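(* (a) Let $G$ be any connected finite simple graph, on $n$ vertices, and let $p\ge1$. Then at least one of the min-max eigenvalues $\lambda_1(\Delta_p),\dots,\lambda_n(\Delta_p)$ lies in $$\begin{cases}\left(2^{p-3},\,2^{p-1}\left(\frac{\sqrt3}{p}\right)^p\right),&\text{if }p<2,\\[4pt] \left[\frac12,\frac32\right],&\text{if }p=2,\\[4pt] \left(\frac{2^{p-1}}{p^p},\,3\times2^{p-3}\right),&\text{if }p>2.\end{cases}$$ (b) Let $G$ be any finite simple graph on $n$ vertices. For $p>1$, at least $\alpha_*(G)$ of the min-max eigenvalues $\lambda_1(\Delta_p),\dots,\lambda_n(\Delta_p)$ (counted with multiplicity, i.e. by index) are larger than $\frac{2^{p-1}}{p^p}$; and at least $\alpha_*(G)$ of the min-max eigenvalues $\lambda_1(\Delta_1),\dots,\lambda_n(\Delta_1)$ (counted with multiplicity) are equal to $1$.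
   Context: Every vertex has degree $\deg(i)\ge1$; $V=\{1,\dots,n\}$ is the vertex set and $E$ the edge set of $G$. For $p\ge1$ and $x\in\mathbb R^n\setminus\{0\}$, $F_p(x)=\frac{\sum_{\{i,j\}\in E}|x_i-x_j|^p}{\sum_{i\in V}\deg(i)|x_i|^p}$. Yang index: for $S\subset\mathbb R^n\setminus\{0\}$ non-empty, compact and centrally symmetric, let $C_*(S)$ be the singular chain complex with $\mathbb Z_2$ coefficients, $T$ the chain map induced by $x\mapsto -x$, $C_*(S,-)=\{c: Tc=c\}$ the subcomplex of symmetric chains, with cycles $Z_q(S,-)$ and homology $H_q(S,-)$. Define homomorphisms $\nu:Z_q(S,-)\to\mathbb Z_2$ inductively: writing $z=c+Tc$, $\nu(z)=\mathrm{In}(c)$ if $q=0$ (where $\mathrm{In}(\sum n_i\sigma_i)=\sum n_i$ mod 2) and $\nu(z)=\nu(\partial c)$ if $q\ge1$. This is well defined, vanishes on boundaries and induces $\nu_*:H_q(S,-)\to\mathbb Z_2$. Then $\gamma(S)=\min\{k\in\mathbb Z^+:\nu_*H_k(S,-)=0\}$; $\gamma(\varnothing)=0$. Min-max eigenvalues of the graph $p$-Laplacian $\Delta_p$: $\lambda_k(\Delta_p)=\inf_{\gamma(S)\ge k}\sup_{x\in S}F_p(x)$, $k=1,\dots,n$, the infimum over compact centrally symmetric $S\subset\mathbb R^n\setminus\{0\}$. Pseudo-independence number: let $\mathcal{SC}_{na}(G)$ be the collection of all families $P=\{V_1,\dots,V_k\}$ of pairwise disjoint non-empty subsets of $V$ such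 that each $V_i$ induces a complete subgraph and the $V_i$ are pairwise non-adjacent, meaning that every edge of $G$ intersects at most one $V_l$. Put $c(P)=\sum_{i=1}^kc(V_i)$ with $c(V_i)=1$ if $|V_i|\le2$ and $c(V_i)=2$ if $|V_i|\ge3$. Then $\alpha_*(G)=\max\{c(P):P\in\mathcal{SC}_{na}(G)\}$.
   Formalization: Part (a) is stated for n ≥ 3: it fails for the graph with two vertices and one edge, whose min-max eigenvalues are 0 and 2^{p-1} (0 and 2 at p = 2, outside [1/2, 3/2]); that graph is excluded for every p, although the claim holds for it when p < √3. *)

(* Defs.v *)
From HB Require Import structures.
From mathcomp Require Import all_boot all_order all_algebra.
From mathcomp Require Import all_classical all_reals all_analysis.
From mathcomp Require Import freeg.
Set Implicit Arguments.
Unset Strict Implicit.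
Unset Printing Implicit Defensive.
Import Order.TTheory GRing.Theory Num.Theory numFieldNormedType.Exports.

Local Open Scope classical_set_scope.
Local Open Scope ring_scope.

Definition simplex (R : realType) (q : nat) : set 'rV[R]_q.+1 :=
  [set x | (forall i, 0 <= x 0 i) /\ \sum_i x 0 i = 1].
Arguments simplex R q _ : clear implicits.

Definition face_fun (R : realType) (q : nat) (i : 'I_q.+2) (x : 'rV[R]_q.+1) :
    'rV[R]_q.+2 :=
  \row_j (if unlift i j is Some k then x 0 k else 0).

Lemma face_fun_simplex (R : realType) (q : nat) (i : 'I_q.+2)
  (x : simplex R q) : face_fun i (val x) \in simplex R q.+1.
Proof.
case: x => x /= /set_mem [x0 x1]; apply/mem_set; split=> [j|].
  by rewrite mxE; case: unliftP.
rewrite (bigD1_ord i) //= mxE unlift_none add0r -x1.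
by apply: eq_bigr => k _; rewrite mxE liftK.
Qed.

(** The inclusion of the standard [q]-simplex as the face opposite to the
    [i]-th vertex of the standard [q.+1]-simplex. *)
Definition face_map (R : realType) (q : nat) (i : 'I_q.+2) (x : simplex R q) :
    simplex R q.+1 :=
  SigSub (face_fun_simplex i x).

Lemma face_map_continuous (R : realType) (q : nat) (i : 'I_q.+2) :
  continuous (@face_map R q i).
Proof.
apply: continuous_comp_initial => /= x.
have val_cont : continuous (set_val : simplex R q -> 'rV[R]_q.+1).
  exact: initial_continuous.
suff face_cont : continuous (@face_fun R q i).
  exact: (continuous_comp (val_cont x) (face_cont (set_val x))).
move=> {x val_cont} x U /nbhs_ballP [e e0 sU].
apply/nbhs_ballP; exists e => //= y [_ xy]; apply: sU; split=> // a j.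
rewrite !mxE; case: unliftP => [k _|_]; last exact: ballxx.
exact: xy.
Qed.

Section SingularChains.
Variable R : realType.

Definition singular (X : topologicalType) (q : nat) :=
  continuousType (simplex R q) X.

Definition chain (X : topologicalType) (q : nat) :=
  {freeg (singular X q) / 'F_2}.

Definition face (X : topologicalType) (q : nat) (s : singular X q.+1)
    (i : 'I_q.+2) : singular X q :=
  [the continuousType _ _ of s \o mkcts (@face_map_continuous R q i)].

(** No signs are needed in characteristic two. *)
Definition boundary (X : topologicalType) (q : nat) (c : chain X q.+1) :
    chain X q :=
  fglift (fun s => \sum_(i < q.+2) << face s i >> : chain X q) c.

(** The boundary of a [0]-chain is zero (and [0.-1 = 0]). *)
Definition boundary_pred (X : topologicalType) (q : nat) :
    chain X q -> chain X q.-1 :=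
  match q with
  | 0 => fun=> 0
  | q'.+1 => @boundary X q'
  end.

Definition push (X Y : topologicalType) (f : continuousType X Y) (q : nat)
    (c : chain X q) : chain Y q :=
  fglift (fun s : singular X q =>
    << ([the continuousType _ _ of f \o s] : singular Y q) >> : chain Y q) c.

Definition coeff_sum (X : topologicalType) (q : nat) (c : chain X q) : 'F_2 :=
  fglift (fun=> 1 : ('F_2)^o) c.

Section Involution.
Variables (X : topologicalType) (t : continuousType X X).

Definition sym_chains (q : nat) : set (chain X q) :=
  [set c | push t c = c].

Definition sym_cycles (q : nat) : set (chain X q) :=
  [set z | sym_chains z /\ boundary_pred z = 0].

Definition sym_boundaries (q : nat) : set (chain X q) :=
  [set boundary c | c in @sym_chains q.+1].

Definition sym_class (q : nat) (z : chain X q) : set (chain X q) :=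
  [set z' | sym_cycles z' /\ sym_boundaries (z' - z)].

(** Homology classes are represented as cosets of the boundaries. *)
Definition sym_homology (q : nat) : set (set (chain X q)) :=
  [set sym_class z | z in @sym_cycles q].

(** Such a [c] exists, and [nu] does not depend on the choice made here, when
    [z] is a symmetric cycle and [t] is a fixed-point-free involution. *)
Definition half (q : nat) (z : chain X q) : chain X q :=
  xget 0 [set c | z = c + push t c].

Fixpoint nu (q : nat) : chain X q -> 'F_2 :=
  match q with
  | 0 => fun z => coeff_sum (half z)
  | q'.+1 => fun z => @nu q' (boundary (half z))
  end.

(** The representative is immaterial: [nu] vanishes on symmetric boundaries. *)
Definition nu_star (q : nat) (h : set (chain X q)) : 'F_2 :=
  nu (xget 0 h).

Definition nu_star_zero (q : nat) : Prop :=
  forall h, @sym_homology q h -> nu_star h = 0.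

(** The minimum over the natural numbers, taken in the extended reals so that
    it is [+oo] if there is no such [k]. The value is [0] for empty [X], and
    [k = 0] never qualifies for nonempty [X] if [t] has no fixed point: it is
    immaterial whether the minimum starts at [0] or at [1] in that case. *)
Definition yang_index : \bar R :=
  ereal_inf [set k%:R%:E | k in [set k | nu_star_zero k]].

End Involution.

Definition centrally_symmetric (n : nat) (S : set 'rV[R]_n) : Prop :=
  forall x, S x -> S (- x).

Lemma antipode_subproof (n : nat) (S : set 'rV[R]_n)
  (symS : centrally_symmetric S) (x : S) : - val x \in S.
Proof. by case: x => x /= /set_mem Sx; apply/mem_set/symS. Qed.

Definition antipode (n : nat) (S : set 'rV[R]_n)
    (symS : centrally_symmetric S) (x : S) : S :=
  SigSub (antipode_subproof symS x).

Lemma antipode_continuous (n : nat) (S : set 'rV[R]_n)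
  (symS : centrally_symmetric S) : continuous (antipode symS).
Proof.
apply: continuous_comp_initial => /= x.
have val_cont : continuous (set_val : S -> 'rV[R]_n).
  exact: initial_continuous.
have opp_cont : continuous (-%R : 'rV[R]_n -> 'rV[R]_n).
  exact: oppr_continuous.
exact: (continuous_comp (val_cont x) (opp_cont (set_val x))).
Qed.

Definition yang (n : nat) (S : set 'rV[R]_n) (symS : centrally_symmetric S) :
    \bar R :=
  yang_index (mkcts (@antipode_continuous n S symS)).

Definition vdeg (n : nat) (e : rel 'I_n) (i : 'I_n) : nat := #|[pred j | e i j]|.

(** Each edge [{i, j}] is counted once, as the pair with [i < j]. *)
Definition rayleigh (n : nat) (e : rel 'I_n) (p : R) (x : 'rV[R]_n) : R :=
  (\sum_(i < n) \sum_(j < n | (i < j)%N && e i j) `|x 0 i - x 0 j| `^ p) /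
  (\sum_(i < n) (vdeg e i)%:R * `|x 0 i| `^ p).

Definition minmax_eigenvalue (n : nat) (e : rel 'I_n) (p : R) (k : nat) :
    \bar R :=
  ereal_inf [set ereal_sup [set (rayleigh e p x)%:E | x in S] |
    S in [set S : set 'rV[R]_n | [/\ compact S, ~ S 0 &
      exists symS : centrally_symmetric S, (k%:R%:E <= yang symS)%E]]].

End SingularChains.

Definition simple_graph (n : nat) (e : rel 'I_n) : Prop :=
  symmetric e /\ irreflexive e.

Definition no_isolated_vertex (n : nat) (e : rel 'I_n) : Prop :=
  forall i, (1 <= vdeg e i)%N.

Definition connected_graph (n : nat) (e : rel 'I_n) : Prop :=
  (0 < n)%N /\ forall i j, connect e i j.

Definition clique (n : nat) (e : rel 'I_n) (A : {set 'I_n}) : bool :=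
  [forall i in A, forall j in A, (i != j) ==> e i j].

Definition nonadjacent_cliques (n : nat) (e : rel 'I_n)
    (P : {set {set 'I_n}}) : bool :=
  [&& finset.trivIset P, finset.set0 \notin P, [forall A in P, clique e A] &
    [forall i, forall j, e i j ==>
      (#|[pred A in P | (i \in A) || (j \in A)]| <= 1)%N]].

Definition clique_weight (n : nat) (A : {set 'I_n}) : nat :=
  if (#|A| <= 2)%N then 1 else 2.

Definition pseudo_independence (n : nat) (e : rel 'I_n) : nat :=
  \max_(P : {set {set 'I_n}} | nonadjacent_cliques e P)
    \sum_(A in P) clique_weight A.

(* Main.v *)
(** Every singular cochain obtained from a sign function by cup products and
    barycentric subdivision computes [nu]; hence a compact symmetric set on which
    [m] odd functions have no common zero has Yang index at most [m], and the
    odd image of the cross-polytope in dimension [k] has index at least [k].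
    So [n - a] odd functions whose common nonzero zeros satisfy [F_p > c] give
    [a] eigenvalues above [c], and an odd map from [R^k] vanishing only at [0] on
    whose image [F_p < c] gives [lambda_k < c].

    The odd homeomorphism [x |-> sign x |x|^t] compares the exponents [p] and
    [t p]: [p (2 F_p)^(1/p)] is increasing and [2^(-p) F_p] decreasing in [p].
    This reduces part (b) to [p = 1], where [F_1 x = 1] if [x] has opposite
    signs (or a zero) on every edge, and part (a) to the normalized Laplacian
    [p = 2]: some eigenvalue of the normalized adjacency matrix [A] lies in
    [[-1/2, 1/2]], since otherwise [A^2 - 1/4] is positive definite, which test
    functions supported near low-degree vertices refute. In the extreme case
    [+-1/2] the strict inequalities come from the rigidity of the comparison. *)

(* [nu] is defined by successive choices of halves. A family of cochains whose coboundary is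
   [g + T g] one degree up makes the choices irrelevant. Subdivision enters because the signs of odd
   functions jump: only on small simplices is one of them sure to be constant.

   The rigidity invoked in the extreme case breaks down on vectors of constant modulus, where the
   comparison of [2^(-p) F_p] is an equality on every edge. Such a vector is an eigenvector for
   [+-1/2] only if [4] divides every degree, so one vertex of degree below [4] rescues strictness.
   If all degrees are at least [4], the trace of [A^2] is at most [n / 4], and as [1] is an
   eigenvalue of [A], some other one lies strictly between [-1/2] and [1/2].

   Both bounds of part (a) must hit the same index. With [mu] the chosen eigenvalue, the odd
   functions kill the eigenvalues above [mu], the odd map spans those that are at least [mu], and
   the number of the latter is an index that serves every [p]. Strict bounds survive the infimum
   over sets because the extrema are attained on compact sets, by homogeneity. *)
Require Import Defs.
From HB Require Import structures.
From mathcomp Require Import all_boot all_order all_algebra.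
From mathcomp Require Import all_classical all_reals all_analysis.
From mathcomp Require Import freeg ring lra zify complex.
Set Implicit Arguments.
Unset Strict Implicit.
Unset Printing Implicit Defensive.
Import Order.TTheory GRing.Theory Num.Theory numFieldNormedType.Exports.
Local Open Scope classical_set_scope.
Local Open Scope ring_scope.

(** * Continuity and compactness *)

Section RowContinuity.
Variable R : realType.

Lemma continuous_sum (T : topologicalType) (I : Type) (r : seq I)
    (P : pred I) (F : I -> T -> R) :
  (forall i, P i -> continuous (F i)) ->
  continuous (fun y => \sum_(i <- r | P i) F i y).
Proof.
move=> Fc; elim: r => [|i r IHr].
  rewrite (_ : (fun y => _) = cst 0); first by move=> x; exact: cst_continuous.
  by apply/funext => y; rewrite big_nil.
case: (boolP (P i)) => Pi.
  rewrite (_ : (fun y => _) = F i \+ (fun y => \sum_(j <- r | P j) F j y)).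
    by move=> x; exact: (continuousD (Fc i Pi x) (IHr x)).
  by apply/funext => y; rewrite big_cons Pi.
rewrite (_ : (fun y => _) = (fun y => \sum_(j <- r | P j) F j y)) //.
by apply/funext => y; rewrite big_cons (negPf Pi).
Qed.

Lemma continuous_row (T : topologicalType) n (F : 'I_n -> T -> R) :
  (forall i, continuous (F i)) -> continuous (fun y => \row_i F i y).
Proof.
move=> Fc x U /nbhs_ballP[e e0 eU]; apply: filterS (_ : nbhs x
  [set y | forall i : 'I_n, ball (F i x) e (F i y)]).
  move=> y yU; apply: eU; split=> // i j; rewrite !mxE; exact: yU.
apply: filter_forall => i; apply: Fc; exact: nbhsx_ballx.
Qed.

Lemma rV_norm_le n (x : 'rV[R]_n) M : 0 <= M -> (forall i, `|x 0 i| <= M) ->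
  `|x| <= M.
Proof.
move=> M0 xM; rewrite [leLHS]/Num.Def.normr/= mx_normrE bigmax_le // => -[i j] _ /=.
by rewrite ord1.
Qed.

Lemma coord_le_norm n (x : 'rV[R]_n) i : `|x 0 i| <= `|x|.
Proof.
rewrite [leRHS]/Num.Def.normr/= mx_normrE; apply/bigmax_geP; right => /=.
by exists (0, i).
Qed.

Lemma compact_rV n (A : set 'rV[R]_n) M : closed A ->
  (forall x, A x -> forall i, `|x 0 i| <= M) -> compact A.
Proof.
move=> Ac AM; apply: bounded_closed_compact => //.
exists (`|M|); split=> // e Me x Ax; apply: rV_norm_le => [|i].
  by rewrite (le_trans _ (ltW Me)).
by rewrite (le_trans (AM x Ax i)) // (le_trans (ler_norm M)) // ltW.
Qed.

Lemma compact_simplex q : compact (simplex R q).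
Proof.
apply: (@compact_rV _ _ 1) => [|x [x0 x1] i]; last first.
  rewrite ger0_norm // -x1 (bigD1 i) //= lerDl sumr_ge0 //.
rewrite (_ : simplex R q = (\bigcap_i [set x : 'rV[R]_q.+1 | 0 <= x 0 i]) `&`
    [set x : 'rV[R]_q.+1 | \sum_i x 0 i = 1]).
  apply: closedI.
    apply: closed_bigI => i _.
    apply: (@preimage_closed _ _ (fun x : 'rV[R]_q.+1 => x 0 i) [set u | 0 <= u]).
      by move=> x _; exact: coord_continuous.
    exact: closed_ge.
  apply: (@preimage_closed _ _ (fun x : 'rV[R]_q.+1 => \sum_i x 0 i) [set u | u = 1]).
    by move=> x _; apply: continuous_sum => i _; exact: coord_continuous.
  exact: closed_eq.
by apply/seteqP; split=> x [x0 x1]; split=> // i; [move=> _|]; exact: x0.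
Qed.

End RowContinuity.

(** * Cochains and barycentric subdivision *)

Section Cochains.
Variable V : eqType.
Implicit Types (g : seq V -> 'F_2) (v w : seq V) (s : nat -> V -> 'F_2).

Lemma addF2 (x : 'F_2) : x + x = 0.
Proof. exact: (addrr_pchar2 (pchar_Fp (isT : prime 2))). Qed.

Lemma oppF2 (x : 'F_2) : - x = x.
Proof. by apply/eqP; rewrite -subr_eq0 -opprD addF2 oppr0. Qed.

Lemma addF2K (x y : 'F_2) : x + (x + y) = y.
Proof. by rewrite addrA addF2 add0r. Qed.

(** Ordered simplices are vertex lists, so that the dimension is a length and cochains of all
    degrees share one type. A single vertex has the empty list as its only face, as in the augmented
    complex. *)
Fixpoint deletions v : seq (seq V) :=
  if v is x :: v' then v' :: map (cons x) (deletions v') else [::].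

Definition coboundary g v : 'F_2 := \sum_(w <- deletions v) g w.

Lemma coboundary_cons g x v :
  coboundary g (x :: v) = g v + coboundary (fun w => g (x :: w)) v.
Proof. by rewrite /coboundary /= big_cons big_map. Qed.

Lemma eq_coboundary g1 g2 : g1 =1 g2 -> coboundary g1 =1 coboundary g2.
Proof. by move=> eq_g v; apply: eq_bigr => w _; apply: eq_g. Qed.

Lemma coboundaryD g1 g2 v :
  coboundary (fun w => g1 w + g2 w) v = coboundary g1 v + coboundary g2 v.
Proof. exact: big_split. Qed.

Lemma coboundaryK g v : coboundary (coboundary g) v = 0.
Proof.
elim: v g => [|x v IHv] g; first by rewrite /coboundary big_nil.
rewrite coboundary_cons (eq_coboundary (fun w => coboundary_cons g x w)).
by rewrite coboundaryD IHv addr0 addF2.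
Qed.

Lemma deletionsP v w : w \in deletions v ->
  (size w).+1 = size v /\ {subset w <= v}.
Proof.
elim: v w => [|x v IHv] w //=; rewrite inE => /predU1P[->|].
  by split=> // y yv; rewrite inE yv orbT.
case/mapP=> u /IHv[<- uv] ->; split=> // y; rewrite !inE => /predU1P[->|/uv ->].
  by rewrite eqxx.
by rewrite orbT.
Qed.

(** The cochain [ds_(q-1) \cup ... \cup ds_0] on [q]-simplices. *)
Fixpoint cup s v : 'F_2 :=
  if v is x :: v' then
    if v' is y :: v'' then (s (size v'') x + s (size v'') y) * cup s v' else 1
  else 0.

Arguments cup : simpl never.

(** The cochain [s_q \cup ds_(q-1) \cup ... \cup ds_0] on [q]-simplices. *)
Definition half_cup s v : 'F_2 :=
  if v is x :: v' then s (size v') x * cup s v else 0.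

Lemma cup_cons s x v : v != [::] ->
  cup s (x :: v) = (s (size v).-1 x + s (size v).-1 (head x v)) * cup s v.
Proof. by case: v. Qed.

(** The faces that omit a vertex after [a] and [b] are summed by induction; in the three terms that
    remain, each of the signs of [a], [b], [c] occurs twice. *)
Lemma coboundary_cup s v : (1 < size v)%N -> coboundary (cup s) v = 0.
Proof.
elim: v => [|a [|b v] IHv] // _; rewrite coboundary_cons.
rewrite coboundary_cons.
case: v IHv => [|c v] IHv; first by rewrite /coboundary /= big_nil addr0 addF2.
have := IHv isT; rewrite coboundary_cons => /eqP; rewrite addr_eq0 => /eqP E.
rewrite [coboundary _ _](_ : _ = (s (size v) a + s (size v) b) *
    coboundary (fun w => cup s (b :: w)) (c :: v)); last first.
  rewrite /coboundary mulr_sumr; apply: eq_big_seq => w /deletionsP[[szw] _].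
  by rewrite (@cup_cons _ a) //= szw.
have {E}-> : coboundary (fun w => cup s (b :: w)) (c :: v) = cup s (c :: v).
  by rewrite E oppF2.
rewrite (@cup_cons _ a) // (@cup_cons _ b) //=.
set A := s _ a; set B := s _ b; set C := s _ c; set D := cup _ _.
have -> : (B + C) * D + ((A + C) * D + (A + B) * D) = D * (A + A + (B + B) + (C + C)).
  by ring.
by rewrite !addF2 mulr0.
Qed.

(** Leibniz rule: [cup] is a cocycle, so only the coboundary of the leading factor survives. On a
    single vertex the identity fails, since [cup] is [1] there and the empty face has value [0]. *)
Lemma coboundary_half_cup s v : (1 < size v)%N ->
  coboundary (half_cup s) v = cup s v.
Proof.
case: v => [|a [|b v]] // _; rewrite coboundary_cons.
rewrite [coboundary _ _](_ : _ = s (size v) a *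
    coboundary (fun w => cup s (a :: w)) (b :: v)); last first.
  rewrite /coboundary mulr_sumr; apply: eq_big_seq => w /deletionsP[[szw] _].
  by rewrite /half_cup szw.
have /eqP := @coboundary_cup s (a :: b :: v) isT.
rewrite coboundary_cons addr_eq0 => /eqP E.
have {E}-> : coboundary (fun w => cup s (a :: w)) (b :: v) = cup s (b :: v).
  by rewrite E oppF2.
by rewrite /half_cup (@cup_cons s a) //= mulrDl addrC.
Qed.

(** Flipping all signs leaves every [ds_j] unchanged, so the two values differ only in the leading
    factor, by [1]. This pairs a simplex with its antipode in the recursion of [nu]. *)
Lemma half_cup_antipode s s' v : v != [::] ->
  {in v, forall x, forall j, s' j x = s j x + 1} ->
  half_cup s v + half_cup s' v = cup s v.
Proof.
move=> v0 ss'; have cupE : cup s' v = cup s v.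
  elim: v {v0} ss' => [|a [|b v] IHv] // ss'.
  rewrite !(@cup_cons _ a) //= IHv; last first.
    by move=> x xv; apply: ss'; rewrite inE xv orbT.
  by rewrite !ss' ?inE ?eqxx ?orbT // addrACA addF2 addr0.
case: v v0 ss' cupE => [|a v] // _ ss' cupE.
by rewrite /half_cup cupE -mulrDl ss' ?inE ?eqxx // addF2K mul1r.
Qed.

(** In dimension [q] all factors [ds_j] with [j < q] occur, and one of them vanishes. This is how
    [m] functions annihilate [m]-simplices. *)
Lemma cup_eq0 s v j c : (j.+1 < size v)%N -> {in v, forall x, s j x = c} ->
  cup s v = 0.
Proof.
elim: v => [|a [|b v] IHv] // jv sc; rewrite cup_cons //=.
case: (ltngtP j (size v)) jv => [jv _|/=|jE _]; [|lia|].
  by rewrite IHv ?mulr0 //= => x xv; apply: sc; rewrite inE xv orbT.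
by rewrite -jE !sc ?inE ?eqxx ?orbT // addF2 mul0r.
Qed.

(** With a single sign function the cochain detects the simplices with alternating signs, the
    quantity counted in Ky Fan's form of Tucker's lemma. *)
Lemma half_cup_alternating (s : V -> 'F_2) x0 v : v != [::] ->
  half_cup (fun=> s) v =
  [forall i : 'I_(size v), s (nth x0 v i) == (~~ odd i)%:R]%:R.
Proof.
move=> v0; have F2E (x : 'F_2) : x = (x == 1)%:R.
  by case: x => [] [|[|//]] i; apply/val_inj.
(* Generalized over the starting sign [c], because the tail alternates from the opposite sign. *)
have E (c : bool) : cup (fun=> s) v * (s (head x0 v) == c%:R)%:R =
    [forall i : 'I_(size v), s (nth x0 v i) == (odd i (+) c)%:R]%:R.
  elim: v v0 c => [|a [|b v] IHv] // _ c.
    rewrite [cup _ _]/= /cup mul1r; congr (nat_of_bool _)%:R.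
    by apply/idP/forallP => [+ [[|//] ilt]|/(_ ord0)].
  have {IHv} := IHv isT (~~ c); rewrite /= => IHv.
  rewrite cup_cons //=.
  have [sa|sa] := eqVneq (s a) c%:R; last first.
    rewrite mulr0 (introF forallP) //.
    by move/(_ ord0); rewrite /= (negPf sa).
  rewrite mulr1 sa.
  have -> : c%:R + s b = (s b == (~~ c)%:R)%:R :> 'F_2.
    case: (s b) (c) => [] [|[|//]] i [|]; apply/val_inj => //=.
  rewrite mulrC IHv; congr (nat_of_bool _)%:R.
  apply/forallP/forallP => /= H.
    case=> [[|i] ilt] /=; first by rewrite sa.
    by have := H (Ordinal (ilt : (i < size (b :: v))%N)); rewrite /= addbN addNb.
  by move=> i; have := H (fintype.lift ord0 i); rewrite /= addbN addNb.
transitivity (cup (fun=> s) v * (s (head x0 v) == true%:R)%:R).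
  by case: v v0 {E} => // a v _; rewrite mulrC -F2E.
by rewrite E; congr (nat_of_bool _)%:R; apply: eq_forallb => i; rewrite addbT.
Qed.

End Cochains.
Arguments cup : simpl never.

Section Subdivision.
Variables (R : realType) (V : lmodType R).
Implicit Types (g : seq V -> 'F_2) (v w : seq V).

Definition barycenter v : V := (size v)%:R^-1 *: \sum_(x <- v) x.

(** The sum of [g] over the simplices of the barycentric subdivision of [v]. *)
Fixpoint subdiv_rec n g v : 'F_2 :=
  if n is n'.+1 then
    \sum_(u <- deletions v) subdiv_rec n' (fun w => g (barycenter v :: w)) u
  else g [::].

Definition subdiv g v : 'F_2 := subdiv_rec (size v) g v.

Lemma subdiv_nil g : subdiv g [::] = g [::].
Proof. by []. Qed.

Lemma subdiv_deletions g v : v != [::] ->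
  subdiv g v = \sum_(u <- deletions v) subdiv (fun w => g (barycenter v :: w)) u.
Proof.
case: v => [|x v] // _; rewrite [LHS]/=; apply: eq_big_seq => u.
by case/deletionsP; rewrite /subdiv => -[->].
Qed.

Lemma eq_subdiv g1 g2 : g1 =1 g2 -> subdiv g1 =1 subdiv g2.
Proof. by move=> /funext->. Qed.

Lemma subdivD g1 g2 v :
  subdiv (fun w => g1 w + g2 w) v = subdiv g1 v + subdiv g2 v.
Proof.
have [n] := ubnP (size v); elim: n g1 g2 v => // n IHn g1 g2 v vn.
have [->|v0] := eqVneq v [::]; first by rewrite !subdiv_nil.
rewrite !subdiv_deletions // -big_split; apply: eq_big_seq => u /deletionsP[su _].
by rewrite IHn //; move: vn su; case: (size v) => //= m mn [->].
Qed.

(** The subdivision is the cone from the barycenter over the subdivided boundary. The faces of a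
    cone are its base and the cones over the faces of the base; the latter are summed over the
    boundary of a boundary and cancel. *)
Lemma subdiv_coboundary g : subdiv (coboundary g) =1 coboundary (subdiv g).
Proof.
move=> v; have [n] := ubnP (size v); elim: n g v => // n IHn g v vn.
have [->|v0] := eqVneq v [::].
  by rewrite subdiv_nil /coboundary !big_nil.
rewrite subdiv_deletions //.
transitivity (\sum_(u <- deletions v) (subdiv g u +
  coboundary (subdiv (fun w => g (barycenter v :: w))) u)); last first.
  by rewrite big_split /= [X in _ + X]coboundaryK addr0.
apply: eq_big_seq => u /deletionsP[su _].
under eq_subdiv do rewrite coboundary_cons.
by rewrite subdivD IHn //; move: vn su; case: (size v) => //= m mn [->].
Qed.

Lemma iter_subdiv_coboundary r g :
  iter r subdiv (coboundary g) =1 coboundary (iter r subdiv g).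
Proof.
elim: r g => [|r IHr] g v //=.
by rewrite (eq_subdiv (IHr g)) subdiv_coboundary.
Qed.

Lemma iter_subdivD r g1 g2 v : iter r subdiv (fun w => g1 w + g2 w) v =
  iter r subdiv g1 v + iter r subdiv g2 v.
Proof.
elim: r v => [|r IHr] v //=; rewrite (eq_subdiv IHr).
exact: subdivD.
Qed.

End Subdivision.

Lemma deletions_map (U V : eqType) (f : U -> V) v :
  deletions (map f v) = map (map f) (deletions v).
Proof.
elim: v => //= x v ->; congr cons; rewrite -!map_comp.
exact: eq_map.
Qed.

Lemma half_cup_map (U V : eqType) (f : U -> V) (s : nat -> V -> 'F_2) w :
  half_cup (fun j x => s j (f x)) w = half_cup s (map f w).
Proof.
suff cupE : cup (fun j x => s j (f x)) w = cup s (map f w).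
  by case: w cupE => //= a w ->; rewrite size_map.
elim: w => [|a [|b w] IHw] //.
by rewrite (@cup_cons _ _ a) // [map _ _]/= (@cup_cons _ _ (f a)) // IHw /= size_map.
Qed.

Lemma subdiv_map (R : realType) (U V : lmodType R) (f : {linear U -> V}) g v :
  subdiv (fun w => g (map f w)) v = subdiv g (map f v).
Proof.
have [n] := ubnP (size v); elim: n g v => // n IHn g v vn.
have [->|v0] := eqVneq v [::]; first by rewrite !subdiv_nil.
have v0' : map f v != [::] by case: (v) v0.
rewrite !subdiv_deletions // deletions_map big_map; apply: eq_big_seq => u.
move=> /deletionsP[su _]; rewrite -IHn; last first.
  by move: vn su; case: (size v) => //= m mn [->].
apply: eq_subdiv => w /=; congr (g (_ :: _)).
by rewrite /barycenter linearZ /= linear_sum size_map big_map.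
Qed.

Lemma iter_subdiv_map (R : realType) (U V : lmodType R) (f : {linear U -> V})
    r g v :
  iter r (@subdiv _ _) (fun w => g (map f w)) v =
  iter r (@subdiv _ _) g (map f v).
Proof.
elim: r v => [|r IHr] v //=; rewrite (eq_subdiv IHr).
exact: subdiv_map.
Qed.

(** * Shrinking of diameters under subdivision *)

Section Mesh.
Variables (R : realType) (V : normedModType R).
Implicit Types (g : seq V -> 'F_2) (v w : seq V) (C : V -> Prop).

(** Convexity, as far as subdivision uses it. *)
Definition bary_closed C :=
  forall v, v != [::] -> {in v, forall x, C x} -> C (barycenter v).

Definition mesh_le (d : R) v := {in v &, forall x y, `|x - y| <= d}.

Lemma barycenterB v y : v != [::] ->
  y - barycenter v = (size v)%:R^-1 *: \sum_(x <- v) (y - x).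
Proof.
move=> v0; have s0 : (size v)%:R != 0 :> R by rewrite pnatr_eq0 size_eq0.
rewrite /barycenter big_split /= sumrN scalerDr scalerN; congr (_ - _).
rewrite big_const_seq count_predT iter_addr_0 -[y *+ _]scaler_nat scalerA.
by rewrite mulVf // scale1r.
Qed.

Lemma bary_closed_ball C y d :
  bary_closed C -> bary_closed (fun x => C x /\ `|y - x| <= d).
Proof.
move=> bC v v0 Cv; split; first by apply: bC => // x /Cv[].
have s0 : 0 < (size v)%:R :> R by rewrite ltr0n lt0n size_eq0.
rewrite barycenterB // normrZ ger0_norm ?invr_ge0 ?(ltW s0) // mulrC.
rewrite ler_pdivrMr // (le_trans (ler_norm_sum _ _ _)) // mulr_natr.
rewrite -iter_addr_0 -(count_predT v) -big_const_seq big_seq [leRHS]big_seq.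
by apply: ler_sum => x /Cv[].
Qed.

(** In the average of the differences [y - x] the term for [y] itself is zero, which leaves one term
    fewer than the number of vertices. *)
Lemma barycenter_dist d v y : 0 <= d -> mesh_le d v -> y \in v ->
  `|barycenter v - y| <= (size v).-1%:R / (size v)%:R * d.
Proof.
move=> d0 dv yv; have v0 : v != [::] by case: (v) yv.
have s0 : 0 < (size v)%:R :> R by rewrite ltr0n lt0n size_eq0.
rewrite distrC barycenterB // normrZ ger0_norm ?invr_ge0 ?(ltW s0) //.
rewrite [_ / _]mulrC -mulrA ler_pM2l ?invr_gt0 //.
rewrite (big_rem _ yv) /= subrr add0r (le_trans (ler_norm_sum _ _ _)) //.
rewrite mulr_natl -iter_addr_0 -(size_rem yv) -(count_predT (rem y v)).
rewrite -big_const_seq big_seq [leRHS]big_seq.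
by apply: ler_sum => x /mem_rem xv; apply: dv.
Qed.

(** Barycentric subdivision shrinks diameters by [N / N.+1] in dimension [N]. *)
Lemma subdiv_eq0 N C d g v : bary_closed C -> {in v, forall x, C x} ->
  (size v <= N.+1)%N -> 0 <= d -> mesh_le d v ->
  (forall w, size w = size v -> {in w, forall x, C x} ->
     mesh_le (N%:R / N.+1%:R * d) w -> g w = 0) ->
  subdiv g v = 0.
Proof.
have [n] := ubnP (size v); elim: n C g v => // n IHn C g v vn bC Cv vN d0 dv g0.
have [vE|v0] := eqVneq v [::].
  by move: g0; rewrite vE subdiv_nil; apply.
have mv : (size v).-1%:R / (size v)%:R <= N%:R / N.+1%:R :> R.
  case: v v0 vN {vn Cv dv g0} => //= x v _ vN.
  rewrite ler_pdivrMr ?ltr0n // mulrAC ler_pdivlMr ?ltr0n //.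
  by rewrite -!natrM ler_nat; lia.
rewrite subdiv_deletions // big1_seq // => u /andP[_ uv].
have [su uvs] := deletionsP uv.
set c := N%:R / N.+1%:R * d.
have bd y : y \in v -> `|barycenter v - y| <= c.
  move=> yv; rewrite (le_trans (barycenter_dist d0 dv yv)) //.
  by rewrite ler_wpM2r.
(* The ball about the barycenter joins the invariant in order to bound the edges from the cone
   point, which the mesh of the subdivided face does not see. *)
apply: (IHn (fun x => C x /\ `|barycenter v - x| <= c)) => //.
- by move: vn; rewrite -su.
- exact: bary_closed_ball.
- by move=> x /uvs xv; split; [exact: Cv|exact: bd].
- by apply: leq_trans vN; rewrite -su.
- by move=> x y /uvs xv /uvs yv; apply: dv.
move=> w sw Cw cw; apply: g0 => [|x|x y]; first by rewrite /= sw.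
  by rewrite inE => /predU1P[->|/Cw[]//]; apply: bC.
have c0 : 0 <= c by rewrite mulr_ge0 ?divr_ge0.
rewrite !inE => /predU1P[->|xw] /predU1P[->|yw]; last exact: cw.
- by rewrite subrr normr0.
- by have [] := Cw _ yw.
- by rewrite distrC; have [] := Cw _ xw.
Qed.

Lemma iter_subdiv_eq0 r N C d g v : bary_closed C -> {in v, forall x, C x} ->
  (size v <= N.+1)%N -> 0 <= d -> mesh_le d v ->
  (forall w, size w = size v -> {in w, forall x, C x} ->
     mesh_le ((N%:R / N.+1%:R) ^+ r * d) w -> g w = 0) ->
  iter r (@subdiv R V) g v = 0.
Proof.
move=> bC; elim: r d v => [|r IHr] d v Cv vN d0 dv g0.
  by apply: g0 => //; rewrite mul1r.
apply: (subdiv_eq0 bC Cv vN d0 dv) => w sw Cw dw.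
apply: (IHr (N%:R / N.+1%:R * d)) => //; rewrite ?sw //.
  by rewrite mulr_ge0 ?divr_ge0.
by move=> w' sw' Cw' dw'; apply: g0 => //; rewrite exprSr -mulrA.
Qed.

(** The difference vanishes on every simplex in [C] of this dimension, so the shrinking lemma
    applies with a crude diameter bound [d]. *)
Lemma eq_iter_subdiv r C g1 g2 v : bary_closed C -> {in v, forall x, C x} ->
  (forall w, size w = size v -> {in w, forall x, C x} -> g1 w = g2 w) ->
  iter r (@subdiv R V) g1 v = iter r (@subdiv R V) g2 v.
Proof.
move=> bC Cv g12; apply/eqP; rewrite -subr_eq0 oppF2 -iter_subdivD; apply/eqP.
pose d : R := \sum_(x <- v) \sum_(y <- v) `|x - y|.
apply: (@iter_subdiv_eq0 r (size v) C d) => //.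
- by rewrite /d !sumr_ge0 // => x _; rewrite sumr_ge0.
- move=> x y xv yv; rewrite /d (big_rem _ xv) /= (big_rem _ yv) /= -!addrA.
  by rewrite lerDl addr_ge0 ?sumr_ge0 // => z _; rewrite sumr_ge0.
by move=> w sw Cw _; rewrite g12 // addF2.
Qed.

End Mesh.

(** * The Yang index *)

Section LinearExtension.
Variable K : choiceType.
Implicit Types c : {freeg K / 'F_2}.

Lemma fgliftD (M : lmodType 'F_2) (f : K -> M) c1 c2 :
  fglift f (c1 + c2) = fglift f c1 + fglift f c2.
Proof.
have fB := lift_is_additive f.
have f0 : fglift f 0 = 0 by rewrite -(subrr c1) fB subrr.
by rewrite -[c2 in LHS]opprK fB -[- c2]sub0r fB f0 sub0r opprK.
Qed.

Lemma fglift0 (M : lmodType 'F_2) (f : K -> M) : fglift f 0 = 0.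
Proof. by rewrite -(subrr 0) (lift_is_additive f) subrr. Qed.

Lemma fglift_sum (M : lmodType 'F_2) (f : K -> M) I (r : seq I) (P : pred I)
    (F : I -> {freeg K / 'F_2}) :
  fglift f (\sum_(i <- r | P i) F i) = \sum_(i <- r | P i) fglift f (F i).
Proof.
by elim/big_rec2: _ => [|i x y _ <-]; rewrite ?fglift0 ?fgliftD.
Qed.

Lemma fgliftU (M : lmodType 'F_2) (f : K -> M) x :
  fglift f (<< x >> : {freeg K / 'F_2}) = f x.
Proof. by rewrite liftU scale1r. Qed.

Lemma freeg_F2_ind (P : {freeg K / 'F_2} -> Prop) : P 0 ->
  (forall x, P << x >>) -> (forall c1 c2, P c1 -> P c2 -> P (c1 + c2)) ->
  forall c, P c.
Proof.
move=> P0 PU PD c; rewrite -(freeg_sumE c); elim/big_ind: _ => // x _.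
case: (coeff x c) => [] [|[|//]] i.
  have -> : Ordinal i = 0 :> 'F_2 by apply/val_inj.
  by rewrite freegU0.
by have -> : Ordinal i = 1 :> 'F_2 by apply/val_inj.
Qed.

Lemma fglift_addf (M : lmodType 'F_2) (f1 f2 : K -> M) c :
  fglift (fun x => f1 x + f2 x) c = fglift f1 c + fglift f2 c.
Proof.
elim/freeg_F2_ind: c => [|x|c1 c2 IH1 IH2]; first by rewrite !fglift0 addr0.
  by rewrite !fgliftU.
by rewrite !fgliftD IH1 IH2 addrACA.
Qed.

Lemma fglift_const0 (M : lmodType 'F_2) c : fglift (fun=> 0 : M) c = 0.
Proof.
elim/freeg_F2_ind: c => [|x|c1 c2 IH1 IH2]; rewrite ?fglift0 ?fgliftU //.
by rewrite fgliftD IH1 IH2 addr0.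
Qed.

Lemma eq_fglift (M : lmodType 'F_2) (f1 f2 : K -> M) :
  f1 =1 f2 -> fglift f1 =1 fglift f2.
Proof. by move=> /funext->. Qed.

Lemma addF2_freeg c : c + c = 0.
Proof.
by apply/eqP/freeg_eqP => x; rewrite coeffD addF2 coeff0.
Qed.

Lemma oppF2_freeg c : - c = c.
Proof. by apply/eqP; rewrite -subr_eq0 -opprD addF2_freeg oppr0. Qed.

Lemma sum_symmetric0 n (H : 'I_n -> 'I_n -> {freeg K / 'F_2}) :
  (forall i j, H i j = H j i) -> (forall i, H i i = 0) ->
  \sum_i \sum_j H i j = 0.
Proof.
move=> Hsym H0; pose S := \sum_(i : 'I_n) \sum_(j : 'I_n | (i < j)%N) H i j.
transitivity (S + S); last exact: addF2_freeg.
transitivity (S + \sum_(i : 'I_n) \sum_(j : 'I_n | (j < i)%N) H i j).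
  rewrite -big_split; apply: eq_bigr => i _ /=.
  rewrite (bigID (fun j : 'I_n => (i < j)%N)) /=; congr (_ + _).
  rewrite (bigD1 i) /= ?ltnn // H0 add0r; apply: eq_bigl => j.
  by rewrite -leqNgt ltn_neqAle andbC.
congr (_ + _); rewrite (exchange_big_dep xpredT) //=.
by apply: eq_bigr => j _; apply: eq_bigr => i _; rewrite Hsym.
Qed.

End LinearExtension.

Lemma fglift_comp (K L : choiceType) (M : lmodType 'F_2) (f : L -> M)
    (h : K -> {freeg L / 'F_2}) (c : {freeg K / 'F_2}) :
  fglift f (fglift h c) = fglift (fun x => fglift f (h x)) c.
Proof.
elim/freeg_F2_ind: c => [|x|c1 c2 IH1 IH2]; first by rewrite !fglift0.
  by rewrite !fgliftU.
by rewrite !fgliftD IH1 IH2.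
Qed.

Section Chains.
Variables (R : realType) (X : topologicalType).

(** The simplicial identity in a form symmetric in [i] and [k]: both sides omit these two
    vertices. *)
Lemma lift_swap n (i k : 'I_n.+2) (j j' : 'I_n.+1) (m : 'I_n) :
  k = fintype.lift i j -> i = fintype.lift k j' ->
  fintype.lift i (fintype.lift j m) = fintype.lift k (fintype.lift j' m).
Proof.
move=> /(congr1 val) /= ki /(congr1 val) /= ik; apply/val_inj => /=.
by move: ki ik; rewrite /bump; lia.
Qed.

Lemma face_funC q (i k : 'I_q.+3) (j j' : 'I_q.+2) (x : 'rV[R]_q.+1) :
  k = fintype.lift i j -> i = fintype.lift k j' ->
  face_fun i (face_fun j x) = face_fun k (face_fun j' x).
Proof.
move=> ki ik; apply/rowP => l; rewrite !mxE.
case: (unliftP i l) => [l1 lE|->]; last first.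
  by rewrite ik liftK mxE unlift_none.
rewrite mxE; case: (unliftP j l1) lE => [m ->|->] lE; last first.
  by rewrite lE -ki unlift_none.
by rewrite lE (lift_swap _ ki ik) liftK mxE liftK.
Qed.

Lemma face_face q (s : singular R X q.+2) (i k : 'I_q.+3) (j j' : 'I_q.+2) :
  k = fintype.lift i j -> i = fintype.lift k j' ->
  face (face s i) j = face (face s k) j'.
Proof.
move=> ki ik; apply/continuousEP => x /=; congr (s _).
by apply/val_inj => /=; exact: face_funC.
Qed.

Lemma boundaryK q (c : chain R X q.+2) : boundary (boundary c) = 0.
Proof.
rewrite /boundary fglift_comp; under eq_fglift => s.
  rewrite fglift_sum; under eq_bigr do rewrite fgliftU.
  (* [H i k] omits the vertices [i] and [k]. It is symmetric, so the double sum cancels in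
     characteristic two. *)
  pose H (i k : 'I_q.+3) : chain R X q :=
    if unlift i k is Some j then << face (face s i) j >> else 0.
  rewrite (_ : \sum_i _ = \sum_i \sum_k H i k); last first.
    apply: eq_bigr => i _; rewrite (bigD1_ord i) //= {1}/H unlift_none add0r.
    by apply: eq_bigr => j _; rewrite /H liftK.
  rewrite sum_symmetric0; first over.
    move=> i k; rewrite /H; case: unliftP => [j ki|->]; last first.
      by rewrite unlift_none.
    case: unliftP => [j' ik|ik]; first by rewrite (face_face s ki ik).
    by move: ki; rewrite ik => /eqP; rewrite (negPf (neq_lift _ _)).
  by move=> i; rewrite /H unlift_none.
exact: fglift_const0.
Qed.

End Chains.

Lemma simplex_delta (R : realType) q (i : 'I_q.+1) :
  simplex R q (delta_mx 0 i).
Proof.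
split=> [j|]; first by rewrite mxE eqxx /=; case: eqP.
rewrite (bigD1 i) //= mxE !eqxx big1 ?addr0 // => j ji.
by rewrite mxE eqxx (negPf ji).
Qed.

Definition vertex (R : realType) q (i : 'I_q.+1) : simplex R q :=
  SigSub (mem_set (simplex_delta R i)).

Section Involution.
Variables (R : realType) (X : topologicalType) (t : continuousType X X).
Variable s0 : X -> 'F_2.
Hypothesis s0t : forall x, s0 (t x) = s0 x + 1.

Definition turn q (s : singular R X q) : singular R X q :=
  [the continuousType _ _ of t \o s].

Lemma face_turn q (s : singular R X q.+1) i : face (turn s) i = turn (face s i).
Proof. exact/continuousEP. Qed.

Lemma push_boundary q (c : chain R X q.+1) :
  push t (boundary c) = boundary (push t c).
Proof.
rewrite /push /boundary !fglift_comp; apply: eq_fglift => s.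
rewrite fglift_sum fgliftU; apply: eq_bigr => i _.
by rewrite fgliftU -/(turn _) -face_turn.
Qed.

(** The sign [s0] of the first vertex splits the singular simplices into two classes exchanged by
    [t]; the part of [z] in one class is a half. *)
Lemma half_exists q (z : chain R X q) : push t z = z ->
  exists c, z = c + push t c.
Proof.
move=> zs; pose pos (s : singular R X q) := s0 (s (vertex R ord0)).
pose part (b : 'F_2) : chain R X q -> chain R X q :=
  fglift (fun s : singular R X q => << s >> *+ (pos s == b) : chain R X q).
have F2P (b : 'F_2) : (b == 0) || (b == 1).
  by case: b => [] [|[|//]].
have zE c : c = part 0 c + part 1 c.
  elim/freeg_F2_ind: c => [|s|c1 c2 IH1 IH2].
  - by rewrite /part !fglift0 addr0.
  - rewrite /part !fgliftU; case/orP: (F2P (pos s)) => /eqP->.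
      by rewrite eqxx mulr1n addr0.
    by rewrite eqxx mulr1n add0r.
  by rewrite {1}IH1 {1}IH2 /part !fgliftD addrACA.
have partP b c : push t (part b c) = part (b + 1) (push t c).
  rewrite /push /part !fglift_comp; apply: eq_fglift => s; rewrite fgliftU.
  have -> : (pos (turn s) == b + 1) = (pos s == b).
    by rewrite /pos /= s0t (inj_eq (addIr 1)).
  by case: eqP => _; rewrite ?mulr1n ?fgliftU ?mulr0n ?fglift0.
exists (part 0 z); rewrite partP zs add0r; exact: zE.
Qed.

Lemma half_spec q (z : chain R X q) : push t z = z ->
  z = Defs.half t z + push t (Defs.half t z).
Proof.
move=> /half_exists zc; rewrite /Defs.half.
exact: (@xgetPex _ 0 [set c | z = c + push t c] zc).
Qed.

Section Formula.
Variable g : forall q, singular R X q -> ('F_2)^o.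
Hypothesis g0 : forall s : singular R X 0, g s + g (turn s) = 1.
Hypothesis gS : forall q (s : singular R X q.+1),
  \sum_i g (face s i) = g s + g (turn s).

(** Stokes' formula, the coboundary of [g] being [g] plus its translate by [t] one degree up. *)
Lemma fglift_boundary q (c : chain R X q.+1) :
  fglift (@g q) (boundary c) = fglift (@g q.+1) (c + push t c).
Proof.
rewrite fgliftD /boundary /push !fglift_comp -fglift_addf.
apply: eq_fglift => s; rewrite fglift_sum fgliftU -/(turn s) -gS.
by apply: eq_bigr => i _; rewrite fgliftU.
Qed.

Lemma fglift_sym_boundary q (c : chain R X q.+1) : push t c = c ->
  fglift (@g q) (boundary c) = 0.
Proof. by move=> ct; rewrite fglift_boundary ct fgliftD addF2. Qed.

(** The boundaries of the half and of its translate add up to that of [z], which is zero, so modulo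
    two they are equal. *)
Lemma boundary_half q (z : chain R X q.+1) : sym_cycles t z ->
  sym_cycles t (boundary (Defs.half t z)).
Proof.
move=> [zs zb]; split; last by case: q z zs zb => // q z _ _; exact: boundaryK.
rewrite /sym_chains /= push_boundary; have zE := half_spec zs.
have : boundary (Defs.half t z + push t (Defs.half t z)) = 0 by rewrite -zE.
by rewrite /boundary fgliftD => /eqP; rewrite addr_eq0 oppF2_freeg => /eqP.
Qed.

(** The recursion replaces [z] by the boundary of its half, and by Stokes' formula both have the
    same value under [g]. Hence the choice of halves does not matter. *)
Lemma nuE q (z : chain R X q) : sym_cycles t z -> nu t z = fglift (@g q) z.
Proof.
elim: q z => [|q IHq] z zc; last first.
  by rewrite /= IHq; [rewrite fglift_boundary -half_spec //; case: zc|
    exact: boundary_half].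
rewrite /= {2}(half_spec zc.1) fgliftD /push fglift_comp -fglift_addf /coeff_sum.
apply: (@eq_fglift _ ('F_2)^o) => s; rewrite fgliftU -/(turn s).
exact: esym (g0 s).
Qed.

End Formula.

Lemma sym_class_repr q (z : chain R X q) : sym_cycles t z ->
  sym_class t z (xget 0 (sym_class t z)).
Proof.
move=> zc; apply: (@xgetI _ 0 _ z); split=> //; exists 0.
  by rewrite /sym_chains /= /push fglift0.
by rewrite subrr /boundary fglift0.
Qed.

Lemma nu_star_zeroW q : (forall z : chain R X q, sym_cycles t z -> nu t z = 0) ->
  nu_star_zero R t q.
Proof. by move=> nu0 h [z zc <-]; have [z'c _] := sym_class_repr zc; exact: nu0. Qed.

End Involution.

(** The representative taken by [nu_star] differs from [z] by the boundary of a symmetric chain,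
    where [g] vanishes; so one symmetric cycle of value [1] suffices. *)
Lemma nu_star_nonzero (R : realType) (X : topologicalType)
    (t : continuousType X X) (s0 : X -> 'F_2)
    (g : forall q, singular R X q -> ('F_2)^o) :
  (forall x, s0 (t x) = s0 x + 1) ->
  (forall s : singular R X 0, g 0%N s + g 0%N (turn t s) = 1) ->
  (forall q (s : singular R X q.+1),
     \sum_i g q (face s i) = g q.+1 s + g q.+1 (turn t s)) ->
  forall q (z : chain R X q), sym_cycles t z -> fglift (g q) z = 1 ->
  ~ nu_star_zero R t q.
Proof.
move=> s0t g0 gS q z zc z1 /(_ (sym_class t z)).
have [z'c [c cs cE]] := sym_class_repr zc.
rewrite /nu_star (nuE s0t g0 gS z'c) => /(_ (ex_intro2 _ _ z zc erefl)) z'0.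
move: (fglift_sym_boundary gS cs); rewrite cE oppF2_freeg fgliftD z'0 z1 add0r.
by move/eqP; rewrite oner_eq0.
Qed.

Lemma simplex_bary_closed (R : realType) q : bary_closed (simplex R q).
Proof.
move=> v v0 Cv; have s0 : 0 < (size v)%:R :> R by rewrite ltr0n lt0n size_eq0.
rewrite /barycenter; split=> [i|].
  rewrite mxE mulr_ge0 ?invr_ge0 ?(ltW s0) // summxE big_seq sumr_ge0 //.
  by move=> x /Cv[].
under eq_bigr do rewrite mxE summxE; rewrite -mulr_sumr exchange_big /=.
rewrite big_seq (eq_bigr (fun=> 1)) => [|x /Cv[]//]; rewrite -big_seq.
by rewrite big_const_seq count_predT iter_addr_0 mulVf ?gt_eqF.
Qed.

Section FaceLinear.
Variables (R : realType) (q : nat) (i : 'I_q.+2).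

Fact face_fun_linear : linear (@face_fun R q i).
Proof.
move=> a x y; apply/rowP => j; rewrite !mxE.
by case: unliftP => [k _|_]; rewrite ?mxE // mulr0 addr0.
Qed.

HB.instance Definition _ :=
  GRing.isLinear.Build R 'rV[R]_q.+1 'rV[R]_q.+2 _ (@face_fun R q i)
    face_fun_linear.

Lemma face_fun_delta (k : 'I_q.+1) :
  face_fun i (delta_mx 0 k : 'rV[R]_q.+1) = delta_mx 0 (fintype.lift i k).
Proof.
apply/rowP => j; rewrite !mxE eqxx /=; case: unliftP => [l ->|->].
  by rewrite mxE eqxx /= (inj_eq (@lift_inj _ _)).
by rewrite (negPf (neq_lift _ _)).
Qed.

Lemma face_fun_simplexE (x : 'rV[R]_q.+1) :
  (face_fun i x \in simplex R q.+1) = (x \in simplex R q).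
Proof.
apply/idP/idP => /set_mem H; last first.
  exact: (@face_fun_simplex _ _ i (SigSub (mem_set H))).
have [H0 H1] := H; apply/mem_set; split=> [j|].
  by have := H0 (fintype.lift i j); rewrite mxE liftK.
rewrite -H1 (bigD1_ord i) //= mxE unlift_none add0r.
by apply: eq_bigr => k _; rewrite mxE liftK.
Qed.

End FaceLinear.

Lemma deletions_enum n (V : eqType) (f : 'I_n.+1 -> V) :
  deletions [seq f k | k <- enum 'I_n.+1] =
  [seq [seq f (fintype.lift i k) | k <- enum 'I_n] | i <- enum 'I_n.+1].
Proof.
elim: n f => [|n IHn] f.
  by rewrite enum_ordSl (size0nil (size_enum_ord 0)).
rewrite enum_ordSl /=; congr cons; first by rewrite -map_comp.
rewrite -map_comp (IHn (f \o fintype.lift ord0)) -!map_comp; apply: eq_map => i.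
rewrite /= [in RHS]enum_ordSl /= -map_comp; congr cons; last first.
  by apply: eq_map => k /=; congr f; apply/val_inj; rewrite /= /bump; lia.
by congr f; apply/val_inj.
Qed.

Definition vertices (R : realType) q : seq 'rV[R]_q.+1 :=
  [seq delta_mx 0 i | i <- enum 'I_q.+1].

Lemma deletions_vertices (R : realType) q : deletions (vertices R q.+1) =
  [seq [seq face_fun i x | x <- vertices R q] | i <- enum 'I_q.+2].
Proof.
rewrite /vertices deletions_enum; apply: eq_map => i; rewrite -[in RHS]map_comp.
by apply: eq_map => k; rewrite /= face_fun_delta.
Qed.

Lemma vertices_simplex (R : realType) q :
  {in vertices R q, forall x, simplex R q x}.
Proof. by move=> _ /mapP[i _ ->]; exact: simplex_delta. Qed.

Lemma size_vertices (R : realType) q : size (vertices R q) = q.+1.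
Proof. by rewrite size_map size_enum_ord. Qed.

Section SignCochain.
Variables (R : realType) (X : topologicalType) (t : continuousType X X).
Variable s : nat -> X -> 'F_2.
Hypothesis st : forall j x, s j (t x) = s j x + 1.

(** Signs are pulled back to the ambient row space because subdivision is defined in a vector space.
    Off the simplex the value [0] is a default that subdivision never meets. *)
Definition sign_on q (c : singular R X q) j (x : 'rV[R]_q.+1) : 'F_2 :=
  oapp (fun y : simplex R q => s j (c y)) 0 (insub x).

Lemma sign_on_val q (c : singular R X q) j (x : simplex R q) :
  sign_on c j (val x) = s j (c x).
Proof. by rewrite /sign_on valK. Qed.

Lemma sign_on_face q (c : singular R X q.+1) i j x :
  sign_on (face c i) j x = sign_on c j (face_fun i x).
Proof.
have [xs|xs] := boolP (x \in simplex R q); last first.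
  by rewrite /sign_on !insubN ?face_fun_simplexE.
rewrite (_ : x = val (SigSub xs : simplex R q)) // sign_on_val.
rewrite (_ : face_fun i _ = val (face_map i (SigSub xs : simplex R q))) //.
by rewrite sign_on_val.
Qed.

Lemma sign_on_turn q (c : singular R X q) j x : simplex R q x ->
  sign_on (turn t c) j x = sign_on c j x + 1.
Proof.
move=> /mem_set xs; rewrite (_ : x = val (SigSub xs : simplex R q)) //.
by rewrite !sign_on_val /= st.
Qed.

(** Every number [r] of subdivisions gives a cochain computing [nu]. *)
Definition sign_cochain r q (c : singular R X q) : ('F_2)^o :=
  iter r (@subdiv R _) (half_cup (sign_on c)) (vertices R q).

Lemma sign_cochain_turn r q (c : singular R X q) :
  sign_cochain r c + sign_cochain r (turn t c) =
  iter r (@subdiv R _) (cup (sign_on c)) (vertices R q).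
Proof.
rewrite -iter_subdivD; apply: eq_iter_subdiv (@simplex_bary_closed R q) _ _.
  exact: vertices_simplex.
move=> w sw Cw; apply: half_cup_antipode => [|x xw j].
  by rewrite -size_eq0 sw size_vertices.
by rewrite sign_on_turn //; exact: Cw.
Qed.

Lemma sign_cochain0 r (c : singular R X 0) :
  sign_cochain r c + sign_cochain r (turn t c) = 1.
Proof.
rewrite sign_cochain_turn; transitivity
    (iter r (@subdiv R _) (fun w => (size w == 1%N)%:R) (vertices R 0)).
  apply: eq_iter_subdiv (@simplex_bary_closed R 0) _ _.
    exact: vertices_simplex.
  by move=> w; rewrite size_vertices; case: w => [|a [|]].
have: size (vertices R 0) = 1%N by rewrite size_vertices.
elim: r (vertices R 0) => [|r IHr] v sv /=; first by rewrite sv.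
case: v sv => [|a [|]] // _; rewrite /subdiv /= big_seq1 IHr //.
Qed.

(** Subdivision commutes with coboundaries, the Leibniz rule turns [half_cup] into [cup], and the
    linear face maps carry the standard vertices to the faces of the vertex list. *)
Lemma sign_cochainS r q (c : singular R X q.+1) :
  \sum_i sign_cochain r (face c i) = sign_cochain r c + sign_cochain r (turn t c).
Proof.
rewrite sign_cochain_turn.
rewrite -(@eq_iter_subdiv _ _ r (simplex R q.+1) (coboundary (half_cup (sign_on c)))).
- rewrite iter_subdiv_coboundary /coboundary deletions_vertices big_map big_enum.
  apply: eq_bigr => i _; rewrite -iter_subdiv_map; rewrite /sign_cochain; congr (iter _ _ _ _).
  apply/funext => w; rewrite -half_cup_map; congr (half_cup _ _).
  by apply/funext => j; apply/funext => x; exact: sign_on_face.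
- exact: simplex_bary_closed.
- exact: vertices_simplex.
by move=> w sw Cw; apply: coboundary_half_cup; rewrite sw size_vertices.
Qed.

Lemma nu_sign_cochain r q (z : chain R X q) : sym_cycles t z ->
  nu t z = fglift (@sign_cochain r q) z.
Proof.
exact: (nuE (st 0%N) (@sign_cochain0 r) (@sign_cochainS r)).
Qed.

End SignCochain.

Lemma fglift_dom0 (K : choiceType) (M : lmodType 'F_2) (f : K -> M)
    (c : {freeg K / 'F_2}) :
  (forall x, x \in dom c -> f x = 0) -> fglift f c = 0.
Proof.
move=> f0; rewrite -(freeg_sumE c) fglift_sum big1_seq // => x /andP[_ xc].
by rewrite liftU f0 // scaler0.
Qed.

Lemma eventually_seq (T : eqType) (P : T -> nat -> Prop) (r : seq T) :
  (forall x, x \in r -> \forall n \near \oo, P x n) ->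
  \forall n \near \oo, forall x, x \in r -> P x n.
Proof.
elim: r => [|a r IHr] Pr; first by near=> n.
have Pa := Pr a (mem_head a r).
have /IHr{}IHr : forall x, x \in r -> \forall n \near \oo, P x n.
  by move=> x xr; apply: Pr; rewrite inE xr orbT.
near=> n => x; rewrite inE => /predU1P[->|]; first by near: n.
by move: x; near: n.
Unshelve. all: by end_near. Qed.

Lemma local_sign (R : realType) (X : topologicalType) q
    (c : singular R X q) (F : X -> R) (x : simplex R q) :
  continuous F -> F (c x) != 0 ->
  exists2 e, 0 < e & forall y : simplex R q, `|val x - val y| < e ->
    (F (c y) != 0) && ((0 < F (c y)) == (0 < F (c x))).
Proof.
move=> Fc Fx.
have cFc : {for x, continuous (F \o c)}.
  by apply: continuous_comp; [exact: cts_fun|exact: Fc].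
have /cFc : nbhs ((F \o c) x) [set u | (u != 0) && ((0 < u) == (0 < F (c x)))].
  have [Fx0|Fx0|Fx0] := ltgtP 0 (F (c x)); last by rewrite -Fx0 eqxx in Fx.
    near=> u; have u0 : 0 < u by near: u; exact: lt_nbhsr.
    by rewrite /= u0 gt_eqF.
  near=> u; have u0 : u < 0 by near: u; exact: lt_nbhsl.
  by rewrite /= lt_eqF // ltNge (ltW u0).
move=> [? [[B Bo <-] /= Bx BsubV]].
have : nbhs (val x) B by exact: open_nbhs_nbhs.
move=> /nbhs_ballP[e e0 eB]; exists e => // y xy; apply: BsubV; apply: eB.
by rewrite -ball_normE.
Unshelve. all: by end_near. Qed.

(** * Upper bound on the index: odd functions without a common zero *)

Section OddMap.
Variables (R : realType) (X : topologicalType) (t : continuousType X X).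
Variable s0 : X -> 'F_2.
Hypothesis s0t : forall x, s0 (t x) = s0 x + 1.
Variables (m : nat) (F : 'I_m -> X -> R).
Hypothesis F_continuous : forall j, continuous (F j).
Hypothesis F_odd : forall j x, F j (t x) = - F j x.
Hypothesis F_neq0 : forall x, exists j, F j x != 0.

(** At a zero of [F_j], and for [j >= m], the sign [s0] takes over, so that oddness holds
    everywhere. The sign of [F_j] is locally constant only where [F_j] is nonzero. *)
Definition coord_sign j (x : X) : 'F_2 :=
  if insub j is Some i then if F i x != 0 then (0 < F i x)%R%:R else s0 x else s0 x.

Lemma coord_sign_odd j x : coord_sign j (t x) = coord_sign j x + 1.
Proof.
rewrite /coord_sign; case: insub => [i|//]; rewrite F_odd oppr_eq0 oppr_gt0.
case: (ltgtP (F i x) 0) => _ //=; last exact: (esym (addF2 1)).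
by rewrite add0r.
Qed.

(** A Lebesgue number: near each point some [F_j] is nonzero and keeps its sign, and the simplex is
    compact. *)
Lemma coord_sign_mesh q (c : singular R X q) : exists2 e : R, 0 < e &
  forall x, simplex R q x -> exists2 j, (j < m)%N & exists b,
    forall y, simplex R q y -> `|x - y| <= e -> sign_on coord_sign c j y = b.
Proof.
pose P (e : R) (x : 'rV[R]_q.+1) := exists2 j, (j < m)%N & exists b,
  forall y, simplex R q y -> `|x - y| <= e -> sign_on coord_sign c j y = b.
have /compact_near_coveringP/(_ R 0^'+ P _) cover := @compact_simplex R q.
suff : \forall e \near 0^'+, simplex R q `<=` P e.
  move=> H; have : \forall e \near (0 : R)^'+, 0 < e /\ simplex R q `<=` P e.
    by near=> e; split; near: e => //; exact: nbhs_right_gt.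
  by move=> /filter_ex[e [e0 eP]]; exists e.
apply: cover => x xs; have [j Fj] := F_neq0 (c (SigSub (mem_set xs))).
have [d d0 dF] := local_sign (@F_continuous j) Fj.
near=> x' e.
have xx' : `|x - x'| < d / 2.
  near: x'; apply/nbhs_ballP; exists (d / 2) => /=; first by rewrite divr_gt0.
  by move=> u; rewrite -ball_normE.
have ed : e <= d / 2 by near: e; apply: nbhs_right_le; exact: divr_gt0.
exists j => //; exists (0 < F j (c (SigSub (mem_set xs))))%R%:R => y ys /= xy.
have : `|x - y| < d.
  rewrite -(subrKA x') (le_lt_trans (ler_normD _ _)) // [ltRHS]splitr.
  by rewrite ltr_leD // (le_trans xy).
rewrite (_ : y = val (SigSub (mem_set ys) : simplex R q)) // => /dF.
rewrite sign_on_val /coord_sign valK => /andP[-> /eqP ->] //.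
Unshelve. all: by end_near. Qed.

(** On a small enough [m]-simplex some sign with [j < m] is constant, so a factor [ds_j] vanishes,
    and with it the cochain after enough subdivisions. *)
Lemma nu_star_zero_odd_map : nu_star_zero R t m.
Proof.
apply: nu_star_zeroW => z zc.
have cochain0 (c : singular R X m) :
    \forall r \near \oo, sign_cochain coord_sign r c = 0.
  have [e e0 mesh] := coord_sign_mesh c.
  pose d : R := \sum_(x <- vertices R m) \sum_(y <- vertices R m) `|x - y|.
  have d0 : 0 <= d by rewrite /d !sumr_ge0 // => x _; rewrite sumr_ge0.
  have small : \forall r \near \oo, (m%:R / m.+1%:R) ^+ r * d <= e.
    have : (m%:R / m.+1%:R : R) ^+ r * d @[r --> \oo] --> 0 * d.
      apply: cvgMl; apply: cvg_expr; rewrite ger0_norm ?divr_ge0 //.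
      by rewrite ltr_pdivrMr ?ltr0n // mul1r ltr_nat.
    by rewrite mul0r => /cvgr_le; apply.
  near=> r; apply: (@iter_subdiv_eq0 _ _ r m (simplex R m) d) => //.
  - exact: simplex_bary_closed.
  - exact: vertices_simplex.
  - by rewrite size_vertices.
  - move=> x y xv yv; rewrite /d (big_rem _ xv) /= (big_rem _ yv) /= -!addrA.
    by rewrite lerDl addr_ge0 ?sumr_ge0 // => u _; rewrite sumr_ge0.
  move=> [|x w] // sw Cw mw; have [j jm [b jb]] := mesh x (Cw x (mem_head x w)).
  rewrite /half_cup (@cup_eq0 _ _ _ j b) ?mulr0 //.
    by rewrite sw size_vertices.
  move=> y yw; apply: jb; first exact: Cw.
  rewrite (le_trans (mw _ _ (mem_head x w) yw)) //; near: r; exact: small.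
(* A chain has finitely many simplices, so one number [r] of subdivisions serves them all. *)
have [r _ /(_ r (leqnn r)) r0] := eventually_seq (fun c (_ : c \in dom z) => cochain0 c).
rewrite (nu_sign_cochain coord_sign_odd r zc).
exact: (@fglift_dom0 _ ('F_2)^o).
Unshelve. all: by end_near. Qed.

End OddMap.

Section LexSign.
Variables (R : realType) (n : nat) (S : set 'rV[R]_n).
Hypothesis S0 : ~ S 0.
Hypothesis symS : centrally_symmetric S.

(** Tells each point from its antipode, as needed to halve symmetric chains. *)
Definition lex_sign (x : S) : 'F_2 :=
  if [pick i | val x 0 i != 0] is Some i then (0 < val x 0 i)%R%:R else 0.

Lemma lex_sign_odd (x : S) : lex_sign (antipode symS x) = lex_sign x + 1.
Proof.
rewrite /lex_sign (eq_pick (Q := fun i => val x 0 i != 0)); last first.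
  by move=> i; rewrite /= mxE oppr_eq0.
case: pickP => [i|x0].
  rewrite /= mxE oppr_gt0; case: (ltgtP (val x 0 i) 0) => _ //= _.
    by rewrite add0r.
  exact: (esym (addF2 1)).
case: S0; rewrite (_ : 0 = val x); first exact/set_mem/valP.
by apply/rowP => i; rewrite mxE; have /negbFE/eqP := x0 i.
Qed.

(** A form of the Borsuk-Ulam theorem. *)
Lemma yang_le m (F : 'I_m -> 'rV[R]_n -> R) :
  (forall j, continuous (F j)) -> (forall j x, F j (- x) = - F j x) ->
  (forall x, S x -> exists j, F j x != 0) -> (yang symS <= m%:R%:E)%E.
Proof.
move=> Fc Fo F0; rewrite /yang /yang_index; apply: ereal_inf_lbound.
exists m => //=; have H := @nu_star_zero_odd_map R _ (mkcts (@antipode_continuous R n S symS))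
  lex_sign lex_sign_odd m (fun j (x : S) => F j (val x)). apply: H.
- move=> j x; apply: continuous_comp; last exact: Fc.
  exact: initial_continuous.
- by move=> j x; exact: Fo.
by move=> x; apply: F0; exact/set_mem/valP.
Qed.

End LexSign.

Lemma addF2_bool (a : 'F_2) (b c : bool) :
  (a + b%:R == c%:R) = (b == (a != c%:R)).
Proof. by case: a b c => [] [|[|//]] i [] []. Qed.

(** * Lower bound on the index: images of the cross-polytope *)

Section CrossPolytope.
Variables (R : realType) (k n : nat) (f : 'rV[R]_k -> 'rV[R]_n).
Hypothesis f_continuous : continuous f.
Hypothesis f_odd : forall x, f (- x) = - f x.
Hypothesis f_eq0 : forall x, f x = 0 -> x = 0.

(** A sphere whose facets are simplices, which gives explicit symmetric cycles. *)
Definition cross_polytope : set 'rV[R]_k := [set a | \sum_i `|a 0 i| = 1].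
Definition cross_image : set 'rV[R]_n := [set f a | a in cross_polytope].

Lemma cross_image_compact : compact cross_image.
Proof.
apply: continuous_compact; first exact: continuous_subspaceT.
apply: (@compact_rV _ _ _ 1) => [|x <- i]; last first.
  by rewrite (bigD1 i) //= lerDl sumr_ge0.
apply: (@preimage_closed _ _ (fun x : 'rV[R]_k => \sum_i `|x 0 i|) [set u | u = 1]).
  move=> x _; apply: continuous_sum => i _ y.
  by apply: continuous_comp; [exact: coord_continuous|exact: norm_continuous].
exact: closed_eq.
Qed.

Lemma cross_image_neq0 : ~ cross_image 0.
Proof.
move=> [a a1 /f_eq0 a0]; move: a1; rewrite /cross_polytope /= a0 big1.
  by move/esym/eqP; rewrite oner_eq0.
by move=> i _; rewrite mxE normr0.
Qed.

Lemma cross_image_sym : centrally_symmetric cross_image.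
Proof.
move=> _ [a a1 <-]; exists (- a); last exact: f_odd.
by rewrite /cross_polytope /= -a1; apply: eq_bigr => i _; rewrite mxE normrN.
Qed.

Let t : continuousType cross_image cross_image :=
  mkcts (@antipode_continuous R n _ cross_image_sym).

Section Facets.
Variables (j : nat) (jk : (j < k)%N).
Implicit Types (e : {ffun 'I_j.+1 -> bool}) (x : 'rV[R]_j.+1).

Definition facet_fun e x : 'rV[R]_k := \row_l
  (if insub (val l) is Some i then (-1) ^+ e i * x 0 i else 0).

Lemma facet_fun_cross e (x : simplex R j) : cross_polytope (facet_fun e (val x)).
Proof.
have [x0 x1] : simplex R j (val x) by exact/set_mem/valP.
rewrite /cross_polytope /= -x1.
pose G l : R := if insub l is Some i then val x 0 i else 0.
rewrite (eq_bigr (fun l : 'I_k => G l)); last first.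
  move=> l _; rewrite mxE /G; case: insub => [i|]; last by rewrite normr0.
  by rewrite normrM normrX normrN1 expr1n mul1r ger0_norm.
rewrite -(big_mkord xpredT G) (big_cat_nat _ (n := j.+1)) //=.
rewrite [X in _ + X]big_nat_cond [X in _ + X]big1 ?addr0; last first.
  by move=> l /andP[/andP[jl _] _]; rewrite /G insubF // ltnNge jl.
by rewrite big_mkord; apply: eq_bigr => i _; rewrite /G valK.
Qed.

Lemma facet_fun_continuous e : continuous (facet_fun e).
Proof.
apply: continuous_row => l; case: insub => [i|]; last exact: cst_continuous.
move=> x; apply: (@continuous_comp _ _ _ (fun y : 'rV[R]_j.+1 => y 0 i)).
  exact: coord_continuous.
exact: mulrl_continuous.
Qed.

Lemma facet_subproof e (x : simplex R j) : f (facet_fun e (val x)) \in cross_image.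
Proof. by apply/mem_set; exists (facet_fun e (val x)) => //; exact: facet_fun_cross. Qed.

Definition facet_map e (x : simplex R j) : cross_image := SigSub (facet_subproof e x).

Lemma facet_map_continuous e : continuous (facet_map e).
Proof.
apply: continuous_comp_initial => x /=.
have vc : continuous (set_val : simplex R j -> 'rV[R]_j.+1).
  exact: initial_continuous.
apply: (@continuous_comp _ _ _ (facet_fun e \o set_val) f); last exact: f_continuous.
exact: (continuous_comp (vc x) (@facet_fun_continuous e (set_val x))).
Qed.

Definition facet e : singular R cross_image j := mkcts (@facet_map_continuous e).

(** The fundamental cycle of the cross-polytope on the first [j.+1] axes. Since the index is the
    first degree where [nu_star] vanishes, a cycle is needed in every degree [j < k]. *)
Definition cross_cycle : chain R cross_image j := \sum_e << facet e >>.

Lemma turn_facet e : turn t (facet e) = facet [ffun i => ~~ e i].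
Proof.
apply/continuousEP => x; apply/val_inj => /=; rewrite -f_odd; congr f.
apply/rowP => l; rewrite !mxE; case: insub => [i|]; last by rewrite oppr0.
by rewrite ffunE signrN mulNr.
Qed.

Lemma cross_cycle_sym : push t cross_cycle = cross_cycle.
Proof.
rewrite /cross_cycle /push fglift_sum.
rewrite [RHS](reindex_inj (h := fun e : {ffun 'I_j.+1 -> bool} => [ffun i => ~~ e i])).
  by apply: eq_bigr => e _; rewrite fgliftU -turn_facet.
by move=> e1 e2 /ffunP e12; apply/ffunP => i; have := e12 i; rewrite !ffunE => /negb_inj.
Qed.

End Facets.

Lemma cross_cycle_boundary j (jk : (j.+1 < k)%N) : boundary (cross_cycle jk) = 0.
Proof.
rewrite /cross_cycle /boundary fglift_sum; under eq_bigr do rewrite fgliftU.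
rewrite exchange_big big1 // => i _.
(* The face opposite to [i] does not see the sign [e i], so the facets [e] and [flip e] share it. *)
pose flip (e : {ffun 'I_j.+2 -> bool}) := [ffun l => if l == i then ~~ e l else e l].
have flipK : involutive flip.
  by move=> e; apply/ffunP => l; rewrite !ffunE; case: eqP => // _; rewrite negbK.
rewrite (bigID (fun e : {ffun 'I_j.+2 -> bool} => e i)) /=.
rewrite [X in _ + X](reindex_inj (inv_inj flipK)) /=.
rewrite [X in _ + X](eq_big (fun e : {ffun 'I_j.+2 -> bool} => e i)
  (fun e => << face (facet jk e) i >>)).
- exact: addF2_freeg.
- by move=> e; rewrite ffunE eqxx negbK.
move=> e _; congr (<< _ >>); apply/continuousEP => x; apply/val_inj => /=; congr f.
apply/rowP => l; rewrite !mxE; case: insub => // l'; rewrite mxE ffunE.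
by case: unliftP => [l'' ->|->]; rewrite ?mulr0 // eq_sym (negPf (neq_lift _ _)).
Qed.

Lemma cross_cycleP j (jk : (j < k)%N) : sym_cycles t (cross_cycle jk).
Proof.
split; first exact: cross_cycle_sym.
by case: j jk => // j jk; exact: cross_cycle_boundary.
Qed.

(** By oddness, the sign at the [i]-th vertex of the facet [e] is [a i] plus [e i]. Hence exactly
    one facet alternates, and without subdivision the cochain counts alternating facets. *)
Lemma cross_cycle_sign j (jk : (j < k)%N) (s : cross_image -> 'F_2) :
  (forall x, s (t x) = s x + 1) ->
  fglift (@sign_cochain R cross_image (fun=> s) 0 j) (cross_cycle jk) = 1.
Proof.
move=> st; rewrite /cross_cycle fglift_sum.
pose a (i : 'I_j.+1) := s (facet jk [ffun=> false] (vertex R i)).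
have sE e i : s (facet jk e (vertex R i)) = a i + (e i)%:R.
  case eiE: (e i); [rewrite -st|rewrite addr0]; congr s; apply/val_inj => /=.
    rewrite -f_odd; congr f; apply/rowP => l; rewrite !mxE.
    case: insub => [l'|]; last by rewrite oppr0.
    rewrite !mxE ffunE eqxx /=; case: eqP => [->|]; last by rewrite !mulr0 oppr0.
    by rewrite eiE mul1r expr1 mulN1r.
  congr f; apply/rowP => l; rewrite !mxE; case: insub => [l'|] //.
  by rewrite !mxE ffunE eqxx /=; case: eqP => [->|]; rewrite ?mulr0 // eiE.
pose e0 : {ffun 'I_j.+1 -> bool} := [ffun i => a i != (~~ odd i)%:R].
rewrite (eq_bigr (fun e => (e == e0)%:R : ('F_2)^o)); last first.
  move=> e _; rewrite fgliftU /sign_cochain [iter _ _ _ _]/=.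
  rewrite (half_cup_alternating _ 0); last by rewrite -size_eq0 size_vertices.
  congr (nat_of_bool _)%:R.
  have nthE (i : 'I_j.+1) :
      (sign_on (fun=> s) (facet jk e) 0 (nth 0 (vertices R j) i) == (~~ odd i)%:R) =
      (e i == e0 i).
    rewrite (nth_map ord0) ?size_enum_ord // nth_ord_enum.
    by rewrite -[delta_mx _ _]/(val (vertex R i)) sign_on_val sE ffunE addF2_bool.
  have sv := size_vertices R j; apply/forallP/eqP => [se|eE i].
    apply/ffunP => i; have ilt : (i < size (vertices R j))%N by rewrite sv.
    by apply/eqP; rewrite -nthE; exact: se (Ordinal ilt).
  have ij : (i < j.+1)%N by case: i => i /=; rewrite sv.
  by have := nthE (Ordinal ij); rewrite [in RHS]eE eqxx.
by rewrite (bigD1 e0) //= eqxx big1 ?addr0 // => e /negPf->.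
Qed.

Lemma yang_cross_image : (k%:R%:E <= yang cross_image_sym)%E.
Proof.
apply: le_ereal_inf_tmp => _ [j /= jz <-]; rewrite lee_fin ler_nat leqNgt.
apply/negP => jk; pose s := @lex_sign R n cross_image.
have st x : s (t x) = s x + 1 by apply: lex_sign_odd; exact: cross_image_neq0.
apply: (nu_star_nonzero st) jz.
- exact: (@sign_cochain0 _ _ t (fun=> s) (fun=> st) 0).
- exact: (@sign_cochainS _ _ t (fun=> s) (fun=> st) 0).
- exact: (cross_cycleP jk).
exact: cross_cycle_sign.
Qed.

End CrossPolytope.

(** * Inequalities for signed powers *)

Section PowerInequalities.
Variable R : realType.
Implicit Types a b d h m p q s t u v T : R.

(** Weighted AM-GM for [u] and [1], from [1 + y < expR y] at
    [y = ln (u / g)] and [y = ln (1 / g)] where [g = 1 + s * (u - 1)]. *)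
Lemma powR_lt_tangent s u : 0 < s -> s < 1 -> 0 <= u -> u != 1 ->
  u `^ s < 1 + s * (u - 1).
Proof.
move=> s0 s1; rewrite le_eqVlt => /predU1P[<- _|u0 u1].
  by rewrite powR0 ?gt_eqF //; lra.
have g0 : 0 < 1 + s * (u - 1) by nra.
set g := 1 + s * (u - 1) in g0 *.
have ug : u / g != 1.
  rewrite -subr_eq0 -[X in _ - X](mulfV (lt0r_neq0 g0)) -mulrBl mulf_neq0 //.
    rewrite /g; apply/eqP => H.
    have : (1 - s) * (u - 1) = 0 by rewrite -H; ring.
    by move=> /eqP; rewrite mulf_eq0 !subr_eq0 (negPf u1) orbF gt_eqF.
  by rewrite invr_neq0 // gt_eqF.
have ug0 : 0 < u / g by rewrite divr_gt0.
have g'0 : 0 < g^-1 by rewrite invr_gt0.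
have E1 : 1 + ln (u / g) < u / g.
  rewrite -[ltRHS]lnK ?posrE // expR_gt1Dx //.
  by apply: contra_neq ug => /eqP; rewrite ln_eq0 // => /eqP.
have E2 : 1 + ln g^-1 <= g^-1 by rewrite -[leRHS]lnK ?posrE // expR_ge1Dx.
rewrite lnM ?posrE // lnV ?posrE // in E1.
rewrite lnV ?posrE // in E2.
have E3 : s * (u / g) + (1 - s) * g^-1 = 1.
  by rewrite mulrA -mulrDl (_ : s * u + (1 - s) = g) ?mulfV ?gt_eqF // /g; ring.
rewrite -ltr_ln ?posrE ?powR_gt0 // ln_powR.
nra.
Qed.

Lemma powR_le_tangent s u : 0 <= s -> s <= 1 -> 0 <= u ->
  u `^ s <= 1 + s * (u - 1).
Proof.
rewrite le_eqVlt => /predU1P[<- _ _|s0]; first by rewrite powRr0 mul0r addr0.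
rewrite le_eqVlt => /predU1P[-> u0|s1 u0].
  by rewrite powRr1 // mul1r subrKC.
have [->|u1] := eqVneq u 1; first by rewrite powR1 subrr mulr0 addr0.
exact/ltW/powR_lt_tangent.
Qed.

Lemma powRVK t u : t != 0 -> 0 <= u -> (u `^ t) `^ t^-1 = u.
Proof. by move=> t0 u0; rewrite -powRrM mulfV // powRr1. Qed.

Lemma tangent_le_powR t u : 1 <= t -> 0 <= u -> 1 + t * (u - 1) <= u `^ t.
Proof.
move=> t1 u0; have t0 : 0 < t by lra.
have := @powR_le_tangent t^-1 (u `^ t).
rewrite invr_ge0 ltW // invf_le1 // t1 powR_ge0 powRVK ?(gt_eqF t0) // => /(_ isT isT isT).
by rewrite -lerBlDl ler_pdivlMl //; lra.
Qed.

Lemma tangent_lt_powR t u : 1 < t -> 0 <= u -> u != 1 -> 1 + t * (u - 1) < u `^ t.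
Proof.
move=> t1 u0 u1; have t0 : 0 < t by lra.
have := @powR_lt_tangent t^-1 (u `^ t).
rewrite invr_gt0 t0 invf_lt1 // t1 powR_ge0 powRVK ?(gt_eqF t0) // => /(_ isT isT isT).
have -> : u `^ t != 1.
  by rewrite powR_eq1 negb_or negb_or u1 -leNgt u0 gt_eqF.
by move/(_ isT); rewrite -ltrBlDl ltr_pdivlMl //; lra.
Qed.

Lemma powR_superadd t u v : 1 <= t -> 0 <= u -> 0 <= v ->
  u `^ t + v `^ t <= (u + v) `^ t.
Proof.
move=> t1 u0 v0; have [uv0|uv0] := eqVneq (u + v) 0.
  have -> : u = 0 by lra. have -> : v = 0 by lra.
  by rewrite addr0 powR0 ?addr0 // gt_eqF //; lra.
have p0 : 0 < u + v by lra.
have E w : 0 <= w -> w <= u + v -> w `^ t <= (u + v) `^ t * (w / (u + v)).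
  rewrite le_eqVlt => /predU1P[<-|w0] wuv.
    by rewrite powR0 ?mul0r ?mulr0 // gt_eqF //; lra.
  rewrite -[X in X `^ t <= _](divfK uv0) [X in X `^ t]mulrC powRM //; try lra.
    rewrite ler_pM2l ?powR_gt0 // ge1r_powR // divr_gt0 //=.
    by rewrite ler_pdivrMr // mul1r.
  by rewrite divr_ge0 // ltW.
rewrite -[leRHS]mulr1 -[X in _ <= _ * X](mulfV uv0) mulrDl mulrDr.
by apply: lerD; apply: E; lra.
Qed.

Lemma powR_subadd s u v : 0 < s -> s <= 1 -> 0 <= u -> 0 <= v ->
  (u + v) `^ s <= u `^ s + v `^ s.
Proof.
move=> s0 s1 u0 v0.
have H := @powR_superadd s^-1 (u `^ s) (v `^ s).
have {H} := H _ (powR_ge0 _ _) (powR_ge0 _ _).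
rewrite -!powRrM mulfV ?gt_eqF // !powRr1 // invf_ge1 // s1 => /(_ isT) H.
rewrite -[leRHS]powRr1 ?addr_ge0 ?powR_ge0 // -[X in _ <= _ `^ X](mulVf (lt0r_neq0 s0)).
by rewrite powRrM ge0_ler_powR ?nnegrE ?addr_ge0 ?powR_ge0 // ltW.
Qed.

Lemma powR_midpoint_le t u v : 1 <= t -> 0 <= u -> 0 <= v ->
  ((u + v) / 2) `^ t <= (u `^ t + v `^ t) / 2.
Proof.
move=> t1 u0 v0; have [m0|m0] := eqVneq (u + v) 0.
  by rewrite m0 mul0r powR0 ?divr_ge0 ?addr_ge0 ?powR_ge0 // gt_eqF //; lra.
set m := (u + v) / 2; have mp : 0 < m by rewrite /m; lra.
have E w : 0 <= w -> m `^ t * (1 + t * (w / m - 1)) <= w `^ t.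
  move=> w0; rewrite -[X in _ <= X `^ _](divfK (lt0r_neq0 mp)).
  have wm0 : 0 <= w / m by rewrite divr_ge0 // ltW.
  rewrite [w / m * m]mulrC [leRHS](powRM _ (ltW mp) wm0) ler_pM2l ?powR_gt0 //.
  by rewrite tangent_le_powR // divr_ge0 // ltW.
have := lerD (E u u0) (E v v0); rewrite -mulrDr.
have -> : 1 + t * (u / m - 1) + (1 + t * (v / m - 1)) = 2 + t * ((u + v) / m - 2).
  by ring.
rewrite (_ : (u + v) / m = 2); first by lra.
by apply: (canLR (mulfK (lt0r_neq0 mp))); rewrite /m; lra.
Qed.

Lemma powR_midpoint_lt t u v : 1 < t -> 0 <= u -> 0 <= v -> u != v ->
  ((u + v) / 2) `^ t < (u `^ t + v `^ t) / 2.
Proof.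
move=> t1 u0 v0 uv; set m := (u + v) / 2.
have mp : 0 < m.
  rewrite /m divr_gt0 // lt_neqAle addr_ge0 // andbT eq_sym paddr_eq0 //.
  by apply: contra uv => /andP[/eqP-> /eqP->].
have E w : 0 <= w -> w != m -> m `^ t * (1 + t * (w / m - 1)) < w `^ t.
  move=> w0 wm; rewrite -[X in _ < X `^ _](divfK (lt0r_neq0 mp)).
  have wm0 : 0 <= w / m by rewrite divr_ge0 // ltW.
  rewrite [w / m * m]mulrC [ltRHS](powRM _ (ltW mp) wm0) ltr_pM2l ?powR_gt0 //.
  rewrite tangent_lt_powR // ?divr_ge0 ?(ltW mp) //.
  by apply: contra_neq wm => wm1; rewrite -(divfK (lt0r_neq0 mp) w) wm1 mul1r.
have um : u != m by apply: contra_neq uv; rewrite /m; lra.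
have vm : v != m by apply: contra_neq uv; rewrite /m; lra.
have := ltrD (E u u0 um) (E v v0 vm); rewrite -mulrDr.
have -> : 1 + t * (u / m - 1) + (1 + t * (v / m - 1)) = 2 + t * ((u + v) / m - 2).
  by ring.
rewrite (_ : (u + v) / m = 2); first by lra.
by apply: (canLR (mulfK (lt0r_neq0 mp))); rewrite /m; lra.
Qed.

(** As [2^(1 - s)] is at most its tangent [2 - s], this reduces to [s (2 - s) < 1]. *)
Lemma powR2_gt s : 0 < s -> s < 1 -> 2 * s < 2 `^ s.
Proof.
move=> s0 s1; have H : 2 `^ (1 - s) <= 2 - s.
  rewrite (le_trans (@powR_le_tangent (1 - s) 2 _ _ _)) //; lra.
rewrite -[X in _ `^ X](subKr 1 s) powRB ?pnatr_eq0 ?implybT // powRr1 //.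
rewrite ltr_pdivlMr ?powR_gt0 // (le_lt_trans (_ : _ <= 2 * s * (2 - s))) //.
  by rewrite ler_wpM2l // mulr_ge0 // ltW.
by nra.
Qed.

(** Mean value theorem: the derivative is [s] times [(1 + c)^(s - 1) + (1 - c)^(s - 1)], and the
    tangent bound makes this sum at least [2 / (1 - r^2)] with [r = (1 - s) c]. At [d = 1] the right
    side is [2^s]. *)
Lemma powR_diff_lower s d : 0 < s -> s < 1 -> 0 < d -> d <= 1 ->
  2 * s * d < (1 + d) `^ s - (1 - d) `^ s.
Proof.
move=> s0 s1 d0; rewrite le_eqVlt => /predU1P[->|d1].
  rewrite subrr powR0 ?gt_eqF // subr0 mulr1.
  rewrite -[1 + 1]/2; exact: powR2_gt.
pose dg (x : R) := s * (1 + x) `^ (s - 1) - s * (1 - x) `^ (s - 1) * -1.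
pose g : R -> R := ((powR (R := R))^~ s \o (cst 1 + id)) - ((powR (R := R))^~ s \o (cst 1 - id)).
have gd (x : R) : -1 < x -> x < 1 -> is_derive x 1 g (dg x).
  move=> x1 x1'; apply: is_deriveB.
    rewrite -[s * _]mulr1; apply: is_derive1_comp.
      by apply: is_derive1_powR; rewrite -[ltRHS]/(1 + x); lra.
    by rewrite -[X in is_derive _ _ _ X]add0r; apply: is_deriveD.
  apply: is_derive1_comp; first by apply: is_derive1_powR; rewrite -[ltRHS]/(1 - x); lra.
  by rewrite -[X in is_derive _ _ _ X]add0r; apply: is_deriveB.
have gc : {within `[0, d], continuous g}.
  apply: continuous_in_subspaceT => x; rewrite inE /= in_itv /= => /andP[x0 xd].
  have [|dx _] := gd x _ (le_lt_trans xd d1); first by lra.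
  exact/differentiable_continuous/derivable1_diffP.
have [|c] := @MVT R g dg 0 d d0 _ gc.
  by move=> x; rewrite in_itv /= => /andP[x0 xd]; apply: gd; lra.
have gE x : g x = (1 + x) `^ s - (1 - x) `^ s by [].
rewrite in_itv /= !gE addr0 !subr0 subrr subr0 => /andP[c0 cd] ->.
rewrite ltr_pM2r // /dg mulrN1 opprK -mulrDr (mulrC 2) ltr_pM2l //.
have r0 (x : R) : -1 < x -> x < 1 -> (1 + (1 - s) * x)^-1 <= (1 + x) `^ (s - 1).
  move=> x1 x1'; have A : 0 < 1 + x by lra.
  have B : 0 < 1 + (1 - s) * x by nra.
  rewrite -[s - 1]opprB powRN lef_pV2 ?posrE ?powR_gt0 //.
  by rewrite (le_trans (@powR_le_tangent (1 - s) (1 + x) _ _ _)) //; lra.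
have := lerD (r0 c _ _) (r0 (- c) _ _); rewrite mulrN.
have rc0 : 0 < (1 - s) * c by rewrite mulr_gt0 ?subr_gt0.
have rc1 : (1 - s) * c < 1 by nra.
move=> /(_ _ _ _ _)/(lt_le_trans _); apply; try lra.
set r := (1 - s) * c in rc0 rc1 *.
rewrite -[ltRHS](_ : 2 / ((1 + r) * (1 - r)) = _); last by field; apply/andP; split; lra.
by rewrite ltr_pdivlMr ?mulr_gt0; nra.
Qed.

(** Dividing by the mean [m] turns [u] and [v] into [1 + d] and [1 - d]. Used with [u = a^t],
    [v = b^t] and [s = 1 / t]. *)
Lemma powR_sub_lt s u v : 0 < s -> s < 1 -> 0 <= v -> v < u ->
  u - v < s^-1 * (u `^ s - v `^ s) * ((u + v) / 2) `^ (1 - s).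
Proof.
move=> s0 s1 v0 vu; set m := (u + v) / 2; have m0 : 0 < m by rewrite /m; lra.
pose d := (u - v) / 2 / m.
have dm : d * m = (u - v) / 2 by rewrite /d divfK ?gt_eqF.
have d0 : 0 < d by apply: divr_gt0 => //; lra.
have d1 : d <= 1 by rewrite /d ler_pdivrMr // mul1r /m; lra.
have uE : u = (1 + d) * m by rewrite mulrDl dm /m; lra.
have vE : v = (1 - d) * m by rewrite mulrBl dm /m; lra.
have -> : u `^ s - v `^ s = m `^ s * ((1 + d) `^ s - (1 - d) `^ s).
  have e1 : 0 <= 1 + d by lra.
  have e2 : 0 <= 1 - d by lra.
  rewrite {1}uE {1}vE (powRM _ e1 (ltW m0)) (powRM _ e2 (ltW m0)); ring.
have -> : u - v = s^-1 * (2 * s * d) * m.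
  by rewrite uE vE; field; rewrite gt_eqF.
have mE : m `^ s * m `^ (1 - s) = m.
  by rewrite -powRD ?(gt_eqF m0) ?implybT // subrKC powRr1 // ltW.
rewrite (_ : s^-1 * (m `^ s * _) * _ = s^-1 * ((1 + d) `^ s - (1 - d) `^ s) * m).
  by rewrite ltr_pM2r // ltr_pM2l ?invr_gt0 // powR_diff_lower.
by rewrite -[in RHS]mE; ring.
Qed.

Lemma powR_add_lt s u v : 0 < s -> s < 1 -> 0 <= u -> 0 <= v -> 0 < u + v ->
  u + v < s^-1 * (u `^ s + v `^ s) * ((u + v) / 2) `^ (1 - s).
Proof.
move=> s0 s1 u0 v0 uv0; have uv := powR_subadd s0 (ltW s1) u0 v0.
apply: (@lt_le_trans _ _ (s^-1 * (u + v) `^ s * ((u + v) / 2) `^ (1 - s))); last first.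
  by rewrite ler_wpM2r ?powR_ge0 // ler_wpM2l // invr_ge0 ltW.
set m := (u + v) / 2; have m0 : 0 < m by rewrite /m; lra.
have -> : u + v = 2 * m by rewrite /m; lra.
rewrite (powRM _ _ (ltW m0)) // -!mulrA -powRD ?(gt_eqF m0) ?implybT //.
by rewrite subrKC (powRr1 (ltW m0)) mulrA ltr_pM2r // ltr_pdivlMl // mulrC powR2_gt.
Qed.

Definition spow t x : R := Num.sg x * `|x| `^ t.

Lemma spowN t x : spow t (- x) = - spow t x.
Proof. by rewrite /spow sgrN normrN mulNr. Qed.

Lemma spow_ge0 t x : t != 0 -> 0 <= x -> spow t x = x `^ t.
Proof.
move=> t0; rewrite le_eqVlt => /predU1P[<-|x0].
  by rewrite /spow normr0 powR0 // mulr0.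
by rewrite /spow gtr0_sg // mul1r gtr0_norm.
Qed.

Lemma spow_sym_ind (P : R -> R -> Prop) :
  (forall a b, P a b -> P b a) -> (forall a b, P a b -> P (- a) (- b)) ->
  (forall a b, 0 <= b -> b <= a -> P a b) ->
  (forall a b, 0 < b -> b <= a -> P a (- b)) -> forall a b, P a b.
Proof.
move=> PC PN P1 P2; suff H a b : 0 <= a -> `|b| <= a -> P a b.
  have H' a b : `|b| <= `|a| -> P a b.
    have [a0 ba|a0 ba] := ger0P a; first exact: H.
    by rewrite -[a]opprK -[b]opprK; apply/PN/H; rewrite ?normrN // oppr_ge0 ltW.
  by move=> a b; have [|/ltW] := lerP `|a| `|b|; [move=> /H'/PC|exact: H'].
move=> a0; have [b0 ba|b0 ba] := ger0P b; first exact: P1.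
by rewrite -[b]opprK; apply: P2; rewrite ?oppr_gt0.
Qed.

Lemma powR_half t u : 0 <= u -> 2 `^ (1 - t) * u `^ t = 2 * (u / 2) `^ t.
Proof.
move=> u0; rewrite powRM // powRB ?pnatr_eq0 ?implybT // powRr1 //.
by rewrite -[2^-1]powR_inv1 // -powRrM mulN1r powRN mulrAC mulrA.
Qed.

(** Equal signs use superadditivity of the power, opposite signs its convexity at the midpoint. The
    factor [2^(1 - t)] is forced by [b = - a], where equality holds. *)
Lemma spow_diff_ge t a b : 1 <= t ->
  2 `^ (1 - t) * `|a - b| `^ t <= `|spow t a - spow t b|.
Proof.
move=> t1; have t0 : t != 0 by lra.
have t20 : 2 `^ (1 - t) <= 1.
  by rewrite -[leRHS](powRr0 2) ler_powR // ?ler1n //; lra.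
move: a b; apply: spow_sym_ind => a b.
- by rewrite distrC [X in _ -> _ <= X]distrC.
- by rewrite !spowN -!opprD !normrN.
- move=> b0 ba; have a0 := le_trans b0 ba; rewrite !spow_ge0 // ger0_norm ?subr_ge0 //.
  have H := @powR_superadd t (a - b) b t1 _ b0; rewrite subrK in H.
  have /H{}H : 0 <= a - b by rewrite subr_ge0.
  rewrite ger0_norm; last by rewrite subr_ge0 (le_trans _ H) // lerDr powR_ge0.
  by rewrite (@le_trans _ _ ((a - b) `^ t)) ?lerBrDr // ler_piMl ?powR_ge0.
move=> b0 ba; have a0 := lt_le_trans b0 ba.
rewrite spowN !opprK !spow_ge0 ?(ltW a0) ?(ltW b0) //.
rewrite !ger0_norm ?addr_ge0 ?powR_ge0 ?(ltW a0) ?(ltW b0) //.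
rewrite powR_half ?addr_ge0 ?(ltW a0) ?(ltW b0) //.
by have := powR_midpoint_le t1 (ltW a0) (ltW b0); lra.
Qed.

Lemma spow_diff_gt t a b : 1 < t -> a != b -> a != - b ->
  2 `^ (1 - t) * `|a - b| `^ t < `|spow t a - spow t b|.
Proof.
move=> t1; have t0 : t != 0 by lra.
have t20 : 2 `^ (1 - t) < 1.
  by rewrite -[ltRHS](powRr0 2) -ltr_ln ?posrE ?powR_gt0 // !ln_powR; have := @ln_gt0 R 2 (ltr1n R 2); nra.
move: a b; apply: spow_sym_ind => a b.
- move=> H ba bna; rewrite distrC [ltRHS]distrC; apply: H; first by rewrite eq_sym.
  by apply: contra_neq bna => ->; rewrite opprK.
- by rewrite !spowN -!opprD !normrN eqr_opp => H ab; rewrite eqr_oppLR opprK => /H; apply.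
- move=> b0 ba ab _; have a0 := le_trans b0 ba; rewrite !spow_ge0 // ger0_norm ?subr_ge0 //.
  have H := @powR_superadd t (a - b) b (ltW t1) _ b0; rewrite subrK in H.
  have /H{}H : 0 <= a - b by rewrite subr_ge0.
  rewrite ger0_norm; last by rewrite subr_ge0 (le_trans _ H) // lerDr powR_ge0.
  rewrite (@lt_le_trans _ _ ((a - b) `^ t)) ?lerBrDr // gtr_pMl //.
  by rewrite powR_gt0 // subr_gt0 lt_neqAle eq_sym ab.
move=> b0 ba _; rewrite opprK => ab; have a0 := lt_le_trans b0 ba.
rewrite spowN !opprK !spow_ge0 ?(ltW a0) ?(ltW b0) //.
rewrite !ger0_norm ?addr_ge0 ?powR_ge0 ?(ltW a0) ?(ltW b0) //.
rewrite powR_half ?addr_ge0 ?(ltW a0) ?(ltW b0) //.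
by have := powR_midpoint_lt t1 (ltW a0) (ltW b0) ab; lra.
Qed.

Lemma spow_diff_lt t a b : 1 < t -> a != b ->
  `|spow t a - spow t b| <
    t * `|a - b| * ((`|a| `^ t + `|b| `^ t) / 2) `^ (1 - t^-1).
Proof.
move=> t1; have t0 : t != 0 by lra.
have s0 : 0 < t^-1 by rewrite invr_gt0; lra.
have s1 : t^-1 < 1 by rewrite invf_lt1 //; lra.
move: a b; apply: spow_sym_ind => a b.
- by move=> H; rewrite eq_sym => /H; rewrite distrC [`|a - b|]distrC [`|a| `^ t + _]addrC.
- by rewrite !spowN -!opprD !normrN eqr_opp.
- move=> b0 ba ab; have a0 := le_trans b0 ba; rewrite !spow_ge0 //.
  have lt_ba : b < a by rewrite lt_neqAle eq_sym ab.
  have lt_t : b `^ t < a `^ t by rewrite gt0_ltr_powR ?nnegrE //; lra.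
  rewrite !ger0_norm ?subr_ge0 ?(ltW lt_t) //.
  have := powR_sub_lt s0 s1 (powR_ge0 b t) lt_t.
  by rewrite !powRVK // invrK.
move=> b0 ba _; have a0 := lt_le_trans b0 ba.
rewrite spowN !opprK normrN !spow_ge0 ?(ltW a0) ?(ltW b0) //.
rewrite !ger0_norm ?addr_ge0 ?powR_ge0 ?(ltW a0) ?(ltW b0) //.
have ab0 : 0 < a `^ t + b `^ t by rewrite addr_gt0 ?powR_gt0.
have := powR_add_lt s0 s1 (powR_ge0 a t) (powR_ge0 b t) ab0.
by rewrite !powRVK ?(ltW a0) ?(ltW b0) // invrK.
Qed.

End PowerInequalities.

Section SignedPower.
Variable R : realType.
Implicit Types a b h m p q s t u v T : R.

Lemma norm_spow t a : t != 0 -> `|spow t a| = `|a| `^ t.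
Proof.
move=> t0; rewrite /spow normrM normr_sg; have [->|a0] := eqVneq a 0.
    by rewrite ?eqxx mul0r normr0 powR0.
by rewrite mul1r ger0_norm ?powR_ge0.
Qed.

Lemma spow_eq0 t a : t != 0 -> (spow t a == 0) = (a == 0).
Proof. by move=> t0; rewrite -normr_eq0 norm_spow // powR_eq0 normr_eq0 t0 andbT. Qed.

Lemma spowK t : t != 0 -> cancel (@spow R t) (spow t^-1).
Proof.
move=> t0 a; have [a0|a0] := lerP 0 a.
  by rewrite (spow_ge0 t0 a0) spow_ge0 ?invr_eq0 ?powR_ge0 // powRVK.
rewrite -[a]opprK [spow t _]spowN spowN; congr (- _); have {}a0 : 0 <= - a by rewrite oppr_ge0 ltW.
by rewrite (spow_ge0 t0 a0) spow_ge0 ?invr_eq0 ?powR_ge0 // powRVK.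
Qed.

Lemma spowM t c a : t != 0 -> 0 <= c -> spow t (c * a) = c `^ t * spow t a.
Proof.
move=> t0; rewrite le_eqVlt => /predU1P[<-|c0].
  by rewrite mul0r powR0 // mul0r /spow sgr0 mul0r.
by rewrite /spow sgrM gtr0_sg // mul1r normrM gtr0_norm // (powRM _ (ltW c0)) // mulrCA.
Qed.

Lemma spow_continuous t : 0 < t -> continuous (@spow R t).
Proof.
move=> t0; have tn0 : t != 0 by rewrite gt_eqF.
have pos a : 0 < a -> {for a, continuous (@spow R t)}.
  move=> a0; have Dp : derivable (powR (R := R) ^~ t) a 1.
    by apply: ex_derive; exact: is_derive1_powR.
  have c : {for a, continuous (powR (R := R) ^~ t)}.
    exact/differentiable_continuous/derivable1_diffP.
  rewrite /prop_for /continuous_at (spow_ge0 tn0 (ltW a0)).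
  apply: (@cvg_trans _ (x `^ t @[x --> a])); last exact: c.
  apply: near_eq_cvg; near=> x; rewrite spow_ge0 //.
  by near: x; apply: filterS (lt_nbhsr a0) => x /ltW.
move=> a; have [a0|a0|<-] := ltgtP 0 a; first exact: pos.
  rewrite (_ : @spow R t = -%R \o @spow R t \o -%R); last first.
    by apply/funext => x /=; rewrite spowN opprK.
  apply: continuous_comp; first exact: oppr_continuous.
  apply: continuous_comp; last exact: oppr_continuous.
  by apply: pos; rewrite oppr_gt0.
rewrite /continuous_at {2}/spow sgr0 mul0r; apply/cvgr0Pnorm_lt => e e0.
near=> x; rewrite norm_spow //.
have -> : e = (e `^ t^-1) `^ t by rewrite -powRrM mulVf // powRr1 // ltW.
apply: gt0_ltr_powR; rewrite ?nnegrE ?powR_ge0 //.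
near: x; apply/nbhs_ballP; exists (e `^ t^-1); first exact: powR_gt0.
by move=> y; rewrite /ball_ /= sub0r normrN.
Unshelve. all: by end_near. Qed.

(** Weighted AM-GM for [u / T] and [v]. It replaces Hoelder's inequality by a linear bound that can
    be summed over edges; [T] is the value of [u / v] at which it is sharp. *)
Lemma powR_young s u v T : 0 < s -> s < 1 -> 0 <= u -> 0 <= v -> 0 < T ->
  u `^ s * v `^ (1 - s) <= T `^ s * (s * (u / T) + (1 - s) * v).
Proof.
move=> s0 s1 u0 + T0; rewrite le_eqVlt => /predU1P[<-|v0].
  rewrite powR0 ?mulr0 ?addr0; last by lra.
  by rewrite mulr_ge0 ?powR_ge0 // mulr_ge0 ?divr_ge0 // ltW.
have Tv : 0 < T * v by rewrite mulr_gt0.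
have uTv0 : 0 <= u / (T * v) by rewrite divr_ge0 // ltW.
have := powR_le_tangent (ltW s0) (ltW s1) uTv0.
rewrite -(ler_pM2l (powR_gt0 s Tv)) -(powRM _ (ltW Tv) uTv0).
rewrite [T * v * _]mulrC divfK ?(gt_eqF Tv) // (powRM _ (ltW T0) (ltW v0)) => H.
have vE : v `^ s * v `^ (1 - s) = v.
  by rewrite -powRD ?(gt_eqF v0) ?implybT // subrKC powRr1 // ltW.
apply: (le_trans (ler_wpM2r (powR_ge0 v (1 - s)) H)).
rewrite (_ : _ * _ * _ * _ = T `^ s * (v `^ s * v `^ (1 - s)) * (1 + s * (u / (T * v) - 1))).
  rewrite vE -mulrA ler_pM2l ?powR_gt0 // le_eqVlt; apply/orP; left; apply/eqP.
  by field; rewrite !gt_eqF.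
by ring.
Qed.

(** The edge form of the comparison of exponents: after [spow_diff_lt], the mean of the powers [t]
    is bounded by that of the powers [t p], and Young's inequality separates the two factors. *)
Lemma spow_edge_lt t p T a b : 1 < t -> 1 <= p -> 0 < T -> a != b ->
  `|spow t a - spow t b| `^ p <
    t `^ p * (T `^ t^-1 * (t^-1 * (`|a - b| `^ (t * p) / T) +
      (1 - t^-1) * ((`|a| `^ (t * p) + `|b| `^ (t * p)) / 2))).
Proof.
move=> t1 p1 T0 ab; have t0 : 0 < t by lra.
have p0 : 0 < p by lra.
have s0 : 0 < t^-1 by rewrite invr_gt0.
have s1 : t^-1 < 1 by rewrite invf_lt1.
set m := (`|a| `^ t + `|b| `^ t) / 2.
have m0 : 0 <= m by rewrite /m divr_ge0 ?addr_ge0 ?powR_ge0.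
set M := (_ + _) / 2; have mM : m `^ p <= M.
  by rewrite (le_trans (powR_midpoint_le p1 (powR_ge0 _ _) (powR_ge0 _ _))) // -!powRrM.
apply: (@lt_le_trans _ _ ((t * `|a - b| * m `^ (1 - t^-1)) `^ p)).
  apply: gt0_ltr_powR; rewrite ?nnegrE //; last exact: spow_diff_lt.
  by rewrite mulr_ge0 ?powR_ge0 // mulr_ge0 // ltW.
rewrite 2?powRM ?mulr_ge0 ?powR_ge0 ?(ltW t0) // -mulrA ler_pM2l ?powR_gt0 //.
apply: (le_trans _ (powR_young s0 s1 (powR_ge0 _ _) _ T0)); last first.
  by rewrite /M divr_ge0 ?addr_ge0 ?powR_ge0.
have -> : (`|a - b| `^ (t * p)) `^ t^-1 = `|a - b| `^ p.
  by rewrite -powRrM mulrAC mulfV ?mul1r // gt_eqF.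
rewrite ler_wpM2l ?powR_ge0 //.
rewrite powRAC ge0_ler_powR ?nnegrE ?powR_ge0 //; first by lra.
by rewrite /M divr_ge0 ?addr_ge0 ?powR_ge0.
Qed.

Lemma spow_edge_le t p T a b : 1 < t -> 1 <= p -> 0 < T ->
  `|spow t a - spow t b| `^ p <=
    t `^ p * (T `^ t^-1 * (t^-1 * (`|a - b| `^ (t * p) / T) +
      (1 - t^-1) * ((`|a| `^ (t * p) + `|b| `^ (t * p)) / 2))).
Proof.
move=> t1 p1 T0; have [->|ab] := eqVneq a b; last exact/ltW/spow_edge_lt.
have s1 : t^-1 <= 1 by rewrite invf_le1 //; lra.
rewrite subrr normr0 powR0; last by lra.
rewrite mulr_ge0 ?powR_ge0 // mulr_ge0 ?powR_ge0 // addr_ge0 //.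
  by rewrite mulr_ge0 ?divr_ge0 ?powR_ge0 ?invr_ge0 //; lra.
by rewrite mulr_ge0 ?subr_ge0 // divr_ge0 ?addr_ge0 ?powR_ge0.
Qed.

Lemma spow_edge_ge t p a b : 1 <= t -> 1 <= p ->
  2 `^ (p - t * p) * `|a - b| `^ (t * p) <= `|spow t a - spow t b| `^ p.
Proof.
move=> t1 p1; rewrite -{1}[p]mul1r -mulrBl !powRrM -powRM ?powR_ge0 //.
by rewrite ge0_ler_powR ?nnegrE ?mulr_ge0 ?powR_ge0 ?spow_diff_ge //; lra.
Qed.

Lemma spow_edge_gt t p a b : 1 < t -> 1 <= p -> a != b -> a != - b ->
  2 `^ (p - t * p) * `|a - b| `^ (t * p) < `|spow t a - spow t b| `^ p.
Proof.
move=> t1 p1 ab anb; rewrite -{1}[p]mul1r -mulrBl !powRrM -powRM ?powR_ge0 //.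
by apply: gt0_ltr_powR; rewrite ?nnegrE ?mulr_ge0 ?powR_ge0 ?spow_diff_gt //; lra.
Qed.

(** Shows the constant as [T / 2] with [T = (2 / p)^p], the form in which the comparison of
    exponents takes it. *)
Lemma powR2_div p : 0 < p -> 2 `^ (p - 1) / p `^ p = (2 / p) `^ p / 2.
Proof.
move=> p0; rewrite powRM ?invr_ge0 ?(ltW p0) // powRB ?pnatr_eq0 ?implybT //.
rewrite powRr1 // -[p^-1]powR_inv1 ?(ltW p0) // -powRrM mulN1r powRN.
by rewrite mulrAC.
Qed.

End SignedPower.

Lemma ltr_sum_ex (R : numDomainType) (I : finType) (P : pred I) (F G : I -> R) i0 :
  (forall i, P i -> F i <= G i) -> P i0 -> F i0 < G i0 ->
  \sum_(i | P i) F i < \sum_(i | P i) G i.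
Proof.
move=> FG Pi0 FG0; rewrite (bigD1 i0) //= [ltRHS](bigD1 i0) //= ltr_leD //.
by apply: ler_sum => i /andP[Pi _]; exact: FG.
Qed.

(** * Rayleigh quotients and min-max eigenvalues *)

Section Rayleigh.
Variables (R : realType) (n : nat) (e : rel 'I_n).
Hypothesis e_simple : simple_graph e.
Hypothesis e_deg : no_isolated_vertex e.
Implicit Types (x : 'rV[R]_n) (p q t T : R).

Definition is_edge (ij : 'I_n * 'I_n) := (ij.1 < ij.2)%N && e ij.1 ij.2.

Definition edge_energy p x : R :=
  \sum_(ij | is_edge ij) `|x 0 ij.1 - x 0 ij.2| `^ p.

Definition degree_mass p x : R := \sum_i (vdeg e i)%:R * `|x 0 i| `^ p.

Lemma rayleighE p x : rayleigh e p x = edge_energy p x / degree_mass p x.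
Proof. by rewrite /rayleigh /edge_energy (pair_big_dep xpredT) /=. Qed.

Lemma sum_edges2 (g : 'I_n -> 'I_n -> R) :
  \sum_i \sum_(j | e i j) g i j =
  \sum_(ij | is_edge ij) (g ij.1 ij.2 + g ij.2 ij.1).
Proof.
have [esym eirr] := e_simple.
rewrite big_split /= /is_edge.
rewrite -(pair_big_dep xpredT (fun i j : 'I_n => (i < j)%N && e i j) (fun i j => g i j)) /=.
rewrite -(pair_big_dep xpredT (fun i j : 'I_n => (i < j)%N && e i j) (fun i j => g j i)) /=.
rewrite [X in _ = _ + X](exchange_big_dep xpredT) //= -big_split.
apply: eq_bigr => i _ /=; rewrite [LHS](bigID (fun j : 'I_n => (i < j)%N)) /=.
congr (_ + _); first by apply: eq_bigl => j; rewrite andbC.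
apply: eq_bigl => j; rewrite [e j i]esym -leqNgt.
case eij: (e i j); rewrite ?andbF //= andbT ltn_neqAle.
by case: eqP => [ji|//]; rewrite (val_inj ji) eirr in eij.
Qed.

Lemma sum_nbr_const i (c : R) : \sum_(j | e i j) c = (vdeg e i)%:R * c.
Proof.
rewrite /vdeg -sum1_card natr_sum mulr_suml.
by apply: eq_big => [j|j _]; rewrite ?inE ?mul1r.
Qed.

Lemma sum_edges (g : 'I_n -> R) :
  \sum_(ij | is_edge ij) (g ij.1 + g ij.2) = \sum_i (vdeg e i)%:R * g i.
Proof.
rewrite -(sum_edges2 (fun i _ => g i)).
by apply: eq_bigr => i _; exact: sum_nbr_const.
Qed.

Lemma degree_mass_gt0 p x : x != 0 -> 0 < degree_mass p x.
Proof.
move=> x0; have [i xi] : exists i, x 0 i != 0.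
  apply/existsP; apply: contra_neqT x0; rewrite negb_exists => /forallP x0.
  by apply/rowP => i; rewrite mxE; apply/eqP; rewrite -[_ == _]negbK.
rewrite /degree_mass (bigD1 i) //= ltr_pwDl //.
  by rewrite mulr_gt0 ?powR_gt0 ?normr_gt0 // ltr0n; exact: e_deg.
by apply: sumr_ge0 => j _; rewrite mulr_ge0 // powR_ge0.
Qed.

Lemma edge_energy_neq0 p x : p != 0 -> edge_energy p x != 0 ->
  exists2 ij, is_edge ij & x 0 ij.1 != x 0 ij.2.
Proof.
move=> p0 E0; have [/existsP[ij /andP[? ?]]|/existsPn no] :=
  boolP [exists ij, is_edge ij && (x 0 ij.1 != x 0 ij.2)]; first by exists ij.
case/eqP: E0; apply: big1 => ij eij; have := no ij.
by rewrite eij /= negbK => /eqP->; rewrite subrr normr0 powR0.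
Qed.

Lemma degree_mass_spow t p x : t != 0 ->
  degree_mass p (map_mx (spow t) x) = degree_mass (t * p) x.
Proof.
by move=> t0; apply: eq_bigr => i _; rewrite mxE norm_spow // powRrM.
Qed.

Lemma map_spow_eq0 t x : t != 0 -> (map_mx (spow t) x == 0) = (x == 0).
Proof.
move=> t0; apply/eqP/eqP => [/rowP y0|->].
  by apply/rowP => i; have /eqP := y0 i; rewrite !mxE spow_eq0 // => /eqP.
by apply/rowP => i; rewrite !mxE; apply/eqP; rewrite spow_eq0.
Qed.

(** In terms of [F_p]: [p (2 F_p)^(1/p)] increases with [p]. *)
Lemma rayleigh_spow_lt t p T x : 1 < t -> 1 <= p -> 0 < T -> x != 0 ->
  rayleigh e (t * p) x <= T / 2 ->
  rayleigh e p (map_mx (spow t) x) < t `^ p * T `^ t^-1 / 2.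
Proof.
move=> t1 p1 T0 x0; have t0 : t != 0 by lra.
have s1 : t^-1 < 1 by rewrite invf_lt1 //; lra.
have s0 : 0 < t^-1 by rewrite invr_gt0; lra.
rewrite !rayleighE degree_mass_spow //.
have D0 := degree_mass_gt0 (t * p) x0; set D := degree_mass _ _ in D0 *.
rewrite ler_pdivrMr // ltr_pdivrMr // => ET.
pose G ij := t `^ p * (T `^ t^-1 * (t^-1 * (`|x 0 ij.1 - x 0 ij.2| `^ (t * p) / T) +
      (1 - t^-1) * ((`|x 0 ij.1| `^ (t * p) + `|x 0 ij.2| `^ (t * p)) / 2))).
have GE : \sum_(ij | is_edge ij) G ij = t `^ p * (T `^ t^-1 *
    (t^-1 * (edge_energy (t * p) x / T) + (1 - t^-1) * (D / 2))).
  rewrite -!mulr_sumr big_split /= -!mulr_sumr -!mulr_suml; congr (_ * (_ * (_ + _ * (_ / _)))).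
  exact: (sum_edges (fun i => `|x 0 i| `^ (t * p))).
have c0 : 0 < t `^ p * T `^ t^-1 by rewrite mulr_gt0 ?powR_gt0 //; lra.
have ET' : edge_energy (t * p) x / T <= D / 2.
  by rewrite ler_pdivrMr // (_ : D / 2 * T = T / 2 * D) //; ring.
have rhsE : t `^ p * T `^ t^-1 / 2 * D = t `^ p * (T `^ t^-1 *
    (t^-1 * (D / 2) + (1 - t^-1) * (D / 2))) by field.
have tp0 : 0 < t `^ p by rewrite powR_gt0; lra.
have Ts0 : 0 < T `^ t^-1 by rewrite powR_gt0.
(* Strictness has two sources: zero energy leaves slack in the sum of the bounds, and positive
   energy provides an edge with distinct end values. *)
have [E0|E0] := eqVneq (edge_energy (t * p) x) 0.
  apply: (@le_lt_trans _ _ (\sum_(ij | is_edge ij) G ij)).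
    by apply: ler_sum => ij _; rewrite !mxE; apply: spow_edge_le.
  rewrite GE rhsE !ltr_pM2l // E0 mul0r mulr0 add0r ltrDr mulr_gt0 //.
  by rewrite divr_gt0.
have [|ij eij xij] := edge_energy_neq0 _ E0; first by nra.
apply: (@lt_le_trans _ _ (\sum_(ij | is_edge ij) G ij)).
  apply: (@ltr_sum_ex _ _ _ _ _ ij) => // [kl _|]; rewrite !mxE.
    exact: spow_edge_le.
  exact: spow_edge_lt.
by rewrite GE rhsE !ler_pM2l // lerD2r ler_pM2l.
Qed.

(** In terms of [F_p]: [2^(-p) F_p] decreases with [p]. *)
Lemma rayleigh_spow_ge t p x : 1 <= t -> 1 <= p -> x != 0 ->
  2 `^ (p - t * p) * rayleigh e (t * p) x <= rayleigh e p (map_mx (spow t) x).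
Proof.
move=> t1 p1 x0; have t0 : t != 0 by lra.
rewrite !rayleighE degree_mass_spow // mulrA ler_pM2r ?invr_gt0 ?degree_mass_gt0 //.
rewrite mulr_sumr; apply: ler_sum => ij _; rewrite !mxE.
exact: spow_edge_ge.
Qed.

Lemma rayleigh_spow_gt t p x i j : 1 < t -> 1 <= p -> x != 0 -> e i j ->
  x 0 i != x 0 j -> x 0 i != - x 0 j ->
  2 `^ (p - t * p) * rayleigh e (t * p) x < rayleigh e p (map_mx (spow t) x).
Proof.
move=> t1 p1 x0 eij xij xnij; have t0 : t != 0 by lra.
wlog ij : i j eij xij xnij / (i < j)%N.
  move=> W; have [lt_ij|lt_ji|/val_inj ijE] := ltngtP i j; first exact: (W i j).
    apply: (W j i) => //; rewrite ?[e j i](e_simple.1) // eq_sym //.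
    by apply: contra_neq xnij => <-; rewrite opprK.
  by rewrite ijE eqxx in xij.
rewrite !rayleighE degree_mass_spow // mulrA ltr_pM2r ?invr_gt0 ?degree_mass_gt0 //.
rewrite mulr_sumr; apply: (@ltr_sum_ex _ _ _ _ _ (i, j)) => [kl _||].
- by rewrite !mxE; apply: spow_edge_ge => //; exact: ltW.
- by rewrite /is_edge ij.
by rewrite !mxE; apply: spow_edge_gt.
Qed.

End Rayleigh.

Section MinMax.
Variables (R : realType) (n : nat) (e : rel 'I_n).
Hypothesis e_deg : no_isolated_vertex e.
Implicit Types (x : 'rV[R]_n) (c p : R).

Lemma norm_powR_continuous p : 0 < p -> continuous (fun a : R => `|a| `^ p).
Proof.
move=> p0; rewrite (_ : (fun a => _) = Num.norm \o @spow R p); last first.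
  by apply/funext => a /=; rewrite norm_spow // gt_eqF.
move=> a; apply: continuous_comp; first exact: spow_continuous.
exact: norm_continuous.
Qed.

Lemma edge_energy_continuous p : 0 < p -> continuous (@edge_energy R n e p).
Proof.
move=> p0; apply: continuous_sum => -[i j] _ x /=.
apply: (@continuous_comp _ _ _ (fun x : 'rV[R]_n => x 0 i - x 0 j)
  (fun a : R => `|a| `^ p)).
  by apply: continuousB; exact: coord_continuous.
exact: norm_powR_continuous.
Qed.

Lemma degree_mass_continuous p : 0 < p -> continuous (@degree_mass R n e p).
Proof.
move=> p0; apply: continuous_sum => i _ x.
apply: (@continuous_comp _ _ _ (fun x : 'rV[R]_n => `|x 0 i| `^ p)
  ( *%R (vdeg e i)%:R)).
  apply: (@continuous_comp _ _ _ (fun x : 'rV[R]_n => x 0 i)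
    (fun a : R => `|a| `^ p)).
    exact: coord_continuous.
  exact: norm_powR_continuous.
exact: mulrl_continuous.
Qed.

Lemma rayleigh_continuous p x : 0 < p -> x != 0 ->
  {for x, continuous (rayleigh e p)}.
Proof.
move=> p0 x0; rewrite (_ : rayleigh e p =
    (fun y => edge_energy e p y * (degree_mass e p y)^-1)); last first.
  by apply/funext => y; rewrite rayleighE.
apply: continuousM; first exact: edge_energy_continuous.
apply: continuousV; last exact: degree_mass_continuous.
by rewrite gt_eqF // degree_mass_gt0.
Qed.

Lemma rayleighZ p a x : 0 < a -> rayleigh e p (a *: x) = rayleigh e p x.
Proof.
move=> a0; rewrite !rayleighE.
have -> : edge_energy e p (a *: x) = a `^ p * edge_energy e p x.
  rewrite /edge_energy mulr_sumr; apply: eq_bigr => ij _.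
  by rewrite !mxE -mulrBr normrM (gtr0_norm a0) powRM // ltW.
have -> : degree_mass e p (a *: x) = a `^ p * degree_mass e p x.
  rewrite /degree_mass mulr_sumr; apply: eq_bigr => i _.
  by rewrite !mxE normrM (gtr0_norm a0) (powRM _ (ltW a0)) // mulrCA.
by rewrite -mulf_div mulfV ?mul1r // gt_eqF // powR_gt0.
Qed.

Section Lower.
Variables (m : nat) (F : 'I_m -> 'rV[R]_n -> R).
Hypothesis F_continuous : forall j, continuous (F j).
Hypothesis F_odd : forall j x, F j (- x) = - F j x.

(** By [yang_le], a set of index at least [k > m] contains a common zero of the [m] functions. *)
Lemma minmax_eigenvalue_ge p c k : (m < k)%N ->
  (forall x, x != 0 -> (forall j, F j x = 0) -> c <= rayleigh e p x) ->
  (c%:E <= minmax_eigenvalue e p k)%E.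
Proof.
move=> mk cF; apply: le_ereal_inf_tmp => _ [S [cS S0 [symS kS]] <-].
have [x Sx Fx] : exists2 x, S x & forall j, F j x = 0.
  apply: contrapT => no; have := yang_le S0 symS F_continuous F_odd.
  have H x : S x -> exists j, F j x != 0.
    move=> Sx; apply: contrapT => Fx; apply: no; exists x => // j.
    by apply/eqP/negPn/negP => Fj; apply: Fx; exists j.
  move=> /(_ H)/(le_trans kS); rewrite lee_fin ler_nat leqNgt mk //.
apply: (@le_trans _ _ (rayleigh e p x)%:E).
  rewrite lee_fin cF //; by apply: contra_notN S0 => /eqP <-.
by apply: ereal_sup_ubound; exists x.
Qed.

(** The common zeros form a cone and the quotient is homogeneous of degree zero, so its infimum over
    them is a minimum over the compact slice [K]; this yields one [c' > c] for all sets. *)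
Lemma minmax_eigenvalue_gt p c k : (m < k)%N -> 0 < p ->
  (forall a x j, 0 < a -> F j x = 0 -> F j (a *: x) = 0) ->
  (forall x, x != 0 -> (forall j, F j x = 0) -> c < rayleigh e p x) ->
  (c%:E < minmax_eigenvalue e p k)%E.
Proof.
move=> mk p0 FZ cF.
pose K := [set x : 'rV[R]_n | `|x| = 1 /\ forall j, F j x = 0].
have K0 x : K x -> x != 0.
  by move=> [x1 _]; rewrite -normr_eq0 x1 oner_eq0.
have KE x : x != 0 -> (forall j, F j x = 0) ->
    exists2 y, K y & rayleigh e p x = rayleigh e p y.
  move=> x0 Fx; have nx : 0 < `|x|^-1 by rewrite invr_gt0 normr_gt0.
  exists (`|x|^-1 *: x); last by rewrite rayleighZ.
  split; last by move=> j; apply: FZ.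
  by rewrite normrZ gtr0_norm // mulVf // normr_eq0.
have [c' cc' c'F] : exists2 c', c < c' & forall y, K y -> c' <= rayleigh e p y.
  have [K_neq0|K_eq0] := pselect (K !=set0); last first.
    exists (c + 1); first by rewrite ltrDl.
    by move=> y Ky; case: K_eq0; exists y.
  have cK : compact K.
    apply: (@compact_rV _ _ _ 1) => [|x [x1 _] i]; last by rewrite -x1 coord_le_norm.
    rewrite (_ : K = [set x : 'rV[R]_n | `|x| = 1] `&`
        (\bigcap_(j in [set: 'I_m]) [set x | F j x = 0])).
      apply: closedI.
        apply: (@preimage_closed _ _ (fun x : 'rV[R]_n => `|x|) [set u | u = 1]).
          by move=> x _; exact: norm_continuous.
        exact: closed_eq.
      apply: closed_bigI => j _.
      apply: (@preimage_closed _ _ (F j) [set u | u = 0]); last exact: closed_eq.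
      by move=> x _; exact: F_continuous.
    by apply/seteqP; split=> x [x1 Fx]; split=> // j; [move=> _|]; exact: Fx.
  have [|y yK yF] := EVT_min_rV K_neq0 cK (f := rayleigh e p).
    by apply: continuous_in_subspaceT => x /set_mem/K0; exact: rayleigh_continuous.
  have Ky := set_mem yK; exists (rayleigh e p y).
    by apply: cF; [exact: K0|case: Ky].
  by move=> z Kz; apply: yF; exact: mem_set.
apply: (@lt_le_trans _ _ c'%:E); first by rewrite lte_fin.
apply: minmax_eigenvalue_ge mk _ => x x0 Fx.
by have [y Ky ->] := KE x x0 Fx; exact: c'F.
Qed.

End Lower.

Section Upper.
Variables (k : nat) (f : 'rV[R]_k -> 'rV[R]_n).
Hypothesis f_continuous : continuous f.
Hypothesis f_odd : forall a, f (- a) = - f a.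
Hypothesis f_eq0 : forall a, f a = 0 -> a = 0.

Lemma cross_polytope_neq0 (a : 'rV[R]_k) : cross_polytope a -> a != 0.
Proof.
move=> a1; apply/eqP => a0; move: a1; rewrite /cross_polytope /= a0 big1.
  by move/esym/eqP; rewrite oner_eq0.
by move=> i _; rewrite mxE normr0.
Qed.

Lemma minmax_eigenvalue_le_image p c :
  (forall y, cross_image f y -> rayleigh e p y <= c) ->
  (minmax_eigenvalue e p k <= c%:E)%E.
Proof.
move=> fc; apply: ge_ereal_inf.
exists (ereal_sup [set (rayleigh e p x)%:E | x in cross_image f]).
  exists (cross_image f) => //; split.
  - exact: cross_image_compact.
  - exact: cross_image_neq0.
  by exists (cross_image_sym f_odd); exact: yang_cross_image.
by apply: ge_ereal_sup => _ [y fy <-]; rewrite lee_fin fc.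
Qed.

Lemma minmax_eigenvalue_le p c : (forall a, a != 0 -> rayleigh e p (f a) <= c) ->
  (minmax_eigenvalue e p k <= c%:E)%E.
Proof.
move=> fc; apply: minmax_eigenvalue_le_image => _ [a a1 <-].
by apply: fc; exact: cross_polytope_neq0.
Qed.

(** The supremum over the compact image is attained and so inherits the strict bound. *)
Lemma minmax_eigenvalue_lt p c : (0 < k)%N -> 0 < p ->
  (forall a, a != 0 -> rayleigh e p (f a) < c) ->
  (minmax_eigenvalue e p k < c%:E)%E.
Proof.
move=> k0 p0 fc.
have S_neq0 : cross_image f !=set0.
  exists (f (delta_mx 0 (Ordinal k0))); exists (delta_mx 0 (Ordinal k0)) => //.
  rewrite /cross_polytope /= (bigD1 (Ordinal k0)) //= mxE !eqxx normr1 big1 ?addr0 //.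
  by move=> i /negPf ik; rewrite mxE ik andbF normr0.
have [|y yS yF] := EVT_max_rV S_neq0 (cross_image_compact f_continuous)
    (f := rayleigh e p).
  apply: continuous_in_subspaceT => x /set_mem xS; apply: rayleigh_continuous => //.
  by apply/eqP => x0; apply: (cross_image_neq0 f_eq0); rewrite -x0.
apply: (@le_lt_trans _ _ (rayleigh e p y)%:E); last first.
  by have [a a1 <-] := set_mem yS; rewrite lte_fin fc // cross_polytope_neq0.
by apply: minmax_eigenvalue_le_image => z zS; rewrite yF // mem_set.
Qed.

End Upper.
End MinMax.

(** * The pseudo-independence number *)

Section Median.
Variable R : realType.
Implicit Types a b c : R.

Definition median a b c : R := Num.max (Num.min a b) (Num.min (Num.max a b) c).

Lemma medianN a b c : median (- a) (- b) (- c) = - median a b c.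
Proof.
rewrite /median -oppr_max -oppr_min -[Num.min (- _) _]oppr_max -oppr_min.
congr (- _); case: (lerP a b) => ab; case: (lerP a c) => ac; case: (lerP b c) => bc;
  by rewrite ?minEle ?maxEle; repeat (case: ifPn; rewrite -?ltNge => ?); lra.
Qed.

(** With median zero, at most one of the values is positive and at most one negative. A single odd
    condition thus controls all three edges of a triangle. *)
Lemma median_eq0 a b c : median a b c = 0 -> [/\ a * b <= 0, a * c <= 0 & b * c <= 0].
Proof.
rewrite /median; case: (lerP a b) => ab; case: (lerP a c) => ac; case: (lerP b c) => bc;
  by rewrite ?minEle ?maxEle; repeat (case: ifPn; rewrite -?ltNge => ?); split; nra.
Qed.

Lemma medianM r a b c : 0 <= r -> median (r * a) (r * b) (r * c) = r * median a b c.
Proof. by move=> r0; rewrite /median !(maxr_pMr, minr_pMr). Qed.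

End Median.

Section MapSpow.
Variables (R : realType) (n : nat).
Implicit Types (x : 'rV[R]_n) (t : R).

Lemma map_spow_continuous t : 0 < t ->
  continuous (map_mx (spow t) : 'rV[R]_n -> 'rV[R]_n).
Proof.
move=> t0; rewrite (_ : map_mx _ = fun x : 'rV[R]_n => \row_i spow t (x 0 i)).
  apply: continuous_row => i x.
  apply: (@continuous_comp _ _ _ (fun x : 'rV[R]_n => x 0 i) (spow t)).
    exact: coord_continuous.
  exact: spow_continuous.
by apply/funext => x; apply/rowP => i; rewrite !mxE.
Qed.

Lemma map_spowN t x : map_mx (spow t) (- x) = - map_mx (spow t) x.
Proof. by apply/rowP => i; rewrite !mxE spowN. Qed.

Lemma map_spowZ t a x : t != 0 -> 0 <= a ->
  map_mx (spow t) (a *: x) = a `^ t *: map_mx (spow t) x.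
Proof. by move=> t0 a0; apply/rowP => i; rewrite !mxE spowM. Qed.

End MapSpow.

Lemma mulmx_row_continuous (R : realType) k n (M : 'M[R]_(k, n)) :
  continuous (fun a : 'rV[R]_k => a *m M).
Proof.
rewrite (_ : (fun a => _) = fun a : 'rV[R]_k => \row_j \sum_i a 0 i * M i j).
  apply: continuous_row => j; apply: continuous_sum => i _ a.
  apply: (@continuous_comp _ _ _ (fun a : 'rV[R]_k => a 0 i) ( *%R^~ (M i j))).
    exact: coord_continuous.
  exact: mulrr_continuous.
by apply/funext => a; apply/rowP => j; rewrite !mxE.
Qed.

Lemma card_ord_ge n m (P : pred 'I_n) : (forall k : 'I_n, (m <= k)%N -> P k) ->
  (n - m <= #|P|)%N.
Proof.
move=> mP; have [nm|mn] := leqP n m; first by rewrite (eqP nm).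
have H (i : 'I_(n - m)) : (m + i < n)%N by have := ltn_ord i; lia.
rewrite -[X in (X <= _)%N]card_ord.
rewrite -(card_codom (f := fun i : 'I_(n - m) => Ordinal (H i))); last first.
  by move=> i j [] /addnI/val_inj.
by apply: subset_leq_card; apply/fintype.subsetP => _ /codomP[i ->]; apply: mP; rewrite leq_addr.
Qed.

Section PseudoIndependence.
Variables (R : realType) (n : nat) (e : rel 'I_n).
Hypothesis e_simple : simple_graph e.
Hypothesis e_deg : no_isolated_vertex e.
Variable P : {set {set 'I_n}}.
Hypothesis P_nonadj : nonadjacent_cliques e P.

Let P_trivI : finset.trivIset P.
Proof. by case/and4P: P_nonadj. Qed.

(** Vanishing of all coordinates but [clique_weight A] of them on each [A \in P],
    where on a large clique the third coordinate is replaced by the median of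
    the first three, leaves no edge [{i, j}] with [x_i x_j > 0]. *)
Definition leading (A : {set 'I_n}) : {set 'I_n} :=
  [set i in take (clique_weight A) (enum A)].

(** These vertices carry no condition and each other vertex carries one, which leaves [n] minus the
    total weight of them. *)
Definition removed : {set 'I_n} :=
  [set i in finset.cover P | i \in leading (finset.pblock P i)].

Lemma leadingS A : leading A \subset A.
Proof. by apply/fintype.subsetP => i; rewrite inE => /mem_take; rewrite mem_enum. Qed.

Lemma card_leading A : A \in P -> #|leading A| = clique_weight A.
Proof.
move=> AP; have A0 : (0 < #|A|)%N.
  rewrite card_gt0; apply/eqP => A0; case/and4P: P_nonadj => _ /negP[].
  by rewrite -A0.
rewrite /leading cardsE (card_uniqP _) ?take_uniq ?enum_uniq // size_take -cardE.
by rewrite /clique_weight; case: (leqP #|A| 2) => ?; case: ltnP => ?; lia.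
Qed.

Lemma card_removed : #|removed| = \sum_(A in P) clique_weight A.
Proof.
rewrite -sum1_card /removed.
rewrite (eq_bigl (fun i => (i \in finset.cover P) && (i \in leading (finset.pblock P i)))); last first.
  by move=> i; rewrite inE.
rewrite finset.big_trivIset_cond //; apply: eq_bigr => A AP.
rewrite -(card_leading AP) -sum1_card; apply: eq_bigl => i.
case iA: (i \in A); first by rewrite (finset.def_pblock P_trivI AP).
by apply/esym/negbTE; apply: contraFN iA => /(fintype.subsetP (leadingS A)).
Qed.

(** The index [2] occurs only in cliques with at least three vertices. *)
Definition median_vertex i := (i \in finset.cover P) && (index i (enum (finset.pblock P i)) == 2).

Definition reduced_coord (i : 'I_n) (x : 'rV[R]_n) : R :=
  if median_vertex i then
    let s := enum (finset.pblock P i) in median (x 0 (nth i s 0)) (x 0 (nth i s 1)) (x 0 i)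
  else x 0 i.

Lemma reduced_coord_odd i x : reduced_coord i (- x) = - reduced_coord i x.
Proof. by rewrite /reduced_coord; case: ifP => _; rewrite !mxE ?medianN. Qed.

Lemma reduced_coord_continuous i : continuous (reduced_coord i).
Proof.
rewrite /reduced_coord; case: (median_vertex i); last exact: coord_continuous.
move=> x; have cc k : {for x, continuous (fun y : 'rV[R]_n => y 0 k)}.
  exact: coord_continuous.
exact: (continuous_max (continuous_min (cc _) (cc _))
  (continuous_min (continuous_max (cc _) (cc _)) (cc _))).
Qed.

Lemma reduced_coordZ i a x : 0 <= a -> reduced_coord i (a *: x) = a * reduced_coord i x.
Proof. by move=> a0; rewrite /reduced_coord; case: ifP => _; rewrite !mxE ?medianM. Qed.

Lemma reduced_coord_support x i : (forall j, j \notin removed -> reduced_coord j x = 0) ->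
  x 0 i != 0 -> exists2 A, A \in P & (i \in A) && (index i (enum A) <= 2)%N.
Proof.
move=> x0 xi; have [iP|iP] := boolP (i \in finset.cover P); last first.
  case/eqP: xi; rewrite -[RHS](x0 i); first by rewrite /reduced_coord /median_vertex (negPf iP).
  by rewrite inE negb_and iP.
exists (finset.pblock P i); first exact: finset.pblock_mem.
rewrite finset.mem_pblock iP /=; set s := enum _; rewrite leqNgt; apply/negP => is2.
case/eqP: xi; rewrite -[RHS](x0 i).
  by rewrite /reduced_coord /median_vertex iP -/s gtn_eqF.
rewrite inE iP inE -/s; apply: contraL is2 => /index_ltn.
rewrite /clique_weight; by case: ifP => _ h; rewrite -leqNgt ltnW // (leq_trans h).
Qed.

(** Adjacent vertices with nonzero values lie in the same clique. A small clique has only one such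
    vertex; in a large one both are among the first three, whose median is zero. *)
Lemma reduced_coord_edge x i j : (forall l, l \notin removed -> reduced_coord l x = 0) ->
  e i j -> x 0 i * x 0 j <= 0.
Proof.
move=> x0 eij; have [->|xi] := eqVneq (x 0 i) 0; first by rewrite mul0r.
have [->|xj] := eqVneq (x 0 j) 0; first by rewrite mulr0.
have [A AP /andP[iA iA2]] := reduced_coord_support x0 xi.
have [B BP /andP[jB jB2]] := reduced_coord_support x0 xj.
have AB : A = B.
  case/and4P: P_nonadj => _ _ _ /forallP/(_ i)/forallP/(_ j)/implyP/(_ eij).
  move/card_le1_eqP; apply; rewrite inE ?AP ?BP ?iA ?jB ?orbT //.
subst B.
have ij : i != j by apply: contraTneq eij => ->; rewrite e_simple.2.
have lead l : l \in A ->
    (l \notin removed) = (clique_weight A <= index l (enum A))%N.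
  move=> lA; have -> : (l \in removed) = (l \in leading A).
    rewrite inE (finset.def_pblock P_trivI AP lA).
    by rewrite (_ : l \in finset.cover P) //; apply/bigcupP; exists A.
  by rewrite inE in_take ?mem_enum // -leqNgt.
have mvE l : l \in A -> median_vertex l = (index l (enum A) == 2).
  move=> lA; rewrite /median_vertex (finset.def_pblock P_trivI AP lA).
  by rewrite (_ : l \in finset.cover P) //; apply/bigcupP; exists A.
have [A2|A3] := leqP #|A| 2.
  have first l : l \in A -> x 0 l != 0 -> index l (enum A) = 0%N.
    move=> lA xl; have := index_mem l (enum A); rewrite mem_enum lA -cardE => lA2.
    case: (posnP (index l (enum A))) => // l0; case/eqP: xl.
    rewrite -[RHS](x0 l) ?lead // /clique_weight ?A2 //.
    by rewrite /reduced_coord mvE // ltn_eqF // (leq_trans lA2).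
  case/eqP: ij; rewrite -(nth_index i (_ : i \in enum A)) ?mem_enum //.
  by rewrite -[RHS](nth_index i (_ : j \in enum A)) ?mem_enum // !first.
case sE: (enum A) (cardE A) => [|a [|b [|c s]]] szA; rewrite ?szA // in A3.
have sA l : l \in [:: a; b; c] -> l \in A.
  rewrite -mem_enum sE !inE => /or3P[] /eqP->; rewrite eqxx ?orbT //.
have := enum_uniq A; rewrite sE /= !inE !negb_or => /and4P[/and3P[ab ac _] /andP[bc _] _ _].
have cA : c \in A by apply: sA; rewrite !inE eqxx !orbT.
have ic : index c (enum A) = 2 by rewrite sE /= (negPf ac) (negPf bc) eqxx.
have : reduced_coord c x = 0.
  by apply: x0; rewrite lead // ic /clique_weight; case: ifP.
rewrite /reduced_coord mvE // ic eqxx (finset.def_pblock P_trivI AP cA) sE /=.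
move=> /median_eq0[ab0 ac0 bc0].
have in3 l : l \in A -> (index l (enum A) <= 2)%N -> l \in [:: a; b; c].
  move=> lA l2; have <- : take 3 (enum A) = [:: a; b; c] by rewrite sE /= take0.
  by rewrite in_take ?mem_enum.
have := in3 i iA iA2; have := in3 j jB jB2.
rewrite !inE => /or3P[] /eqP jE /or3P[] /eqP iE; rewrite iE jE //;
  solve [by rewrite mulrC | by rewrite iE jE eqxx in ij].
Qed.

Lemma rayleigh1_le1 (x : 'rV[R]_n) : x != 0 -> rayleigh e 1 x <= 1.
Proof.
move=> x0; rewrite rayleighE ler_pdivrMr ?degree_mass_gt0 // mul1r.
rewrite /degree_mass -sum_edges //; apply: ler_sum => ij _.
by rewrite !powRr1 // ler_normB.
Qed.

Lemma rayleigh1_ge1 (x : 'rV[R]_n) : x != 0 ->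
  (forall i, i \notin removed -> reduced_coord i x = 0) -> 1 <= rayleigh e 1 x.
Proof.
move=> x0 xr; rewrite rayleighE ler_pdivlMr ?degree_mass_gt0 // mul1r.
rewrite /degree_mass -sum_edges //; apply: ler_sum => -[i j] /andP[_ /= eij].
have := reduced_coord_edge xr eij; rewrite !powRr1 //.
case: (ger0P (x 0 i)) => xi; case: (ger0P (x 0 j)) => xj;
  case: (ger0P (x 0 i - x 0 j)) => xij; nra.
Qed.

Let m := #|~: removed|.
Let F t (j : 'I_m) (x : 'rV[R]_n) := reduced_coord (enum_val j) (map_mx (spow t) x).

Let F_continuous t j : 0 < t -> continuous (F t j).
Proof.
move=> t0 x; apply: (@continuous_comp _ _ _ (map_mx (spow t)) (reduced_coord (enum_val j))).
  exact: map_spow_continuous.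
exact: reduced_coord_continuous.
Qed.

Let F_odd t j x : F t j (- x) = - F t j x.
Proof. by rewrite /F map_spowN reduced_coord_odd. Qed.

Let F_rayleigh t x : t != 0 -> x != 0 -> (forall j, F t j x = 0) ->
  1 <= rayleigh e 1 (map_mx (spow t) x).
Proof.
move=> t0 x0 Fx; apply: rayleigh1_ge1 => [|i ir]; first by rewrite map_spow_eq0.
have ir' : i \in ~: removed by rewrite inE.
by have := Fx (enum_rank_in ir' i); rewrite /F enum_rankK_in.
Qed.

Let count_ge (Q : pred 'I_n) : (forall k : 'I_n, (m <= k)%N -> Q k) ->
  (\sum_(A in P) clique_weight A <= #|Q|)%N.
Proof.
move=> mQ; rewrite -card_removed (leq_trans _ (card_ord_ge mQ)) //.
by rewrite /m -[n in (n - _)%N]card_ord -(cardsC removed) addnK.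
Qed.

Lemma pseudo_independence_gt (p : R) : 1 < p ->
  (\sum_(A in P) clique_weight A <=
     #|[pred k : 'I_n | ((2 `^ (p - 1) / p `^ p)%:E < minmax_eigenvalue e p k.+1)%E]|)%N.
Proof.
move=> p1; have p0 : 0 < p by lra.
apply: count_ge => k mk /=.
apply: (minmax_eigenvalue_gt e_deg (F := F p)) => // [j|a x j a0|x x0 Fx].
- exact: F_continuous.
- by rewrite /F map_spowZ ?ltW ?gt_eqF // reduced_coordZ ?powR_ge0 // => ->; rewrite mulr0.
rewrite ltNge; apply/negP => Fp.
(* With this [T] the bound [p T^(1/p) / 2] equals [1], so a small [F_p] would force [F_1 < 1]. *)
have T0 : 0 < (2 / p) `^ p by rewrite powR_gt0 // divr_gt0.
have := @rayleigh_spow_lt R n e e_simple e_deg p 1 ((2 / p) `^ p) x p1 (lexx 1) T0 x0.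
rewrite mulr1; rewrite powR2_div // in Fp.
move=> /(_ Fp); rewrite powRr1 ?(ltW p0) // powRVK ?gt_eqF // ?divr_ge0 ?(ltW p0) //.
rewrite mulrCA mulfV ?gt_eqF // mulr1 divff // ltNge.
by rewrite F_rayleigh // gt_eqF.
Qed.

Lemma pseudo_independence_eq1 :
  (\sum_(A in P) clique_weight A <=
     #|[pred k : 'I_n | minmax_eigenvalue e (1 : R) k.+1 == 1%E]|)%N.
Proof.
apply: count_ge => k mk /=; rewrite eq_le; apply/andP; split.
  (* As [F_1] never exceeds [1], any subspace of dimension [k.+1] will do; this is a coordinate
     one. *)
  have free : row_free (pid_mx k.+1 : 'M[R]_(k.+1, n)).
    by rewrite /row_free rank_pid_mx.
  apply: (minmax_eigenvalue_le (f := fun a : 'rV[R]_k.+1 => a *m (pid_mx k.+1 : 'M[R]_(k.+1, n)))).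
  - exact: mulmx_row_continuous.
  - by move=> a; rewrite mulNmx.
  - by move=> a /eqP; rewrite mulmx_free_eq0 // => /eqP.
  by move=> a a0; apply: rayleigh1_le1; rewrite mulmx_free_eq0.
apply: (minmax_eigenvalue_ge (F := F 1) _ _ (mk : (m < k.+1)%N)) => [j|j x|x x0 Fx].
- exact: F_continuous.
- exact: F_odd.
have := F_rayleigh (oner_neq0 _) x0 Fx.
rewrite (_ : map_mx _ x = x) //; apply/rowP => i; rewrite mxE /spow powRr1 //.
by rewrite mulr_sg_norm.
Qed.

End PseudoIndependence.

(** * A normalized adjacency eigenvalue in [-1/2, 1/2] *)

(** With [c u v] the sum of [1 / d i] over the common neighbours of [u] and [v]
    lying in [K], the form [c - diag (d / 4)] cannot be positive definite on
    [K]: its 2x2 minors exclude the degrees 2, 3, 4, ... in turn. *)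
Section DegreeElimination.
Variables (R : realType) (n : nat) (e : rel 'I_n) (K : pred 'I_n).
Hypothesis e_simple : simple_graph e.
Notation d := (vdeg e).

(** Zero outside [K]: in the application the neighbour sums of the test functions vanish there. *)
Definition weight i : R := (K i)%:R / (d i)%:R.
Definition common u v : R := \sum_(i | e u i && e v i) weight i.

Hypothesis K_deg : forall i, K i -> (1 < d i)%N.
Hypothesis minor1 : forall u, K u -> (d u)%:R / 4 < common u u.
Hypothesis minor2 : forall u v, K u -> K v -> u != v ->
  common u v ^+ 2 < (common u u - (d u)%:R / 4) * (common v v - (d v)%:R / 4).

Let eC u v : e u v = e v u. Proof. exact: e_simple.1. Qed.

Lemma weight_ge0 i : 0 <= weight i.
Proof. by rewrite /weight divr_ge0. Qed.

Lemma weightE i : K i -> weight i = (d i)%:R^-1.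
Proof. by move=> Ki; rewrite /weight Ki mul1r. Qed.

Lemma weight_le i m : (K i -> m.+1 <= d i)%N -> weight i <= m.+1%:R^-1.
Proof.
rewrite /weight; case: (K i) => [/(_ isT) md|_]; last by rewrite mul0r invr_ge0.
by rewrite mul1r lef_pV2 ?posrE ?ltr0n ?ler_nat // (leq_trans _ md).
Qed.

Lemma weight_le_common u v i : e u i -> e v i -> weight i <= common u v.
Proof.
move=> ui vi; rewrite /common (bigD1 i) ?ui //= lerDl.
by apply: sumr_ge0 => j _; exact: weight_ge0.
Qed.

Lemma commonE u : common u u = \sum_(i | e u i) weight i.
Proof. by apply: eq_bigl => i; rewrite andbb. Qed.

Lemma common_split u x b : e u x -> (forall i, e u i -> i != x -> weight i <= b) ->
  common u u <= weight x + (d u)%:R * b - b.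
Proof.
move=> ux ib; rewrite commonE (bigD1 x) //= -addrA lerD2l.
rewrite (_ : (d u)%:R * b - b = \sum_(i | e u i && (i != x)) b).
  by apply: ler_sum => i /andP[]; exact: ib.
rewrite sumr_const -[in RHS]mulr_natl (_ : d u = #|[pred i | e u i && (i != x)]|.+1).
  by rewrite -natr1 mulrDl mul1r addrK.
rewrite /vdeg (cardD1 x) inE ux add1n; congr _.+1.
by apply: eq_card => i; rewrite !inE andbC.
Qed.

Lemma common_le u b : (forall i, e u i -> weight i <= b) ->
  common u u <= (d u)%:R * b.
Proof.
move=> ib; rewrite commonE; apply: (le_trans (ler_sum _ ib)).
by rewrite sumr_const mulr_natl.
Qed.

Lemma nbrs_deg2 u : d u = 2 -> exists x y, [/\ x != y, e u x, e u y &
  common u u = weight x + weight y].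
Proof.
rewrite /vdeg cardE => du; have := enum_uniq [pred j | e u j].
have memE i : (i \in enum [pred j | e u j]) = e u i by rewrite mem_enum.
rewrite commonE (eq_bigl (mem [pred j | e u j])) // -big_enum.
case: (enum _) du memE => [|x [|y [|]]] //= _ memE /andP[]; rewrite inE => xy _.
exists x, y; split=> //; first by rewrite -memE mem_head.
  by rewrite -memE !inE eqxx orbT.
by rewrite !big_cons big_nil addr0.
Qed.

Lemma nbrs_deg3 u : d u = 3 -> exists x y z, [/\ x != y, x != z & y != z] /\
  [/\ e u x, e u y, e u z & common u u = weight x + weight y + weight z].
Proof.
rewrite /vdeg cardE => du; have := enum_uniq [pred j | e u j].
have memE i : (i \in enum [pred j | e u j]) = e u i by rewrite mem_enum.
rewrite commonE (eq_bigl (mem [pred j | e u j])) // -big_enum.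
case: (enum _) du memE => [|x [|y [|z [|]]]] //= _ memE /and3P[].
rewrite !inE negb_or => /andP[xy xz] yz _; exists x, y, z; split=> //; split.
- by rewrite -memE mem_head.
- by rewrite -memE !inE eqxx orbT.
- by rewrite -memE !inE eqxx !orbT.
by rewrite !big_cons big_nil addr0 addrA.
Qed.

Lemma weight_half i : weight i <= 2^-1.
Proof. exact: (@weight_le i 1) (@K_deg i). Qed.

(** Both diagonal entries of the minor are at most [weight x], while the off-diagonal entry is at
    least that. *)
Lemma deg2_common_nbr u v x : K u -> K v -> u != v -> d u = 2 -> d v = 2 ->
  e u x -> e v x -> False.
Proof.
move=> Ku Kv uv du dv ux vx.
have Hu := common_split ux (fun i _ _ => weight_half i).
have Hv := common_split vx (fun i _ _ => weight_half i).
have := minor2 Ku Kv uv; have := minor1 Ku; have := minor1 Kv.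
have := weight_le_common ux vx; have := weight_ge0 x.
rewrite du in Hu *; rewrite dv in Hv *.
by nra.
Qed.

(** At most one neighbour in [K] has degree two, and it exceeds the weight [1/3] by [1/6]. *)
Lemma common_le_third u : K u -> common u u <= (d u)%:R / 3 + 6^-1.
Proof.
move=> Ku; have [/existsP[x /andP[ux /andP[Kx /eqP dx]]]|/existsPn no] :=
  boolP [exists x, e u x && (K x && (d x == 2))].
  have H i : e u i -> i != x -> weight i <= 3^-1.
    move=> ui ix; apply: (@weight_le i 2) => Ki; rewrite ltn_neqAle K_deg // andbT.
    apply/eqP => di; apply: (deg2_common_nbr Ki Kx ix (esym di) dx) (_ : e i u) _.
      by rewrite eC.
    by rewrite eC.
  have := common_split ux H; have := weight_half x; lra.
have H i : e u i -> weight i <= 3^-1.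
  move=> ui; apply: (@weight_le i 2) => Ki; rewrite ltn_neqAle K_deg // andbT.
  by have := no i; rewrite ui Ki /= eq_sym.
have := common_le H; lra.
Qed.

Lemma deg2_nonadjacent u v : K u -> K v -> d u = 2 -> d v = 2 -> e u v -> False.
Proof.
move=> Ku Kv du dv uv.
have other a b : K a -> K b -> d a = 2 -> d b = 2 -> e a b ->
    exists2 x, e a x & [/\ x != b, K x, (2 < d x)%N & common a a = 2^-1 + weight x].
  move=> Ka Kb da db ab; have [x [y [xy ax ay caa]]] := nbrs_deg2 da.
  have wb : weight b = 2^-1 by rewrite weightE // db.
  wlog xb : x y xy ax ay caa / b = x.
    move=> W; have [bx|bx] := eqVneq b x; first exact: (W x y).
    have [bY|bY] := eqVneq b y.
      by apply: (W y x) => //; rewrite 1?eq_sym // caa addrC.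
    have Ha : (2 < d a)%N.
      rewrite /vdeg (cardD1 x) inE ax (cardD1 y) !inE ay eq_sym xy (cardD1 b) !inE ab.
      by rewrite bx bY.
    by rewrite da in Ha.
  subst x; exists y => //.
  have Ky : K y.
    apply: contraT => Ky; have := minor1 Ka; rewrite caa wb da /weight (negPf Ky).
    by rewrite mul0r; lra.
  split=> //; first by rewrite eq_sym.
    rewrite ltn_neqAle K_deg // andbT; apply/eqP => dy.
    by apply: (deg2_common_nbr Kb Ky xy db (esym dy)) (_ : e b a) _; rewrite eC.
  by rewrite caa wb.
have [x ux [xv Kx dx cu]] := other u v Ku Kv du dv uv.
have vu : e v u by rewrite eC.
have [y vy [yu Ky dy cv]] := other v u Kv Ku dv du vu.
(* Minor of [a] and [b], whose common neighbour [w] has weight [1/2]; [z] is the other neighbour of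
   [a]. The two instances give [3 d x < d y + 2] and [3 d y < d x + 2], impossible for degrees from
   [3] on. *)
have bound a b w z : K a -> K b -> K w -> K z -> b != a -> e a w -> e b w ->
    d a = 2 -> d w = 2 -> common a a = 2^-1 + weight z ->
    3 * (d z)%:R < (d b)%:R + 2 :> R.
  move=> Ka Kb Kw Kz ba aw bw da dw ca.
  have := minor2 Ka Kb (_ : a != b); rewrite eq_sym => /(_ ba).
  have := weight_le_common aw bw; rewrite weightE // dw => cab.
  have dz0 : 0 < (d z)%:R :> R by rewrite ltr0n (leq_trans _ (K_deg Kz)).
  have -> : common a a - (d a)%:R / 4 = (d z)%:R^-1.
    by rewrite ca weightE // da; lra.
  have c4 : 4^-1 <= common a b ^+ 2 by nra.
  rewrite ltr_pdivlMl //; have := common_le_third Kb.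
  have := ler_wpM2l (ltW dz0) c4; lra.
have H1 := bound u y v x Ku Ky Kv Kx yu uv (_ : e y v) du dv cu.
have H2 := bound v x u y Kv Kx Ku Ky xv vu (_ : e x u) dv du cv.
have := H1 (etrans (eC y v) vy); have := H2 (etrans (eC x u) ux).
have : 3 <= (d x)%:R :> R by rewrite ler_nat.
have : 3 <= (d y)%:R :> R by rewrite ler_nat.
lra.
Qed.

Lemma deg2_absent u : K u -> d u = 2 -> False.
Proof.
move=> Ku du; have [x [y [xy ux uy cu]]] := nbrs_deg2 du.
have third z : e u z -> K z -> (2 < d z)%N.
  move=> uz Kz; rewrite ltn_neqAle K_deg // andbT; apply/eqP => dz.
  exact: (deg2_nonadjacent Ku Kz du (esym dz) uz).
have wx := weight_le (third x ux); have wy := weight_le (third y uy).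
have := minor1 Ku; rewrite cu du => H.
have Kx : K x by apply: contraT => Kx; move: H; rewrite {1}/weight (negPf Kx) mul0r; lra.
have Ky : K y by apply: contraT => Ky; move: H; rewrite {2}/weight (negPf Ky) mul0r; lra.
have := minor2 Kx Ky xy; have := common_le_third Kx; have := common_le_third Ky.
have := weight_le_common (etrans (eC x u) ux) (etrans (eC y u) uy).
move: H; rewrite !weightE // du.
have x3 := third x ux Kx; have y3 := third y uy Ky.
have X3 : 3 <= (d x)%:R :> R by rewrite ler_nat.
have Y3 : 3 <= (d y)%:R :> R by rewrite ler_nat.
have X0 : 0 < (d x)%:R :> R by lra.
have Y0 : 0 < (d y)%:R :> R by lra.
rewrite [_ / 4](_ : _ = 2^-1); last by field.
rewrite -[X in X < _]mulr1 => H.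
have {}H : (d x)%:R * (d y)%:R < 2 * ((d x)%:R + (d y)%:R) :> R.
  move: H; rewrite -(ltr_pM2r (mulr_gt0 X0 Y0)).
  rewrite (_ : _ * _ * (_ * _) = (d x)%:R * (d y)%:R / 2); last by field.
  rewrite (_ : (_ + _) * (_ * _) = (d x)%:R + (d y)%:R); first by lra.
  by field; rewrite !gt_eqF.
have {}H : ((d x - 2) * (d y - 2) <= 3)%N.
  by move: H; rewrite -natrM -natrD -natrM ltr_nat; nia.
(* The degrees [3] and [5] are the extreme case. The minor of [x] and [y], whose off-diagonal entry
   is at least [1/2], would require this product to exceed [144 / 4 = 36]. *)
have {H} : ((d x + 2) * (d y + 2) <= 35)%N by nia.
rewrite -(ler_nat R) natrM (natrD _ (d x)) (natrD _ (d y)) => H c1 c2 c3 m2.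
have c4 : 4^-1 <= common x y ^+ 2 by nra.
have ax : 0 <= common x x - (d x)%:R / 4 by rewrite subr_ge0 ltW ?minor1.
have ay : 0 <= common y y - (d y)%:R / 4 by rewrite subr_ge0 ltW ?minor1.
have bx : common x x - (d x)%:R / 4 <= ((d x)%:R + 2) / 12 by lra.
have by_ : common y y - (d y)%:R / 4 <= ((d y)%:R + 2) / 12 by lra.
have := ler_pM ax ay bx by_; lra.
Qed.

Lemma deg3_absent u : K u -> d u = 3 -> False.
Proof.
move=> Ku du; have deg i : K i -> (2 < d i)%N.
  by move=> Ki; rewrite ltn_neqAle K_deg // andbT; apply/eqP => di; exact: (deg2_absent Ki).
have third i := weight_le (@deg i).
have common3 i : K i -> common i i <= (d i)%:R * 3^-1.
  by move=> _; apply: common_le => j _; exact: third.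
have [x [y [z [[xy xz yz] [ux uy uz cu]]]]] := nbrs_deg3 du.
have := minor1 Ku; rewrite cu du => H.
have Kn w : e u w -> weight x + weight y + weight z - weight w <= 2 / 3 -> K w.
  by move=> uw H'; apply: contraT => Kw; move: H H'; rewrite [weight w]/weight (negPf Kw) mul0r; lra.
have wx := third x; have wy := third y; have wz := third z.
have Kx : K x by apply: Kn => //; lra.
have Ky : K y by apply: Kn => //; lra.
have Kz : K z by apply: Kn => //; lra.
(* The common neighbour [u] gives an off-diagonal entry of at least [1/3], and the diagonal entries
   are at most [d / 12]. *)
have pair a b : K a -> K b -> a != b -> e u a -> e u b -> weight a * weight b < 16^-1.
  move=> Ka Kb ab ua ub; have := minor2 Ka Kb ab.
  have := weight_le_common (etrans (eC a u) ua) (etrans (eC b u) ub).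
  have := common3 a Ka; have := common3 b Kb; rewrite !weightE // du.
  have a0 : 0 < (d a)%:R :> R by rewrite ltr0n (leq_trans _ (deg a Ka)).
  have b0 : 0 < (d b)%:R :> R by rewrite ltr0n (leq_trans _ (deg b Kb)).
  have ma := minor1 Ka; have mb := minor1 Kb.
  move=> cb ca c3 m2; rewrite -invfM ltf_pV2 ?posrE ?mulr_gt0 //.
  nra.
have := pair x y Kx Ky xy ux uy; have := pair x z Kx Kz xz ux uz.
have := pair y z Ky Kz yz uy uz; have := weight_ge0 x; have := weight_ge0 y; have := weight_ge0 z.
(* From [r <= 1/3] one gets [q > 5/24 > 1/8], and [q^2 < 1/16] gives [q < 1/4]. But
   [2 q + 1 / (16 q) > 3/4] means [(q - 1/8) (q - 1/4) > 0]. *)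
have absurd (p q r : R) : 0 <= p -> p <= q -> q <= r -> r <= 3^-1 -> q * r < 16^-1 ->
    3 / 4 < p + q + r -> False.
  move=> p0 pq qr r3 qr16 s; have q4 : q < 4^-1 by nra.
  have : (q - 8^-1) * (q - 4^-1) < 0 by nra.
  nra.
move=> z0 y0 x0 hyz hxz hxy.
have [xy'|/ltW yx'] := lerP (weight x) (weight y);
  have [yz'|/ltW zy'] := lerP (weight y) (weight z);
  have [xz'|/ltW zx'] := lerP (weight x) (weight z).
- by apply: (absurd (weight x) (weight y) (weight z)) => //; lra.
- by apply: (absurd (weight x) (weight y) (weight z)) => //; lra.
- by apply: (absurd (weight x) (weight z) (weight y)) => //; lra.
- by apply: (absurd (weight z) (weight x) (weight y)) => //; lra.
- by apply: (absurd (weight y) (weight x) (weight z)) => //; lra.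
- by apply: (absurd (weight y) (weight z) (weight x)) => //; lra.
- by apply: (absurd (weight z) (weight y) (weight x)) => //; lra.
- by apply: (absurd (weight z) (weight y) (weight x)) => //; lra.
Qed.

(** Once all degrees are at least [4], weights are at most [1/4] and [minor1] fails. *)
Lemma degree_elimination u : K u -> False.
Proof.
move=> Ku; have := minor1 Ku.
have deg i : K i -> (3 < d i)%N.
  move=> Ki; have := K_deg Ki; case: (ltngtP (d i) 3) => // [|/deg3_absent-/(_ Ki)//].
  by move=> d3 d2; case: (@deg2_absent i Ki); lia.
have H : common u u <= (d u)%:R * 4^-1.
  by apply: common_le => i _; apply: (@weight_le i 3) (deg i).
lra.
Qed.

End DegreeElimination.

(** * Test functions: reduction to vertices away from the leaves *)

Section TestFunction.
Variables (R : realType) (n : nat) (e : rel 'I_n).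
Hypothesis n_gt2 : (2 < n)%N.
Hypothesis e_simple : simple_graph e.
Hypothesis e_deg : no_isolated_vertex e.
Hypothesis e_conn : connected_graph e.
Notation d := (vdeg e).
Implicit Types f g : 'I_n -> R.

Definition nbr_sum f i : R := \sum_(j | e i j) f j.

Hypothesis form_gt0 : forall f, (exists i, f i != 0) ->
  4^-1 * (\sum_i (d i)%:R * f i ^+ 2) < \sum_i nbr_sum f i ^+ 2 / (d i)%:R.

Let eC u v : e u v = e v u. Proof. exact: e_simple.1. Qed.

Let d_gt0 i : 0 < (d i)%:R :> R. Proof. by rewrite ltr0n; exact: e_deg. Qed.

Definition leaf i := d i == 1.

Lemma leaf_nbr v w w' : leaf v -> e v w -> e v w' -> w = w'.
Proof.
move=> /eqP dv vw vw'; have /card_le1_eqP := eq_leq dv.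
by apply; rewrite inE.
Qed.

Lemma nbr_sum_delta v i : nbr_sum (fun j => (j == v)%:R) i = (e i v)%:R.
Proof.
rewrite /nbr_sum; case iv: (e i v).
  by rewrite (bigD1 v) //= eqxx big1 ?addr0 // => j /andP[_ /negPf->].
by apply: big1 => j ij; case: eqP => // jv; rewrite -jv ij in iv.
Qed.

Lemma nbr_sumB f g i : nbr_sum (fun j => f j - g j) i = nbr_sum f i - nbr_sum g i.
Proof. by rewrite /nbr_sum big_split sumrN. Qed.

Lemma mass_ge0 f : 0 <= 4^-1 * (\sum_i (d i)%:R * f i ^+ 2).
Proof.
rewrite mulr_ge0 ?invr_ge0 // sumr_ge0 // => i _.
by rewrite mulr_ge0 // sqr_ge0.
Qed.

(** The difference of the indicators of two leaves at the same vertex has zero neighbour sums. *)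
Lemma leaf_unique v v' w : leaf v -> leaf v' -> e w v -> e w v' -> v = v'.
Proof.
move=> lv lv' wv wv'; apply/eqP/negPn/negP => vv'.
have := @form_gt0 (fun j => (j == v)%:R - (j == v')%:R).
rewrite [X in _ < X]big1 => [|i _].
  have H : exists i, (i == v)%:R - (i == v')%:R != 0 :> R.
    by exists v; rewrite eqxx (negPf vv') subr0 oner_neq0.
  by move=> /(_ H); apply/negP; rewrite -leNgt mass_ge0.
rewrite nbr_sumB !nbr_sum_delta.
have -> : e i v = e i v'.
  move: wv wv'; rewrite ![e w _]eC ![e i _]eC => vw v'w.
  apply/idP/idP => [/(leaf_nbr lv vw)|/(leaf_nbr lv' v'w)] <- //.
by rewrite subrr expr0n mul0r.
Qed.

Lemma leaf_nonadjacent v w : leaf v -> e v w -> ~~ leaf w.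
Proof.
move=> lv vw; apply/negP => lw; have wv : e w v by rewrite eC.
have cl : fingraph.closed e (pred2 v w).
  move=> i j ij; rewrite !inE; apply/idP/idP => /orP[]/eqP E; rewrite E in ij *.
  - by rewrite (leaf_nbr lv ij vw) eqxx orbT.
  - by rewrite (leaf_nbr lw ij wv) eqxx.
  - by rewrite eC in ij; rewrite (leaf_nbr lv ij vw) eqxx orbT.
  - by rewrite eC in ij; rewrite (leaf_nbr lw ij wv) eqxx.
have : (#|'I_n| <= #|pred2 v w|)%N.
  apply/subset_leq_card/fintype.subsetP => i _.
  by rewrite -(closed_connect cl (e_conn.2 v i)) !inE eqxx.
by rewrite card_ord card2; case: eqP => _ /=; lia.
Qed.

Lemma leaf_nbr_deg v w : leaf v -> e v w -> (1 < d w <= 3)%N.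
Proof.
move=> lv vw; have /negbTE := leaf_nonadjacent lv vw; rewrite /leaf => dw1.
have := e_deg w; rewrite leq_eqVlt eq_sym dw1 /= => -> /=.
have := @form_gt0 (fun j => (j == v)%:R).
rewrite (bigD1 v) //= eqxx big1 => [|i /negPf->]; last by rewrite expr0n mulr0.
rewrite (bigD1 w) //= nbr_sum_delta eC vw big1 => [|i iw].
  have H : exists i, (i == v)%:R != 0 :> R by exists v; rewrite eqxx oner_neq0.
  move=> /(_ H); rewrite (eqP lv) !expr1n => {}H.
  have : 4^-1 < (d w)%:R^-1 :> R by lra.
  by rewrite ltf_pV2 ?posrE ?d_gt0 // ltr_nat ltnS.
rewrite nbr_sum_delta; case iv: (e i v); last by rewrite expr0n mul0r.
by rewrite eC in iv; rewrite (leaf_nbr lv iv vw) eqxx in iw.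
Qed.

Definition core i := ~~ leaf i && ~~ [exists v, leaf v && e i v].

(** The values [-2] on leaves and [1] elsewhere give neighbour sums [1] at leaves and [d - 3] at
    their neighbours. As these have degree [2] or [3], positivity fails term by term. *)
Lemma no_core : (forall i, ~~ core i) -> False.
Proof.
move=> nc; have [i0 _] : exists i0 : 'I_n, true by exists (Ordinal (ltn_trans (isT : 0 < 2)%N n_gt2)).
pose f i : R := if leaf i then -2 else 1.
have := @form_gt0 f; have H : exists i, f i != 0.
  by exists i0; rewrite /f; case: ifP; rewrite ?oppr_eq0 ?pnatr_eq0 ?oner_eq0.
move=> /(_ H); apply/negP; rewrite -leNgt mulr_sumr; apply: ler_sum => i _.
have cst (P : pred 'I_n) : \sum_(j | P j) 1 = #|P|%:R :> R by rewrite sumr_const.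
have [li|nli] := boolP (leaf i).
  have -> : nbr_sum f i = 1.
    rewrite /nbr_sum (eq_bigr (fun=> 1)) => [|j ij]; last first.
      by rewrite /f (negPf (leaf_nonadjacent li ij)).
    by rewrite cst -/(vdeg e i) (eqP li).
  by rewrite /f li (eqP li); lra.
have := nc i; rewrite /core nli /= negbK => /existsP[v /andP[lv iv]].
have vi : e v i by rewrite eC.
have -> : nbr_sum f i = (d i)%:R - 3.
  rewrite /nbr_sum (bigD1 v) //= {1}/f lv (eq_bigr (fun=> 1)) => [|j /andP[ij jv]].
    have -> : d i = #|[pred j | e i j && (j != v)]|.+1.
      rewrite /vdeg (cardD1 v) inE iv add1n; congr _.+1.
      by apply: eq_card => j; rewrite !inE andbC.
    by rewrite cst -natr1; lra.
  rewrite /f; case: ifP => // lj.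
  by rewrite (leaf_unique lj lv ij iv) eqxx in jv.
rewrite /f (negPf nli) expr1n mulr1.
have := leaf_nbr_deg lv vi; case: (d i) => [|[|[|[|]]]] // _; lra.
Qed.

(** The values at the leaves are chosen so that [nbr_sum] vanishes off the core. *)
Definition extend g i : R :=
  if core i then g i else if leaf i then - \sum_(w | e i w) nbr_sum g w else 0.

Lemma nbr_sum_extend g i : (forall j, ~~ core j -> g j = 0) ->
  nbr_sum (extend g) i = (core i)%:R * nbr_sum g i.
Proof.
move=> g0; have [ci|nci] := boolP (core i).
  rewrite mul1r; apply: eq_bigr => j ij; rewrite /extend; case: ifPn => // ncj.
  rewrite g0 //; case: ifP => // lj; case/andP: ci => _ /existsP[].
  by exists j; rewrite lj ij.
rewrite mul0r; have [li|nli] := boolP (leaf i).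
  apply: big1 => j ij; rewrite /extend (negPf (leaf_nonadjacent li ij)).
  by rewrite /core; case: ifP => // /andP[_ /existsP[]]; exists i; rewrite li eC.
move: (nci); rewrite /core nli /= negbK => /existsP[v /andP[lv iv]].
have vi : e v i by rewrite eC.
have ncv : ~~ core v by rewrite /core lv.
rewrite /nbr_sum (bigD1 v) //= {1}/extend lv (negPf ncv).
rewrite (bigD1 i) //= [X in - (_ + X)]big1 => [|w /andP[vw]]; last first.
  by rewrite (leaf_nbr lv vw vi) eqxx.
rewrite addr0 [X in - X]/nbr_sum (bigD1 v) //= (g0 v) // add0r.
apply/eqP; rewrite addrC subr_eq0; apply/eqP; apply: eq_bigr => j /andP[ij jv].
rewrite /extend; case: ifPn => [//|ncj]; rewrite g0 //; case: ifP => // lj.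
by rewrite (leaf_unique lj lv ij iv) eqxx in jv.
Qed.

(** Extending [g] to the leaves can only add mass, and it removes the neighbour sums off the
    core. *)
Lemma core_form_gt0 g : (forall j, ~~ core j -> g j = 0) -> (exists i, g i != 0) ->
  4^-1 * (\sum_i (d i)%:R * g i ^+ 2) <
    \sum_i (core i)%:R / (d i)%:R * nbr_sum g i ^+ 2.
Proof.
move=> g0 [i0 gi0]; have ci0 : core i0.
  by apply: contraT => /g0 E; rewrite E eqxx in gi0.
have := @form_gt0 (extend g); rewrite [X in _ < X](eq_bigr (fun i =>
    (core i)%:R / (d i)%:R * nbr_sum g i ^+ 2)) => [|i _]; last first.
  rewrite nbr_sum_extend //; case: (core i); rewrite ?mul1r ?mul0r ?expr0n ?mul0r //.
  by rewrite mulrC.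
move=> H; apply: le_lt_trans (H _); last by exists i0; rewrite /extend ci0.
rewrite ler_pM2l ?invr_gt0 //; apply: ler_sum => i _; rewrite ler_pM2l //.
rewrite /extend; case: ifPn => // nci; rewrite g0 // expr0n; exact: sqr_ge0.
Qed.

Lemma core_deg i : core i -> (1 < d i)%N.
Proof. by case/andP=> /negPf nl _; have := e_deg i; rewrite leq_eqVlt eq_sym [d i == 1]nl. Qed.

Lemma core_form_delta a b u v : core u -> core v -> u != v -> (a != 0) || (b != 0) ->
  4^-1 * (a ^+ 2 * (d u)%:R + b ^+ 2 * (d v)%:R) <
  a ^+ 2 * common R e core u u + 2 * a * b * common R e core u v +
  b ^+ 2 * common R e core v v.
Proof.
move=> cu cv uv ab; pose g j : R := a * (j == u)%:R + b * (j == v)%:R.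
have gu : g u = a by rewrite /g eqxx (negPf uv) mulr0 addr0 mulr1.
have gv : g v = b by rewrite /g eqxx eq_sym (negPf uv) mulr0 add0r mulr1.
have := @core_form_gt0 g.
have -> : \sum_i (d i)%:R * g i ^+ 2 = a ^+ 2 * (d u)%:R + b ^+ 2 * (d v)%:R.
  rewrite (bigD1 u) //= (bigD1 v) 1?eq_sym //= gu gv big1 => [|i /andP[/negPf iu /negPf iv]].
    by rewrite addr0 ![_ * (d _)%:R]mulrC.
  by rewrite /g iu iv !mulr0 addr0 expr0n mulr0.
have -> : \sum_i (core i)%:R / (d i)%:R * nbr_sum g i ^+ 2 =
  a ^+ 2 * common R e core u u + 2 * a * b * common R e core u v +
  b ^+ 2 * common R e core v v.
  rewrite /common ![\sum_(i | _ && _) _]big_mkcond /= !mulr_sumr -!big_split /=.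
  apply: eq_bigr => i _; rewrite /weight.
  have -> : nbr_sum g i = a * (e i u)%:R + b * (e i v)%:R.
    by rewrite /nbr_sum big_split /= -!mulr_sumr -!nbr_sum_delta.
  rewrite (eC u) (eC v); case: (e i u); case: (e i v) => /=; ring.
apply.
  move=> j ncj; rewrite /g; case: eqP => [ju|_]; first by rewrite ju cu in ncj.
  by case: eqP => [jv|_]; [rewrite jv cv in ncj|rewrite !mulr0 addr0].
by case/orP: ab => ?; [exists u; rewrite gu|exists v; rewrite gv].
Qed.

Lemma form_not_gt0 : False.
Proof.
have [/existsP[u cu]|/existsPn] := boolP [exists u, core u]; last exact: no_core.
have [w wu] : exists w, w != u.
  apply/existsP; apply: contraT; rewrite negb_exists => /forallP all_u.
  have : (#|'I_n| <= #|pred1 u|)%N.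
    by apply/subset_leq_card/fintype.subsetP => i _; rewrite inE; have := all_u i; rewrite negbK.
  by rewrite card_ord card1; lia.
apply: (degree_elimination e_simple core_deg _ _ cu) => [x cx|x y cx cy xy].
  have := @core_form_gt0 (fun j => (j == x)%:R).
  have -> : \sum_i (d i)%:R * (i == x)%:R ^+ 2 = (d x)%:R :> R.
    rewrite (bigD1 x) //= eqxx expr1n mulr1 big1 ?addr0 // => i /negPf->.
    by rewrite expr0n mulr0.
  have -> : \sum_i (core i)%:R / (d i)%:R * nbr_sum (fun j => (j == x)%:R) i ^+ 2 =
      common R e core x x.
    rewrite /common [RHS]big_mkcond; apply: eq_bigr => i _.
    rewrite nbr_sum_delta andbb eC; case: (e x i); first by rewrite expr1n mulr1.
    by rewrite expr0n mulr0.
  rewrite [_ / 4]mulrC; apply.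
    by move=> j ncj; case: eqP => // jx; rewrite jx cx in ncj.
  by exists x; rewrite eqxx oner_neq0.
have pos a b := @core_form_delta a b x y cx cy xy.
have H1 := pos 1 0; rewrite oner_neq0 /= in H1; have {H1} := H1 isT.
set cxx := common R e core x x in pos *; set cxy := common R e core x y in pos *.
set cyy := common R e core y y in pos *.
move=> H1; pose A := cxx - (d x)%:R / 4.
have A0 : 0 < A by rewrite /A; lra.
(* This vector is orthogonal, for the form, to the first basis vector; its value is [A] times the
   determinant. *)
have := pos cxy (- A); rewrite oppr_eq0 (gt_eqF A0) orbT => /(_ isT) H2.
have : A * cxy ^+ 2 < A * (A * (cyy - (d y)%:R / 4)) by rewrite /A in H2 *; lra.
by rewrite ltr_pM2l.
Qed.

End TestFunction.

(** * Diagonalization of real symmetric matrices *)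

Section RealSpectral.
Variables (R : realType) (n : nat) (M : 'M[R]_n).
Hypothesis M_sym : M^T = M.

Let toC := real_complex R.

Lemma real_complex_ex (z : R[i]%C) : z \is Num.real -> z = toC (complex.Re z).
Proof. by move=> zr; apply/esym; exact: RRe_real. Qed.

Lemma map_mx_complex_ex m k (A : 'M[R[i]%C]_(m, k)) : A \is a mxOver Num.real ->
  A = map_mx toC (map_mx (@complex.Re R) A).
Proof.
move=> /mxOverP Ar; apply/matrixP => i j; rewrite !mxE.
exact: real_complex_ex.
Qed.

(** The complex spectral theorem has real eigenvalues here, and similarity of real matrices descends
    from the complex numbers. The resulting [Q] is invertible but need not be orthogonal, hence the
    Gram matrix used later. *)
Lemma real_symmetric_diag : exists (Q : 'M[R]_n) (mu : 'rV[R]_n),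
  Q \in unitmx /\ Q *m M = diag_mx mu *m Q.
Proof.
pose A := map_mx toC M.
have Ar : A \is a mxOver Num.real.
  by apply/mxOverP => i j; rewrite mxE /toC complex_real.
have As : A \is symmetricmx.
  by apply/is_hermitianmxP; rewrite expr0 scale1r map_mx_id // /A map_trmx M_sym.
have Ah := realsym_hermsym As Ar.
have /orthomx_spectralP AE := hermitian_normalmx Ah.
have sr := hermitian_spectral_diag_real Ah.
have Pu := spectral_unit A.
have dr : diag_mx (spectral_diag A) \is a mxOver Num.real.
  apply/mxOverP => i j; rewrite mxE; case: eqP => _; rewrite ?mulr1n ?mulr0n ?real0 //; exact: (mxOverP sr).
have := @real_similar _ _ A (diag_mx (spectral_diag A)) _ Ar dr.
case.
  exists (spectralmx A) => //; apply/similarP => //.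
  by rewrite {2}AE !mulmxA mulmxV // mul1mx.
move=> P /=; rewrite inE => /andP[Pr Pun] /(similarP Pun) PE.
have PC := map_mx_complex_ex Pr.
have sC := map_mx_complex_ex sr.
exists (map_mx (@complex.Re R) P), (map_mx (@complex.Re R) (spectral_diag A)); split.
  by move: Pun; rewrite {1}PC map_unitmx.
apply: (@map_mx_inj _ _ toC); rewrite !map_mxM map_diag_mx -PC -sC.
exact: PE.
Qed.

End RealSpectral.

(** * Spectrum of the normalized adjacency matrix *)

Section GraphSpectrum.
Variables (R : realType) (n : nat) (e : rel 'I_n).
Hypothesis e_simple : simple_graph e.
Hypothesis e_deg : no_isolated_vertex e.
Notation d := (vdeg e).

Let d_gt0 i : 0 < (d i)%:R :> R. Proof. by rewrite ltr0n; exact: e_deg. Qed.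

Definition sqrt_deg i : R := Num.sqrt (d i)%:R.

Lemma sqrt_deg_gt0 i : 0 < sqrt_deg i.
Proof. by rewrite sqrtr_gt0. Qed.

Lemma sqrt_degK i : sqrt_deg i * sqrt_deg i = (d i)%:R.
Proof. by rewrite -expr2 sqr_sqrtr // ltW. Qed.

Definition adjacency : 'M[R]_n := \matrix_(i, j) ((e i j)%:R / (sqrt_deg i * sqrt_deg j)).

Lemma adjacency_sym : adjacency^T = adjacency.
Proof. by apply/matrixP => i j; rewrite !mxE e_simple.1 [sqrt_deg j * _]mulrC. Qed.

Definition scale_deg (x : 'rV[R]_n) : 'rV[R]_n := \row_i (x 0 i * sqrt_deg i).
Definition unscale_deg (x : 'rV[R]_n) : 'rV[R]_n := \row_i (x 0 i / sqrt_deg i).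

Lemma unscale_degK : cancel unscale_deg scale_deg.
Proof. by move=> x; apply/rowP => i; rewrite !mxE divfK // gt_eqF // sqrt_deg_gt0. Qed.

Lemma scale_degK : cancel scale_deg unscale_deg.
Proof. by move=> x; apply/rowP => i; rewrite !mxE mulfK // gt_eqF // sqrt_deg_gt0. Qed.

Definition dot (x y : 'rV[R]_n) : R := (x *m y^T) 0 0.

Lemma dotE x y : dot x y = \sum_i x 0 i * y 0 i.
Proof. by rewrite /dot mxE; apply: eq_bigr => i _; rewrite mxE. Qed.

Lemma dot_ge0 x : 0 <= dot x x.
Proof. by rewrite dotE sumr_ge0 // => i _; rewrite -expr2 sqr_ge0. Qed.

Lemma dot_eq0 x : dot x x = 0 -> x = 0.
Proof.
rewrite dotE => /eqP; rewrite psumr_eq0 => [/allP x0|i _]; last by rewrite -expr2 sqr_ge0.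
apply/rowP => i; rewrite mxE; apply/eqP.
by have := x0 i (mem_index_enum i); rewrite /= mulf_eq0 orbb.
Qed.

Lemma degree_mass2 x : degree_mass e 2 x = dot (scale_deg x) (scale_deg x).
Proof.
rewrite dotE /degree_mass; apply: eq_bigr => i _.
by rewrite !mxE mulrACA sqrt_degK powR_mulrn // real_normK ?num_real // mulrC expr2.
Qed.

Lemma nbr_sum_adjacency x i :
  (scale_deg x *m adjacency) 0 i = nbr_sum e (fun j => x 0 j) i / sqrt_deg i.
Proof.
rewrite mxE /nbr_sum [in RHS]big_mkcond mulr_suml; apply: eq_bigr => j _.
rewrite !mxE e_simple.1; case: (e i j); last by rewrite !mul0r mulr0.
by rewrite /= mulr1n; field; rewrite !gt_eqF // sqrt_deg_gt0.
Qed.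

Lemma edge_energy2 x : edge_energy e 2 x =
  dot (scale_deg x) (scale_deg x) - dot (scale_deg x *m adjacency) (scale_deg x).
Proof.
have -> : dot (scale_deg x *m adjacency) (scale_deg x) =
    \sum_i \sum_(j | e i j) x 0 i * x 0 j.
  rewrite dotE; apply: eq_bigr => i _; rewrite nbr_sum_adjacency mxE.
  rewrite mulrCA divfK ?gt_eqF ?sqrt_deg_gt0 // /nbr_sum mulr_sumr //.
rewrite (sum_edges2 e_simple) -degree_mass2 /degree_mass -(sum_edges e_simple) -sumrB.
apply: eq_bigr => ij _; rewrite !powR_mulrn // !real_normK ?num_real //; ring.
Qed.

Lemma rayleigh2 x : x != 0 -> rayleigh e 2 x =
  1 - dot (scale_deg x *m adjacency) (scale_deg x) / dot (scale_deg x) (scale_deg x).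
Proof.
move=> x0; have := degree_mass_gt0 e_deg 2 x0; rewrite rayleighE edge_energy2 degree_mass2.
by move=> D0; rewrite mulrBl divff // gt_eqF.
Qed.

Section Eigenbasis.
Variables (Q : 'M[R]_n) (mu : 'rV[R]_n).
Hypothesis Q_unit : Q \in unitmx.
Hypothesis Q_diag : Q *m adjacency = diag_mx mu *m Q.
Implicit Types (a : 'rV[R]_n) (h : R -> R).

Let G := Q *m Q^T.

Lemma gram_sym i j : G i j = G j i.
Proof. by rewrite -[in LHS](trmxK G) trmx_mul trmxK mxE. Qed.

Lemma gram_orth i j : G i j != 0 -> mu 0 i = mu 0 j.
Proof.
have E : diag_mx mu *m G = G *m diag_mx mu.
  have : (Q *m adjacency *m Q^T)^T = Q *m adjacency *m Q^T.
    by rewrite !trmx_mul trmxK adjacency_sym mulmxA.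
  rewrite Q_diag -mulmxA -/G trmx_mul tr_diag_mx => <-.
  by congr (_ *m _); apply/matrixP => k l; rewrite mxE gram_sym.
move/matrixP/(_ i j): E; rewrite mul_diag_mx mul_mx_diag !mxE [RHS]mulrC.
by move=> E G0; apply: (mulIf G0).
Qed.

(** The quadratic form of [h] applied to [adjacency], at the vector [a *m Q]. The Gram matrix [G]
    couples only rows of [Q] with the same eigenvalue. *)
Definition spec_form (h : R -> R) (a : 'rV[R]_n) : R :=
  \sum_i \sum_j a 0 i * a 0 j * h (mu 0 i) * G i j.

Lemma dot_mulQ a b : dot (a *m Q) (b *m Q) = \sum_i \sum_j a 0 i * b 0 j * G i j.
Proof.
rewrite /dot trmx_mul mulmxA -[a *m Q *m _]mulmxA -/G mxE.
under eq_bigr do rewrite !mxE mulr_suml.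
rewrite exchange_big; apply: eq_bigr => i _; apply: eq_bigr => j _ /=.
by ring.
Qed.

Lemma spec_form_sq h a : (forall i, a 0 i != 0 -> 0 <= h (mu 0 i)) ->
  spec_form h a = dot ((\row_i (a 0 i * Num.sqrt (h (mu 0 i)))) *m Q)
    ((\row_i (a 0 i * Num.sqrt (h (mu 0 i)))) *m Q).
Proof.
move=> h0; rewrite dot_mulQ; apply: eq_bigr => i _; apply: eq_bigr => j _.
have [->|Gij] := eqVneq (G i j) 0; first by rewrite !mulr0.
rewrite [(\row_l _) 0 i]mxE [(\row_l _) 0 j]mxE.
have [->|ai] := eqVneq (a 0 i) 0; first by rewrite !mul0r.
rewrite -(gram_orth Gij) mulrACA -expr2 sqr_sqrtr //; exact: h0.
Qed.

Lemma spec_form_ge0 h a : (forall i, a 0 i != 0 -> 0 <= h (mu 0 i)) ->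
  0 <= spec_form h a.
Proof. by move=> h0; rewrite spec_form_sq // dot_ge0. Qed.

Lemma spec_form_eq0 h a : (forall i, a 0 i != 0 -> 0 <= h (mu 0 i)) ->
  spec_form h a = 0 -> forall i, a 0 i != 0 -> h (mu 0 i) = 0.
Proof.
move=> h0; rewrite spec_form_sq // => /dot_eq0/(congr1 (mulmx^~ (invmx Q))).
rewrite mulmxK // mul0mx => /rowP E i ai; have := E i; rewrite !mxE => /eqP.
rewrite mulf_eq0 (negPf ai) /= sqrtr_eq0 => hi.
by apply/eqP; rewrite eq_le hi h0.
Qed.

Lemma mulQ_adjacency a : a *m Q *m adjacency = (\row_i (a 0 i * mu 0 i)) *m Q.
Proof.
rewrite -mulmxA Q_diag mulmxA mul_mx_diag; congr (_ *m _).
by apply/rowP => i; rewrite !mxE.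
Qed.

Lemma spec_formB h1 h2 a : spec_form (fun t => h1 t - h2 t) a =
  spec_form h1 a - spec_form h2 a.
Proof.
rewrite /spec_form -sumrB; apply: eq_bigr => i _; rewrite -sumrB.
apply: eq_bigr => j _; ring.
Qed.

Lemma spec_form_cst c a : spec_form (fun=> c) a = c * dot (a *m Q) (a *m Q).
Proof.
rewrite dot_mulQ mulr_sumr; apply: eq_bigr => i _; rewrite mulr_sumr.
apply: eq_bigr => j _; ring.
Qed.

Lemma spec_form_id a : spec_form id a = dot (a *m Q *m adjacency) (a *m Q).
Proof.
rewrite mulQ_adjacency dot_mulQ; apply: eq_bigr => i _; apply: eq_bigr => j _.
rewrite !mxE; ring.
Qed.

Lemma spec_form_sqr a : spec_form (fun t => t ^+ 2) a =
  dot (a *m Q *m adjacency) (a *m Q *m adjacency).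
Proof.
rewrite mulQ_adjacency dot_mulQ; apply: eq_bigr => i _; apply: eq_bigr => j _.
have [->|Gij] := eqVneq (G i j) 0; first by rewrite !mulr0.
rewrite [(\row_l _) 0 i]mxE [(\row_l _) 0 j]mxE.
rewrite -(gram_orth Gij); ring.
Qed.

Lemma small_eigenvalue : (2 < n)%N -> connected_graph e ->
  exists i, `|mu 0 i| <= 2^-1.
Proof.
move=> n2 e_conn; apply: contrapT => no.
have mu2 i : 0 < mu 0 i ^+ 2 - 4^-1.
  have : 2^-1 < `|mu 0 i| by rewrite ltNge; apply/negP => ?; apply: no; exists i.
  rewrite -(real_normK (num_real (mu 0 i))); nra.
apply: (@form_not_gt0 R n e n2 e_simple e_deg e_conn) => f [i0 fi0].
pose x : 'rV[R]_n := \row_i f i.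
have x0 : x != 0 by apply/eqP => /rowP/(_ i0)/eqP; rewrite !mxE (negPf fi0).
pose a := scale_deg x *m invmx Q.
have aQ : a *m Q = scale_deg x by rewrite mulmxKV.
have -> : \sum_i (d i)%:R * f i ^+ 2 = dot (a *m Q) (a *m Q).
  rewrite aQ dotE; apply: eq_bigr => i _; rewrite !mxE mulrACA sqrt_degK; ring.
have -> : \sum_i nbr_sum e f i ^+ 2 / (d i)%:R = dot (a *m Q *m adjacency) (a *m Q *m adjacency).
  rewrite aQ dotE; apply: eq_bigr => i _; rewrite nbr_sum_adjacency -sqrt_degK.
  rewrite (_ : nbr_sum e _ i = nbr_sum e f i); last by apply: eq_bigr => j _; rewrite mxE.
  by field; rewrite gt_eqF // sqrt_deg_gt0.
rewrite -spec_form_cst -spec_form_sqr -subr_gt0 -spec_formB lt_neqAle.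
rewrite spec_form_ge0 ?andbT => [|i _]; last exact: ltW.
apply/eqP => /esym/spec_form_eq0 E; case/eqP: x0.
rewrite -[x]scale_degK -aQ (_ : a = 0).
  by rewrite mul0mx; apply/rowP => i; rewrite !mxE mul0r.
apply/rowP => i; rewrite [RHS]mxE; apply/eqP/negPn/negP => ai.
by have := mu2 i; rewrite (E (fun j _ => ltW (mu2 j)) i ai) ltxx.
Qed.

(** Weights of at most [1/4] bound the trace of the square by [n / 4]. If no eigenvalue is small,
    all squares equal [1/4] and the square is scalar, yet the square roots of the degrees form an
    eigenvector for [1]. *)
Lemma small_eigenvalue4 : (0 < n)%N -> (forall i, (4 <= d i)%N) ->
  exists i, `|mu 0 i| < 2^-1.
Proof.
move=> n0 d4; apply: contrapT => no.
have mu2 i : 4^-1 <= mu 0 i ^+ 2.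
  have : 2^-1 <= `|mu 0 i| by rewrite leNgt; apply/negP => ?; apply: no; exists i.
  rewrite -(real_normK (num_real (mu 0 i))); nra.
have QMM : Q *m (adjacency *m adjacency) = diag_mx (\row_i (mu 0 i ^+ 2)) *m Q.
  by rewrite mulmxA Q_diag -mulmxA Q_diag mulmxA mulmx_diag; congr (diag_mx _ *m _).
have tr : \sum_i mu 0 i ^+ 2 = \tr (adjacency *m adjacency).
  rewrite -(mulKmx Q_unit (adjacency *m adjacency)) QMM mulmxA mxtrace_mulC mulmxA.
  rewrite mulmxV // mul1mx mxtrace_diag; by apply: eq_bigr => i _; rewrite mxE.
have tr_le : \tr (adjacency *m adjacency) <= \sum_(i < n) 4^-1.
  apply: ler_sum => i _; rewrite mxE.
  apply: (@le_trans _ _ (\sum_(j | e i j) ((d i)%:R^-1 * 4^-1))).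
    rewrite [leRHS]big_mkcond; apply: ler_sum => j _.
    rewrite !mxE [e j i]e_simple.1; case: (e i j); last by rewrite !mul0r.
    rewrite -[leRHS]mulr1 [X in X <= _](_ : _ = (d i)%:R^-1 * (d j)%:R^-1).
      rewrite mulr1 ler_pM2l ?invr_gt0 // lef_pV2 ?posrE // ler_nat //.
    by rewrite /= -!sqrt_degK; field; rewrite !gt_eqF // sqrt_deg_gt0.
  by rewrite sum_nbr_const mulrA divff ?mul1r // gt_eqF.
have eq4 i : mu 0 i ^+ 2 = 4^-1.
  apply/eqP; have : \sum_i mu 0 i ^+ 2 == \sum_(i < n) 4^-1.
    by rewrite eq_le tr tr_le -tr ler_sum.
  rewrite -subr_eq0 -sumrB psumr_eq0 => [/allP/(_ i (mem_index_enum i))|j _]; last by rewrite subr_ge0.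
  by rewrite /= subr_eq0.
have MM : adjacency *m adjacency = (4^-1)%:M.
  rewrite -(mulKmx Q_unit (adjacency *m adjacency)) QMM.
  rewrite (_ : diag_mx _ = (4^-1)%:M) ?mul_scalar_mx -?scalemxAr ?mulVmx ?scalemx1 //.
  by rewrite -diag_const_mx; congr diag_mx; apply/rowP => i; rewrite !mxE eq4.
pose w := scale_deg (const_mx 1).
have wM : w *m adjacency = w.
  apply/rowP => i; rewrite nbr_sum_adjacency mxE mxE mul1r.
  rewrite (_ : nbr_sum _ _ _ = (d i)%:R) -?sqrt_degK ?mulfK ?gt_eqF ?sqrt_deg_gt0 //.
  by rewrite /nbr_sum (eq_bigr (fun=> 1)) ?sum_nbr_const ?mulr1 ?sqrt_degK // => j _; rewrite mxE.
have := congr1 (mulmx w) MM; rewrite mulmxA !wM mul_mx_scalar => /rowP/(_ (Ordinal n0)).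
rewrite !mxE mul1r; have := sqrt_deg_gt0 (Ordinal n0); lra.
Qed.

End Eigenbasis.
End GraphSpectrum.


(** * The min-max eigenvalue in the middle *)

Section MiddleEigenvalue.
Variables (R : realType) (n : nat) (e : rel 'I_n).
Hypothesis e_simple : simple_graph e.
Hypothesis e_deg : no_isolated_vertex e.
Variables (Q : 'M[R]_n) (mu : 'rV[R]_n) (i0 : 'I_n).
Hypothesis Q_unit : Q \in unitmx.
Hypothesis Q_diag : Q *m adjacency R e = diag_mx mu *m Q.
Notation d := (vdeg e).
Notation mu0 := (mu 0 i0).
Implicit Types (p c b : R) (x z a : 'rV[R]_n).

Definition eigen_coord x : 'rV[R]_n := scale_deg e x *m invmx Q.
Definition of_eigen_coord a : 'rV[R]_n := unscale_deg e (a *m Q).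

Lemma of_eigen_coordK : cancel of_eigen_coord eigen_coord.
Proof. by move=> a; rewrite /eigen_coord unscale_degK // mulmxK. Qed.

Lemma eigen_coordE x :
  eigen_coord x = x *m (diag_mx (\row_i sqrt_deg R e i) *m invmx Q).
Proof.
rewrite mulmxA /eigen_coord; congr (_ *m _); apply/rowP => i.
by rewrite mul_mx_diag !mxE.
Qed.

Lemma of_eigen_coordE a :
  of_eigen_coord a = a *m (Q *m diag_mx (\row_i (sqrt_deg R e i)^-1)).
Proof. by rewrite mulmxA mul_mx_diag; apply/rowP => i; rewrite !mxE. Qed.

Lemma rayleigh2_spec x : x != 0 ->
  (1 - mu0 - rayleigh e 2 x) * degree_mass e 2 x =
  spec_form Q mu (fun u => u - mu0) (eigen_coord x).
Proof.
move=> x0; rewrite (spec_formB _ _ id (fun=> mu0)) spec_form_cst (spec_form_id Q_diag).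
rewrite mulmxKV // rayleigh2 // degree_mass2 //.
have := degree_mass_gt0 e_deg 2 x0; rewrite degree_mass2 // => D0.
by field; rewrite gt_eqF.
Qed.

Definition eigenvector x := forall i, nbr_sum e (fun j => x 0 j) i = mu0 * (d i)%:R * x 0 i.

Lemma eigen_coord_eigenvector x :
  (forall i, eigen_coord x 0 i != 0 -> mu 0 i = mu0) -> eigenvector x.
Proof.
move=> supp i; have s0 := sqrt_deg_gt0 R e_deg i.
apply: (@mulIf _ (sqrt_deg R e i)^-1); first by rewrite invr_eq0 gt_eqF.
rewrite -nbr_sum_adjacency // -(mulmxKV Q_unit (scale_deg e x)) -/(eigen_coord x).
rewrite (mulQ_adjacency Q_diag) (_ : \row_ _ _ = mu0 *: eigen_coord x).
  rewrite -scalemxAl mulmxKV // !mxE -(sqrt_degK R e i) //.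
  by field; rewrite gt_eqF.
apply/rowP => j; rewrite [LHS]mxE [RHS]mxE [RHS]mulrC.
by have [->|/supp ->//] := eqVneq (eigen_coord x 0 j) 0; rewrite !mul0r.
Qed.

(** [F_2] is [1] minus the quotient of [adjacency], so low eigenvalues of the matrix mean large
    values of [F_2]. *)
Definition low_support x := forall i, mu0 < mu 0 i -> eigen_coord x 0 i = 0.
Definition high_support x := forall i, mu 0 i < mu0 -> eigen_coord x 0 i = 0.

Lemma rayleigh2_low x : x != 0 -> low_support x ->
  1 - mu0 < rayleigh e 2 x \/ rayleigh e 2 x = 1 - mu0 /\ eigenvector x.
Proof.
move=> x0 lowx; have D0 := degree_mass_gt0 e_deg 2 x0.
have supp i : eigen_coord x 0 i != 0 -> 0 <= mu0 - mu 0 i.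
  by rewrite subr_ge0 leNgt => xi; apply: contra_neqN xi; exact: lowx.
have E : (rayleigh e 2 x - (1 - mu0)) * degree_mass e 2 x =
    spec_form Q mu (fun u => mu0 - u) (eigen_coord x).
  rewrite (_ : spec_form _ _ _ _ = - spec_form Q mu (fun u => u - mu0) (eigen_coord x)).
    by rewrite -rayleigh2_spec // -mulNr; congr (_ * _); ring.
  by rewrite (spec_formB _ _ id (fun=> mu0)) (spec_formB _ _ (fun=> mu0) id) opprB.
have : 0 <= rayleigh e 2 x - (1 - mu0).
  by rewrite -(pmulr_lge0 _ D0) E (spec_form_ge0 e_simple Q_diag).
rewrite subr_ge0 le_eqVlt => /orP[/eqP R1|]; [right|by left].
split=> //; apply: eigen_coord_eigenvector => i xi.
move: E; rewrite -R1 subrr mul0r => /esym/(spec_form_eq0 e_simple Q_unit Q_diag) => /(_ supp i xi) /eqP.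
by rewrite subr_eq0 => /eqP.
Qed.

Lemma rayleigh2_high x : x != 0 -> high_support x ->
  rayleigh e 2 x < 1 - mu0 \/ rayleigh e 2 x = 1 - mu0 /\ eigenvector x.
Proof.
move=> x0 highx; have D0 := degree_mass_gt0 e_deg 2 x0.
have supp i : eigen_coord x 0 i != 0 -> 0 <= mu 0 i - mu0.
  by rewrite subr_ge0 leNgt => xi; apply: contra_neqN xi; exact: highx.
have E := rayleigh2_spec x0.
have : 0 <= 1 - mu0 - rayleigh e 2 x.
  by rewrite -(pmulr_lge0 _ D0) E (spec_form_ge0 e_simple Q_diag).
rewrite subr_ge0 le_eqVlt => /orP[/eqP R1|]; [right|by left].
split=> //; apply: eigen_coord_eigenvector => i xi.
move: E; rewrite -R1 subrr mul0r => /esym/(spec_form_eq0 e_simple Q_unit Q_diag) => /(_ supp i xi) /eqP.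
by rewrite subr_eq0 => /eqP.
Qed.

(* If [|x|] were constant, the equation at a vertex [i] would say that the
   neighbours of [i] whose sign agrees with that of [i] minus the others
   number [d i / 2] in absolute value, so that [4] would divide [d i]. *)
Lemma eigenvector_edge x : connected_graph e -> `|mu0| = 2^-1 ->
  (exists i, (d i < 4)%N) -> x != 0 -> eigenvector x ->
  exists i j, [/\ e i j, x 0 i != x 0 j & x 0 i != - x 0 j].
Proof.
move=> [_ conn] mu_half [i1 d4] x0 eigx; apply: contrapT => no.
have edge i j : e i j -> `|x 0 i| = `|x 0 j|.
  move=> eij; apply/eqP; rewrite eqr_norm2; apply: contrapT => /negP.
  by rewrite negb_or => /andP[? ?]; apply: no; exists i, j.
have const i j : `|x 0 i| = `|x 0 j|.
  have /connectP[s sp ->] := conn i j.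
  elim: s i sp => //= k s IH i /andP[eik /IH <-]; exact: edge.
have xi1 : x 0 i1 != 0.
  apply: contra_neq x0 => x1; apply/rowP => i; rewrite mxE; apply/eqP.
  by rewrite -normr_eq0 (const i i1) x1 normr0.
pose s := #|[pred j | e i1 j & x 0 j == x 0 i1]|.
pose o := #|[pred j | e i1 j & x 0 j != x 0 i1]|.
have ds : d i1 = (s + o)%N.
  rewrite /vdeg -(cardID [pred j | x 0 j == x 0 i1]); congr (_ + _)%N.
  by apply: eq_card => j; rewrite !inE andbC.
have E : (s%:R - o%:R : R) = mu0 * (d i1)%:R.
  apply: (mulIf xi1); rewrite -eigx /nbr_sum (bigID (fun j => x 0 j == x 0 i1)) /=.
  rewrite mulrBl; congr (_ + _).
    rewrite /s -sum1_card natr_sum mulr_suml.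
    by apply: eq_big => [j|j /andP[_ /eqP ->]]; rewrite ?inE ?mul1r.
  rewrite /o -sum1_card natr_sum mulr_suml -sumrN.
  apply: eq_big => [j|j /andP[_ xj]]; rewrite ?inE ?mul1r //.
  by have /eqP := const j i1; rewrite eqr_norm2 (negPf xj) => /eqP ->.
have d1 := e_deg i1.
have mu_pm : mu0 = 2^-1 \/ mu0 = - 2^-1.
  by move: mu_half; case: (ger0P mu0) => ? ?; [left|right]; lra.
(* From [s - o = +-(s + o) / 2]. Either way the degree [s + o] is a multiple of [4], though it lies
   between [1] and [3]. *)
have {E} : (s = 3 * o \/ o = 3 * s)%N.
  case: mu_pm => mu_eq; [left|right]; apply/eqP; rewrite -(eqr_nat R) natrM;
    apply/eqP; move: E; rewrite mu_eq ds natrD; lra.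
by lia.
Qed.

Hypothesis e_conn : connected_graph e.
Hypothesis mu_half : `|mu0| <= 2^-1.
Hypothesis mu_strict : `|mu0| < 2^-1 \/ exists i, (d i < 4)%N.

Lemma rayleigh2_low_strict x : x != 0 -> low_support x ->
  2^-1 < rayleigh e 2 x \/ rayleigh e 2 x = 2^-1 /\
    exists i j, [/\ e i j, x 0 i != x 0 j & x 0 i != - x 0 j].
Proof.
move=> x0 /(rayleigh2_low x0); have := mu_half; rewrite ler_norml => /andP[mul muu].
case=> [?|[-> eigx]]; first by left; lra.
have [?|mu1] := ltP (2^-1) (1 - mu0); first by left.
have mu0E : mu0 = 2^-1 by lra.
right; split; first by lra.
have nmu : `|mu0| = 2^-1 by rewrite mu0E ger0_norm // invr_ge0.
by case: mu_strict => [|d4]; [rewrite nmu ltxx|exact: eigenvector_edge].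
Qed.

Lemma rayleigh2_high_strict x : x != 0 -> high_support x ->
  rayleigh e 2 x < 3 / 2 \/ rayleigh e 2 x = 3 / 2 /\
    exists i j, [/\ e i j, x 0 i != x 0 j & x 0 i != - x 0 j].
Proof.
move=> x0 /(rayleigh2_high x0); have := mu_half; rewrite ler_norml => /andP[mul muu].
case=> [?|[-> eigx]]; first by left; lra.
have [?|mu1] := ltP (1 - mu0) (3 / 2); first by left.
have mu0E : mu0 = - 2^-1 by lra.
right; split; first by lra.
have nmu : `|mu0| = 2^-1 by rewrite mu0E normrN ger0_norm // invr_ge0.
by case: mu_strict => [|d4]; [rewrite nmu ltxx|exact: eigenvector_edge].
Qed.

Let spow2 p x := map_mx (spow (p / 2)) x.

Let spow2K p x : 0 < p -> map_mx (spow (2 / p)) (spow2 p x) = x.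
Proof.
move=> p0; apply/rowP => i; rewrite !mxE -invf_div spowK //.
by rewrite mulf_neq0 ?invr_eq0 ?gt_eqF.
Qed.

Let spow2_eq0 p x : 0 < p -> (spow2 p x == 0) = (x == 0).
Proof. by move=> p0; rewrite map_spow_eq0 // mulf_neq0 ?invr_eq0 ?gt_eqF. Qed.

Let spow2_id x : spow2 2 x = x.
Proof.
apply/rowP => i; rewrite mxE divff ?pnatr_eq0 // /spow powRr1 //.
by rewrite mulr_sg_norm.
Qed.

(** [F_2] is at least [1/2] and the comparison contributes the factor [2^(p - 2)]. If [F_2] is
    exactly [1/2], an edge whose end values differ in modulus makes the comparison strict. *)
Lemma rayleigh_low_lt2 p z : 1 <= p -> p < 2 -> z != 0 -> low_support (spow2 p z) ->
  2 `^ (p - 3) < rayleigh e p z.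
Proof.
move=> p1 p2 z0 supp; have p0 : 0 < p by lra.
have x0 : spow2 p z != 0 by rewrite spow2_eq0.
have t1 : 1 < 2 / p by rewrite ltr_pdivlMr // mul1r.
have tp : 2 / p * p = 2 by rewrite divfK // gt_eqF.
rewrite (_ : 2 `^ (p - 3) = 2 `^ (p - 2 / p * p) * 2^-1); last first.
  rewrite tp (_ : p - 3 = p - 2 + -1); last by ring.
  by rewrite powRD ?powR_inv1 ?pnatr_eq0 ?implybT //.
have := @rayleigh_spow_ge R n e e_deg (2 / p) p (spow2 p z) (ltW t1) p1 x0.
have gt := @rayleigh_spow_gt R n e e_simple e_deg (2 / p) p (spow2 p z) _ _ t1 p1 x0.
rewrite spow2K // in gt *; have pos : 0 < 2 `^ (p - 2 / p * p) :> R by rewrite powR_gt0.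
case: (rayleigh2_low_strict x0 supp) => [R2 ge|[R2 [i [j [eij xij xijN]]]] _].
  by apply: lt_le_trans ge; rewrite ltr_pM2l // tp.
by move: (gt i j eij xij xijN); rewrite [in X in _ * X]tp R2.
Qed.

(** The comparison with [t = 2 / p] and [T = 3], from [F_2 <= 3/2], is strict by itself. *)
Lemma rayleigh_high_lt2 p z : 1 <= p -> p < 2 -> z != 0 -> high_support (spow2 p z) ->
  rayleigh e p z < 2 `^ (p - 1) * (Num.sqrt 3 / p) `^ p.
Proof.
move=> p1 p2 z0 supp; have p0 : 0 < p by lra.
have x0 : spow2 p z != 0 by rewrite spow2_eq0.
have t1 : 1 < 2 / p by rewrite ltr_pdivlMr // mul1r.
have tp : 2 / p * p = 2 by rewrite divfK // gt_eqF.
have R2 : rayleigh e 2 (spow2 p z) <= 3 / 2.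
  by case: (rayleigh2_high_strict x0 supp) => [/ltW|[->]].
have := @rayleigh_spow_lt R n e e_simple e_deg (2 / p) p 3 (spow2 p z) t1 p1 _ x0.
rewrite tp spow2K // => /(_ (ltr0n _ _) R2); congr (_ < _).
have -> : (Num.sqrt 3 / p) `^ p = 3 `^ (p / 2) / p `^ p :> R.
  rewrite powRM ?sqrtr_ge0 ?invr_ge0 ?(ltW p0) // -powR12_sqrt // -powRrM.
  by rewrite -[p^-1]powR_inv1 ?(ltW p0) // -powRrM mulN1r powRN [2^-1 * p]mulrC.
by rewrite mulrAC -powR2_div // invf_div -mulrA [_^-1 * _]mulrC.
Qed.

Lemma rayleigh_low_gt2 p z : 2 < p -> z != 0 -> low_support (spow2 p z) ->
  2 `^ (p - 1) / p `^ p < rayleigh e p z.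
Proof.
move=> p2 z0 supp; have p0 : 0 < p by lra.
have x0 : spow2 p z != 0 by rewrite spow2_eq0.
have t1 : 1 < p / 2 by rewrite ltr_pdivlMr // mul1r.
have tp : p / 2 * 2 = p by rewrite divfK.
have T0 : 0 < (2 / p) `^ p by rewrite powR_gt0 // divr_gt0.
rewrite powR2_div // ltNge; apply/negP => Rp.
have := @rayleigh_spow_lt R n e e_simple e_deg (p / 2) 2 _ z t1 (ler1n _ 2) T0 z0.
rewrite tp => /(_ Rp).
have -> : (p / 2) `^ 2 * ((2 / p) `^ p) `^ (p / 2)^-1 / 2 = 2^-1.
  rewrite -powRrM invf_div mulrCA divff ?gt_eqF // mulr1 -powRM ?divr_ge0 ?(ltW p0) //.
  by rewrite mulrA divfK // divff ?gt_eqF // powR1 mul1r.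
rewrite ltNge => /negP; apply.
by case: (rayleigh2_low_strict x0 supp) => [/ltW|[->]].
Qed.

(** Beyond [p = 2] the two comparisons exchange roles: [2^(2 - p) F_p <= F_2] now yields the upper
    bound. *)
Lemma rayleigh_high_gt2 p z : 2 < p -> z != 0 -> high_support (spow2 p z) ->
  rayleigh e p z < 3 * 2 `^ (p - 3).
Proof.
move=> p2 z0 supp; have p0 : 0 < p by lra.
have x0 : spow2 p z != 0 by rewrite spow2_eq0.
have t1 : 1 < p / 2 by rewrite ltr_pdivlMr // mul1r.
have tp : p / 2 * 2 = p by rewrite divfK.
have pos : 0 < 2 `^ (2 - p) :> R by rewrite powR_gt0.
rewrite -(ltr_pM2l pos) (_ : 2 `^ (2 - p) * (3 * _) = 3 / 2); last first.
  rewrite mulrCA -powRD ?pnatr_eq0 ?implybT // (_ : 2 - p + _ = -1); last by ring.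
  by rewrite powR_inv1.
have := @rayleigh_spow_ge R n e e_deg (p / 2) 2 z (ltW t1) (ler1n _ 2) z0.
have gt := @rayleigh_spow_gt R n e e_simple e_deg (p / 2) 2 z _ _ t1 (ler1n _ 2) z0.
rewrite tp in gt *.
case: (rayleigh2_high_strict x0 supp) => [R2 /le_lt_trans->//|[R2 [i [j [eij xij xijN]]]] _].
rewrite -R2; apply: (gt i j) => //.
  by apply: contra_neq xij => zij; rewrite !mxE zij.
by apply: contra_neq xijN => zij; rewrite !mxE zij spowN.
Qed.

Let U := [set i | mu0 <= mu 0 i]%SET.
Let V := [set i | mu0 < mu 0 i]%SET.

Lemma card_above : (#|V| < #|U|)%N.
Proof.
apply: proper_card; apply/properP; split.
  by apply/fintype.subsetP => i; rewrite !inE; exact: ltW.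
by exists i0; rewrite !inE ?lexx ?ltxx.
Qed.

(** One index for both bounds: it exceeds the number of odd functions and equals the dimension of
    the spanned space. *)
Lemma middle_index : exists2 k : 'I_n, (#|V| < k.+1)%N & k.+1 = #|U|.
Proof.
have UV := card_above; have Un : (#|U|.-1 < n)%N.
  by have := max_card U; rewrite card_ord => ?; lia.
by exists (Ordinal Un) => /=; rewrite prednK //; exact: leq_ltn_trans UV.
Qed.

Let F p (j : 'I_#|V|) z : R := eigen_coord (spow2 p z) 0 (enum_val j).

Let F_low p z : (forall j, F p j z = 0) -> low_support (spow2 p z).
Proof.
move=> Fz i mui; have iV : i \in V by rewrite inE.
by have := Fz (enum_rank_in iV i); rewrite /F enum_rankK_in.
Qed.

Let F_odd p j z : F p j (- z) = - F p j z.
Proof. by rewrite /F /spow2 map_spowN eigen_coordE mulNmx mxE -eigen_coordE. Qed.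

Let F_continuous p j : 0 < p -> continuous (F p j).
Proof.
move=> p0 z; rewrite /F.
apply: (@continuous_comp _ _ _ (fun z => eigen_coord (spow2 p z))
  (fun y : 'rV[R]_n => y 0 (enum_val j))); last exact: coord_continuous.
apply: (@continuous_comp _ _ _ (spow2 p) eigen_coord).
  by apply: map_spow_continuous; rewrite divr_gt0.
rewrite (_ : eigen_coord = mulmx^~ (diag_mx (\row_i sqrt_deg R e i) *m invmx Q)).
  exact: mulmx_row_continuous.
by apply/funext => y; rewrite eigen_coordE.
Qed.

Let F_homogeneous p b z j : 0 < p -> 0 < b -> F p j z = 0 -> F p j (b *: z) = 0.
Proof.
move=> p0 b0; rewrite /F /spow2 map_spowZ ?(ltW b0) ?gt_eqF ?divr_gt0 //.
by move=> Fz; rewrite eigen_coordE -scalemxAl mxE -eigen_coordE Fz mulr0.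
Qed.

Section Span.
Variable p : R.
Hypothesis p_gt0 : 0 < p.

Let pick : 'M[R]_(#|U|, n) := \matrix_(l, i) (enum_val l == i)%:R.

(** Spans the eigenvectors for eigenvalues at least [mu0], then returns from exponent [2] to
    exponent [p]. *)
Definition span_high (a : 'rV[R]_#|U|) : 'rV[R]_n :=
  map_mx (spow (2 / p)) (of_eigen_coord (a *m pick)).

Lemma span_high_continuous : continuous span_high.
Proof.
move=> a; rewrite /span_high.
apply: (@continuous_comp _ _ _ (fun a : 'rV[R]_#|U| => of_eigen_coord (a *m pick))
  (map_mx (spow (2 / p)))); last by apply: map_spow_continuous; rewrite divr_gt0.
rewrite (_ : (fun _ => _) = mulmx^~ (pick *m (Q *m diag_mx (\row_i (sqrt_deg R e i)^-1)))).
  exact: mulmx_row_continuous.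
by apply/funext => b; rewrite of_eigen_coordE !mulmxA.
Qed.

Lemma span_highN (a : 'rV[R]_#|U|) : span_high (- a) = - span_high a.
Proof.
by rewrite /span_high mulNmx of_eigen_coordE mulNmx -of_eigen_coordE map_spowN.
Qed.

Lemma spow2_span_high (a : 'rV[R]_#|U|) : spow2 p (span_high a) = of_eigen_coord (a *m pick).
Proof.
apply/rowP => i; rewrite !mxE -[p / 2]invf_div spowK //.
by rewrite mulf_neq0 ?invr_eq0 ?gt_eqF.
Qed.

Lemma span_high_eq0 (a : 'rV[R]_#|U|) : span_high a = 0 -> a = 0.
Proof.
move=> /(congr1 (spow2 p)); rewrite spow2_span_high => a0.
have {}a0 : of_eigen_coord (a *m pick) = of_eigen_coord 0.
  rewrite a0 of_eigen_coordE mul0mx; apply/eqP.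
  by rewrite /spow2 map_spow_eq0 ?gt_eqF ?divr_gt0.
have /rowP E := can_inj of_eigen_coordK a0; apply/rowP => l.
have := E (enum_val l); rewrite !mxE (bigD1 l) //= mxE eqxx mulr1 big1 ?addr0 //.
by move=> m ml; rewrite mxE (inj_eq enum_val_inj) (negPf ml) mulr0.
Qed.

Lemma span_high_support (a : 'rV[R]_#|U|) : high_support (spow2 p (span_high a)).
Proof.
move=> i mui; rewrite spow2_span_high of_eigen_coordK mxE big1 // => l _.
rewrite mxE; case: eqP => [il|_]; last by rewrite mulr0.
by have := enum_valP l; rewrite il inE leNgt mui.
Qed.

End Span.

Lemma middle_eigenvalue : exists k : 'I_n, forall p, 1 <= p ->
  minmax_eigenvalue e p k.+1 \in
    (if p < 2 then
       `](2 `^ (p - 3))%:E, (2 `^ (p - 1) * (Num.sqrt 3 / p) `^ p)%:E[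
     else if p == 2 then `[(1 / 2)%:E, (3 / 2)%:E]
     else `](2 `^ (p - 1) / p `^ p)%:E, (3 * 2 `^ (p - 3))%:E[).
Proof.
have [k Vk kU] := middle_index; exists k => p p1; have p0 : 0 < p by lra.
have low_gt c : (forall z, z != 0 -> low_support (spow2 p z) -> c < rayleigh e p z) ->
    (c%:E < minmax_eigenvalue e p k.+1)%E.
  move=> cR; apply: (minmax_eigenvalue_gt e_deg (F := F p) _ _ Vk p0) => [j|j x|a x j|x x0 Fx].
  - exact: F_continuous.
  - exact: F_odd.
  - exact: F_homogeneous.
  by apply: cR => //; exact: F_low.
have high_neq0 (a : 'rV[R]_#|U|) : a != 0 -> span_high p a != 0.
  by apply: contra_neq; exact: span_high_eq0.
have high_lt c : (forall z, z != 0 -> high_support (spow2 p z) -> rayleigh e p z < c) ->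
    (minmax_eigenvalue e p k.+1 < c%:E)%E.
  move=> cR; rewrite kU; apply: (minmax_eigenvalue_lt e_deg (f := span_high p)) => //.
  - exact: span_high_continuous.
  - exact: span_highN.
  - exact: span_high_eq0.
  - by rewrite -kU.
  by move=> a a0; apply: cR; [exact: high_neq0|exact: span_high_support].
have [p2|p2|p2] := ltgtP p 2.
- rewrite in_itv /= low_gt ?high_lt // => z z0; first exact: rayleigh_high_lt2.
  exact: rayleigh_low_lt2.
- rewrite in_itv /= low_gt ?high_lt // => z z0; first exact: rayleigh_high_gt2.
  exact: rayleigh_low_gt2.
rewrite in_itv /=; apply/andP; split.
  apply: (minmax_eigenvalue_ge (F := F p) _ _ Vk) => [j|j x|x x0 Fx].
  - exact: F_continuous.
  - exact: F_odd.
  have := F_low Fx; rewrite p2 spow2_id div1r => /(rayleigh2_low_strict x0).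
  by case=> [/ltW|[->]].
rewrite kU; apply: (minmax_eigenvalue_le (f := span_high p)) => //.
- exact: span_high_continuous.
- exact: span_highN.
- exact: span_high_eq0.
move=> a /high_neq0 fa0; have := span_high_support p0 a.
rewrite {1}p2 spow2_id => high; rewrite {1}p2.
by case: (rayleigh2_high_strict fa0 high) => [/ltW|[->]].
Qed.

End MiddleEigenvalue.

Theorem theorem1p5 (R : realType) :
  (* The graph with two vertices and one edge is excluded: its eigenvalues are
     0 and 2 `^ (p - 1), which for p = 2 are not in [1/2, 3/2]. *)
  (forall (n : nat) (e : rel 'I_n) (p : R),
     (2 < n)%N -> simple_graph e -> no_isolated_vertex e -> connected_graph e ->
     1 <= p ->
     exists k : 'I_n,
       minmax_eigenvalue e p k.+1 \in
         (if p < 2 then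
            `](2 `^ (p - 3))%:E,
              (2 `^ (p - 1) * (Num.sqrt 3 / p) `^ p)%:E[
          else if p == 2 then
            `[(1 / 2)%:E, (3 / 2)%:E]
          else
            `](2 `^ (p - 1) / p `^ p)%:E, (3 * 2 `^ (p - 3))%:E[))
  /\
  (forall (n : nat) (e : rel 'I_n),
     simple_graph e -> no_isolated_vertex e ->
     (forall p : R, 1 < p ->
        (pseudo_independence e <=
           #|[pred k : 'I_n | ((2 `^ (p - 1) / p `^ p)%:E
                                 < minmax_eigenvalue e p k.+1)%E]|)%N) /\
     (pseudo_independence e <=
        #|[pred k : 'I_n | minmax_eigenvalue e (1 : R) k.+1 == 1%E]|)%N).
Proof.
split=> [n e p n2 e_simple e_deg e_conn|n e e_simple e_deg].
  have [Q [mu [Q_unit Q_diag]]] := real_symmetric_diag (adjacency_sym R e_simple).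
  suff [i0 mu_half mu_strict] : exists2 i, `|mu 0 i| <= 2^-1 &
      `|mu 0 i| < 2^-1 \/ exists j, (vdeg e j < 4)%N.
    have [k kP] := middle_eigenvalue e_simple e_deg Q_unit Q_diag e_conn mu_half mu_strict.
    by exists k; exact: kP.
  (* If all degrees are at least [4], the trace argument gives an eigenvalue strictly inside;
     otherwise a vertex of degree below [4] excludes eigenvectors of constant modulus for
     [+-1/2]. *)
  have [d4|/existsNP[j /negP dj]] := pselect (forall i, 4 <= vdeg e i)%N.
    have n0 : (0 < n)%N by apply: leq_trans n2.
    have [i mui] := small_eigenvalue4 e_simple e_deg Q_unit Q_diag n0 d4.
    by exists i; [exact: ltW|left].
  have [i mui] := small_eigenvalue e_simple e_deg Q_unit Q_diag n2 e_conn.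
  by exists i => //; right; exists j; rewrite ltnNge.
split=> [p p1|]; apply/bigmax_leqP => P P_nonadj.
  exact: pseudo_independence_gt.
exact: pseudo_independence_eq1.
Qed.
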